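(* The Aganagic-Vafa conjecture holds for the resolved conifold with the outer brane in zero framing. That is, near $x=0$ the plane curve (mirror curve) $$x+y-1-xy^{-1}e^{-t}=0$$ determines a function $y=y(x;t)$, with $y(0;t)=1$, such that $$x\frac{\partial}{\partial x}\Psi^{(0)}_{0,1}(t;x)=\log y(x;t).$$
   Context: Notation: $i=\sqrt{-1}$, $q=e^{i\lambda}$, $q^{1/2}=e^{i\lambda/2}$, $Q=-e^{-t}$. $\mathbf p=(p_1,p_2,\dots)$ are commuting formal variables and $p_\eta=\prod_j p_{\eta_j}$. For a partition $\mu$: $|\mu|$ is its size, $l(\mu)$ its length, $\mu^t$ its transpose, $\kappa_\mu=\sum_j\mu_j(\mu_j-2j+1)$, $z_\mu=\prod_{j}j^{m_j(\mu)}m_j(\mu)!$ with $m_j(\mu)$ the multiplicity of $j$ in $\mu$; $\chi_\mu(\eta)$ is the value of the irreducible character of $S_{|\mu|}$ indexed by $\mu$ on the class of cycle type $\eta$ (taken to be $0$ if $|\mu|\ne|\eta|$). $W_{\mu,\nu}(q)$ is the rational function of $q^{1/2}$ given by $W_{\mu,\nu}(q)=s_\mu(q^{\rho})\,s_\nu(q^{\mu+\rho})$, where $s$ denotes Schur functions, $q^\rho=(q^{-1/2},q^{-3/2},\dots)$ and $q^{\mu+\rho}=(q^{\mu_j-j+1/2})_{j\ge1}$ (sums convergent for $|q|>1$), and $W_\nu(q)=s_\nu(q^\rho)$. The open string amplitude of the resolved conifold with one outer brane and framing $a\in\mathbb Z$ is $$Z^{(a)}(\lambda;t;\mathbf p)=\sum_{\mu,\nu,\eta}q^{a\kappa_\mu/2}W_{\mu,\nu}(q)\,Q^{|\nu|}\,W_{\nu^t}(q)\,\frac{\chi_\mu(\eta)}{z_\eta\,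 i^{\,l(\eta)}}\,p_\eta$$ (sum over all partitions, a formal power series in $Q$ and the $p_n$). Put $\hat Z^{(a)}(\lambda;t;\mathbf p)=Z^{(a)}(\lambda;t;\mathbf p)/Z^{(a)}(\lambda;t;0)$ and $F^{(a)}=\log\hat Z^{(a)}$. The one-point function $F^{(a)}_n(\lambda;t)$ is the coefficient of the linear monomial $p_n$ in $F^{(a)}$; it is expanded as $F^{(a)}_n(\lambda;t)=\sum_{g\ge0}\lambda^{2g-1}F^{(a)}_{g;n}(t)$, and $\Psi^{(a)}_{0,1}(t;x)=\sum_{n\ge1}F^{(a)}_{0;n}(t)\,x^n$; the theorem concerns $a=0$. The Aganagic-Vafa conjecture asserts that the mirror curve $h(x,y)=0$ determines, near $x=0$, a function $y$ whose logarithm is $x\,\partial_x$ of the genus $0$ one-point open string function. *)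

(* Defs.v *)
From HB Require Import structures.
From mathcomp Require Import all_boot all_order all_algebra all_fingroup all_field all_character.

Set Implicit Arguments.
Unset Strict Implicit.
Unset Printing Implicit Defensive.

Import Order.TTheory GRing.Theory Num.Theory.
Local Open Scope ring_scope.

Definition is_part (mu : seq nat) : bool := sorted geq mu && (0%N \notin mu).

Definition conj_part (mu : seq nat) : seq nat :=
  mkseq (fun j => count (fun k => j < k)%N mu) (head 0%N mu).

(* With 0-based j, the summand mu_j (mu_j - 2j + 1) reads
   mu_j (mu_j - 2j - 1). *)
Definition kappa (mu : seq nat) : int :=
  \sum_(j < size mu) (nth 0%N mu j)%:Z * ((nth 0%N mu j)%:Z - (j.*2)%:Z - 1).

Definition zpart (mu : seq nat) : nat :=
  (\prod_(j <- undup mu) (j ^ count_mem j mu * (count_mem j mu)`!))%N.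

Definition cycle_type_is (n : nat) (eta : seq nat) (s : 'S_n) : bool :=
  perm_eq [seq #|X| | X : {set 'I_n} <- enum (porbits s)] eta.

(* The Young subgroup S_mu: permutations preserving the consecutive blocks of
   lengths mu_1, mu_2, ... *)
Definition young (n : nat) (mu : seq nat) : {set 'S_n} :=
  [set s : 'S_n | [forall i : 'I_n,
     reshape_index mu (s i) == reshape_index mu i]].

(* The irreducible character indexed by mu (James-Kerber): the only one whose
   restriction to S_mu contains the trivial character and whose restriction to
   S_{mu^t} contains the sign character. The two sums below are the
   corresponding multiplicities, times the orders of the subgroups. *)
Definition indexed_by (mu : seq nat) (i : Iirr [set: 'S_(sumn mu)]) : bool :=
  (\sum_(s in young (sumn mu) mu) 'chi_i s != 0) &&
  (\sum_(s in young (sumn mu) (conj_part mu)) (-1) ^+ (s : bool) * 'chi_i s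
     != 0).
Arguments indexed_by : clear implicits.

(* No permutation of sumn mu points has cycle type eta when |mu| <> |eta|, so
   the value is then 0. Characters of symmetric groups are integer-valued, so
   Num.floor only moves the value from algC to int. *)
Definition chi (mu eta : seq nat) : int :=
  match [pick i : Iirr [set: 'S_(sumn mu)] | indexed_by mu i],
        [pick s : 'S_(sumn mu) | cycle_type_is eta s] with
  | Some i, Some s => Num.floor ('chi_i s)
  | _, _ => 0
  end.

(* Required here because their [set: _] and [set _ | _] notations hide those of
   finite sets used above. *)
From mathcomp Require Import complex.
From mathcomp Require Import all_classical all_reals all_analysis.
Import Order.TTheory GRing.Theory Num.Theory.
Import numFieldNormedType.Exports.
Local Open Scope classical_set_scope.

Definition parts (n : nat) : set (seq nat) :=
  [set mu | is_part mu /\ sumn mu = n].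

(* Formal power series in Q and p_1, p_2, ...: f d eta is the coefficient of
   Q ^ d * p_eta, for eta a partition. *)

Section FormalSeries.
Variable K : fieldType.

Definition fps := nat -> seq nat -> K.

Definition fone : fps := fun d eta => ((d == 0%N) && (eta == [::]))%:R.

Definition fsub (f g : fps) : fps := fun d eta => f d eta - g d eta.

Definition splits (eta : seq nat) : set (seq nat * seq nat) :=
  [set ab | [/\ is_part ab.1, is_part ab.2 & perm_eq (ab.1 ++ ab.2) eta]].

Definition fmul (f g : fps) : fps := fun d eta =>
  \sum_(k < d.+1) \sum_(ab \in splits eta) f k ab.1 * g (d - k)%N ab.2.

Definition fpow (f : fps) (k : nat) : fps := iter k (fmul f) fone.

(* Inverse and logarithm of a series with constant term 1, through
   sum_k (1 - f) ^ k and - sum_(k >= 1) (1 - f) ^ k / k. As 1 - f has no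
   constant term, its k-th power has no term Q ^ d * p_eta for
   k > d + l(eta), so the truncated sums are exact. *)
Definition finv (f : fps) : fps := fun d eta =>
  \sum_(k < (d + size eta).+1) fpow (fsub fone f) k d eta.

Definition flog (f : fps) : fps := fun d eta =>
  - \sum_(1 <= k < (d + size eta).+1) fpow (fsub fone f) k d eta / k%:R.

(* The value at p = 0 *)
Definition at_p0 (f : fps) : fps := fun d eta =>
  if eta == [::] then f d [::] else 0.

End FormalSeries.

(* R[i] with the topology of the modulus, as a normed module over itself, so
   that derivatives on R[i] are complex derivatives. *)
HB.instance Definition _ (R : realType) := NormedModule.copy R[i] R[i]^o.

Section Conifold.
Variable R : realType.
Local Notation C := R[i].
Local Notation ratfun := {fraction {poly R[i]}}.

Definition cexp (z : C) : C :=
  (expR (complex.Re z))%:C%C *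
  Complex (cos (complex.Im z)) (sin (complex.Im z)).

(* Principal branch *)
Definition clog (z : C) : C :=
  xget 0 [set w | cexp w = z /\ - pi < complex.Im w <= pi].

(* Schur polynomial s_mu(x_0, ..., x_(N-1)) as a ratio of alternants, for
   pairwise distinct x_i *)
Definition schur_poly (mu : seq nat) (x : nat -> C) (N : nat) : C :=
  if (size mu <= N)%N then
    \det (\matrix_(i < N, j < N) x i ^+ (nth 0%N mu j + (N - j.+1))) /
    \det (\matrix_(i < N, j < N) x i ^+ (N - j.+1))
  else 0.

(* Schur function of infinitely many variables: sum over all monomials, i.e. limit
   of the Schur polynomials *)
Definition schur (mu : seq nat) (x : nat -> C) : C :=
  limn (schur_poly mu x).

(* q ^ (mu + rho) in terms of u = q ^ (1/2); with 0-based j, the exponent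
   mu_j - j + 1/2 of q is mu_j - j - 1/2. For mu empty this is q ^ rho. *)
Definition qpow (mu : seq nat) (u : C) (j : nat) : C :=
  u ^ (((nth 0%N mu j).*2)%:Z - (j.*2)%:Z - 1).

Definition is_frac (w : ratfun) (P D : {poly C}) : Prop :=
  D != 0 /\ w = tofrac P / tofrac D.

(* The rational function of u whose value is f u for all |u| > 1 *)
Definition ratfun_of (f : C -> C) : ratfun :=
  xget 0 [set w | exists P D, is_frac w P D /\
    forall u : C, 1 < `|u| -> D.[u] != 0 /\ f u = P.[u] / D.[u]].

Definition W (mu nu : seq nat) : ratfun :=
  ratfun_of (fun u => schur mu (qpow [::] u) * schur nu (qpow mu u)).

Definition W1 (nu : seq nat) : ratfun :=
  ratfun_of (fun u => schur nu (qpow [::] u)).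

Definition qhalf : ratfun := tofrac 'X.

Definition iconst : ratfun := tofrac ('i%C : C)%:P.

(* The sum over mu is limited to |mu| = |eta|, where chi mu eta may be
   nonzero. *)
Definition Z (a : int) : fps ratfun := fun d eta =>
  \sum_(mu \in parts (sumn eta)) \sum_(nu \in parts d)
    qhalf ^ (a * kappa mu) * W mu nu * W1 (conj_part nu) *
    ((chi mu eta)%:~R / ((zpart eta)%:R * iconst ^+ size eta)).

Definition Zhat (a : int) : fps ratfun := fmul (Z a) (finv (at_p0 (Z a))).

Definition Ffree (a : int) : fps ratfun := flog (Zhat a).

(* Coefficient of Q ^ d in the one-point function F_n *)
Definition Fone (a : int) (n d : nat) : ratfun := Ffree a d [:: n].

(* Coefficient of lambda ^ m in P(e ^ (i lambda / 2)) *)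
Definition lcoef (P : {poly C}) (m : nat) : C :=
  \sum_(k < size P) P`_k * ('i%C * k%:R / 2) ^+ m / m`!%:R.

(* w = sum_g lambda ^ (2g-1) c_g as Laurent series in lambda, where
   q ^ (1/2) = e ^ (i lambda / 2); writing w = P / D, this is
   lambda P = D (sum_g lambda ^ (2g) c_g), compared at each lambda ^ m. *)
Definition genus_expansion (w : ratfun) (c : nat -> C) : Prop :=
  exists P D, is_frac w P D /\
    forall m, (if m is k.+1 then lcoef P k else 0) =
      \sum_(g < m.+1 | (g.*2 <= m)%N) c g * lcoef D (m - g.*2).

(* Coefficient of Q ^ d in F_{g;n} *)
Definition Fcoef (a : int) (g n d : nat) : C :=
  xget (fun=> 0) [set c | genus_expansion (Fone a n d) c] g.

Definition Fterm (a : int) (g n : nat) (t : C) (d : nat) : C :=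
  Fcoef a g n d * (- cexp (- t)) ^+ d.

Definition Fgn (a : int) (g n : nat) (t : C) : C :=
  limn (series (Fterm a g n t)).

Definition Psi01_term (a : int) (t x : C) (n : nat) : C :=
  if n is 0 then 0 else Fgn a 0 n t * x ^+ n.

Definition Psi01 (a : int) (t x : C) : C :=
  limn (series (Psi01_term a t x)).

(* y ranges over nonzero numbers; in the library 0^-1 = 0. *)
Definition on_mirror_curve (t x y : C) : Prop :=
  y != 0 /\ x + y - 1 - x * y^-1 * cexp (- t) = 0.

End Conifold.

(* Main.v *)
(* A character of S_n takes the value 0 on a full cycle unless its partition is
   a hook, so the one-point function is a sum over hooks; the sum over nu is
   evaluated by the dual Cauchy identity.  With [k] = q^(k/2) - q^(-k/2), the
   coefficient of Q^d in F_n becomes a product of ratios of such brackets,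
   whose leading term in lambda gives
     F_(0;n) = - n^(-2) sum_d C(n+d-1, d) C(n, d) Q^d.
   This is - (P_n(z) + P_(n-1)(z)) / (2 n^2), where P_n is the n-th Legendre
   polynomial and z = 1 + 2Q.  The three-term recurrence of the P_n is a
   differential equation for L = sum_n P_n x^n, whence L^2 (1 - 2xz + x^2) = 1.
   So y = (1 - x + 1/L) / 2 lies on the mirror curve, and y'/y is the
   derivative of x d/dx Psi. *)
From HB Require Import structures.
Require Import Defs.
From mathcomp Require Import all_boot all_order all_algebra all_fingroup all_field all_character zify ring lra.
Set Implicit Arguments. Unset Strict Implicit. Unset Printing Implicit Defensive.
Import Order.TTheory GRing.Theory Num.Theory.
Local Open Scope ring_scope.

(** * Class functions of the symmetric group on a full cycle *)

(** [chi] selects an irreducible character by two multiplicities, so its value on a full cycle is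
    not at hand. Exterior powers of the permutation representation supply it: their products and
    their sums over Young subgroups are orbit counts, and their alternating sums are n irreducible
    characters of modulus 1 on a full cycle. The centralizer there has at most n elements, so column
    orthogonality leaves 0 for all others. The amplitude involves infinitely many variables, and [W]
    and [W1] are rational functions known only by their values. Hence Schur functions become
    determinants of a size independent of the number of variables, limits are taken at each u with
    |u| > 1, and identities of rational functions are deduced from their values there. The amplitude
    at p = 0 is not evaluated beyond its constant term: passing from q^rho to q^(mu+rho) multiplies
    the sum over nu by a polynomial attached to the cells of mu, and the normalization removes the
    common factor. In the analytic part no root or logarithm is chosen: the root of Delta is Delta
    times L, and log y is recognized because y exp(-g), with g = x d/dx Psi, has derivative 0. *)

Section Colorings.
Variable n : nat.
Implicit Types s t : 'S_n.

Lemma color_perm (T : eqType) (f g : 'I_n -> T) :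
    (forall c, #|[pred i | f i == c]| = #|[pred i | g i == c]|) ->
  exists s : 'S_n, forall i, f i = g (s i).
Proof.
move=> fg; have E (h : 'I_n -> T) c : count_mem c [tuple h i | i < n] = #|[pred i | h i == c]|.
  by rewrite /= count_map cardE -size_filter /enum_mem -enumT -filter_predI; congr size; apply: eq_filter => i; rewrite !inE andbT.
have /tuple_permP[s Es] : perm_eq [tuple f i | i < n] [tuple g i | i < n].
  by apply/allP=> c _ /=; rewrite !E fg.
exists s => i; move/(congr1 (fun u : seq T => nth (f i) u i)): Es.
by rewrite -!tnth_nth !tnth_mktuple.
Qed.

Lemma stableE (A : {set 'I_n}) (s : 'S_n) :
  (s \in 'N(A | 'P)%g) = [forall i, (s i \in A) == (i \in A)].
Proof.
apply/astabsP/forallP => [H i|H i]; first by apply/eqP; rewrite -[RHS]H.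
exact/eqP/H.
Qed.

Lemma stableP (A : {set 'I_n}) (s : 'S_n) :
  reflect (forall i, (s i \in A) = (i \in A)) (s \in 'N(A | 'P)%g).
Proof. by rewrite stableE; apply: (iffP forallP) => H i; apply/eqP/H. Qed.

(** Action of s on the top exterior power of the span of A, as a boolean sign. Outside the
    stabilizer of A, [restr_perm] is trivial and the value is [false]. *)
Definition sgnon (A : {set 'I_n}) (s : 'S_n) : bool := restr_perm A s.

Lemma sgnonM (A : {set 'I_n}) s t :
  s \in 'N(A | 'P)%g -> t \in 'N(A | 'P)%g -> sgnon A (s * t)%g = sgnon A s (+) sgnon A t.
Proof. by move=> sA tA; rewrite /sgnon morphM // odd_permM. Qed.

Lemma restr_perm_out (A : {set 'I_n}) s i : i \notin A -> restr_perm A s i = i.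
Proof. by move=> iA; apply: (out_perm (restr_perm_on A s)). Qed.

Lemma sgnonD (A C : {set 'I_n}) s : C \subset A ->
    s \in 'N(A | 'P)%g -> s \in 'N(C | 'P)%g ->
  sgnon A s = sgnon C s (+) sgnon (A :\: C) s.
Proof.
move=> CA sA sC; have sD : s \in 'N(A :\: C | 'P)%g.
  by apply/stableP => i; rewrite !inE (stableP _ _ sA) (stableP _ _ sC).
rewrite /sgnon -odd_permM; congr odd_perm; apply/permP => i; rewrite permM.
case: (boolP (i \in C)) => iC.
  rewrite (restr_permE sA) ?(subsetP CA) // (restr_permE sC) // restr_perm_out // !inE.
  by rewrite (stableP _ _ sC) iC.
rewrite [restr_perm C s i]restr_perm_out //.
case: (boolP (i \in A)) => iA; last by rewrite !restr_perm_out // !inE (negPf iA) andbF.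
by rewrite (restr_permE sA) // (restr_permE sD) // !inE iA iC.
Qed.

Lemma sgnon_tperm (A : {set 'I_n}) x y :
  x \in A -> y \in A -> x != y -> sgnon A (tperm x y).
Proof.
move=> xA yA xy; rewrite /sgnon.
have -> : restr_perm A (tperm x y) = tperm x y.
  apply/permP => i; case: (boolP (i \in A)) => iA.
    rewrite restr_permE //; apply/stableP => j.
    by case: tpermP => [->|->|//]; rewrite xA yA.
  rewrite restr_perm_out // tpermD //; apply: contraNneq iA => <- //.
by rewrite odd_tperm xy.
Qed.

Lemma sgnon_fix (A : {set 'I_n}) s : (forall i, i \in A -> s i = i) -> sgnon A s = false.
Proof.
move=> H; rewrite /sgnon; have -> : restr_perm A s = 1%g.
  apply/permP => i; rewrite perm1; case: (boolP (i \in A)) => iA; last exact: restr_perm_out.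
  case: (boolP (s \in 'N(A | 'P)%g)) => sA; first by rewrite restr_permE // H.
  by rewrite triv_restr_perm ?perm1.
exact: odd_perm1.
Qed.

Lemma sgnon_small (A : {set 'I_n}) s : s \in 'N(A | 'P)%g -> (#|A| <= 1)%N -> sgnon A s = false.
Proof.
move=> sA A1; apply: sgnon_fix => i iA; apply: (card_le1_eqP A1) => //.
by rewrite (stableP _ _ sA).
Qed.

Lemma sgnonT s : sgnon [set: 'I_n] s = s.
Proof.
rewrite /sgnon; congr odd_perm; apply/permP => i; rewrite restr_permE ?in_setT //.
by apply/stableP => j; rewrite !in_setT.
Qed.

Variable T : finType.
Variable blk : 'I_n -> T.

Definition Young : {set 'S_n} := [set s : 'S_n | [forall i, blk (s i) == blk i]].

Lemma YoungP s : reflect (forall i, blk (s i) = blk i) (s \in Young).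
Proof. by rewrite inE; apply: (iffP forallP) => H i; apply/eqP/H. Qed.

Lemma Young_group_set : group_set Young.
Proof.
apply/group_setP; split=> [|s t /YoungP Hs /YoungP Ht]; first by apply/YoungP => i; rewrite perm1.
by apply/YoungP => i; rewrite permM Ht Hs.
Qed.
Canonical Young_group := Group Young_group_set.

Lemma tperm_Young x y : blk x = blk y -> tperm x y \in Young.
Proof. by move=> xy; apply/YoungP => i; case: tpermP => [->|->|]. Qed.

(** Colour a point by its block and its membership in A. Equal counts in every block make the
    colourings for A and A' rearrangements of each other, and the rearranging permutation preserves
    blocks. *)
Lemma Young_trans (A A' : {set 'I_n}) :
    (forall c, #|[set i in A | blk i == c]| = #|[set i in A' | blk i == c]|) ->
  exists2 s, s \in Young & s @: A = A'.
Proof.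
move=> H.
have [|s Hs] := @color_perm (T * bool)%type
  (fun i => (blk i, i \in A)) (fun i => (blk i, i \in A')).
  have K (B : {set 'I_n}) c b : #|[pred i | (blk i, i \in B) == (c, b)]| =
     (if b then #|[set i in B | blk i == c]| else #|[set i | blk i == c]| - #|[set i in B | blk i == c]|)%N.
    have -> : [set i in B | blk i == c] = [set i | blk i == c] :&: B.
      by apply/setP => i; rewrite !inE andbC.
    rewrite -cardsD; case: b; apply: eq_card => i; rewrite !inE xpair_eqE //.
      by rewrite eqb_id.
    by rewrite eqbF_neg andbC.
  by case=> c b; rewrite !K H.
exists s; first by apply/YoungP => i; case: (Hs i).
apply/setP => i; apply/imsetP/idP => [[j jA ->]|iA].
  by case: (Hs j) => _ <-.
exists (s^-1%g i); last by rewrite permKV.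
by case: (Hs (s^-1%g i)) => _ ->; rewrite permKV.
Qed.

(* Burnside's lemma, [inv] being a complete invariant of the orbits. *)
Lemma Young_orbits (J : finType) (inv : {set 'I_n} -> J) (X : {set {set 'I_n}}) :
    (forall A s, A \in X -> s \in Young -> s @: A \in X /\ inv (s @: A) = inv A) ->
    (forall A A', A \in X -> A' \in X -> inv A = inv A' ->
       exists2 s, s \in Young & s @: A = A') ->
  (\sum_(A in X) #|Young :&: 'N(A | 'P)%g| = #|Young| * #|inv @: X|)%N.
Proof.
move=> H1 H2; rewrite (partition_big_imset inv) /= mulnC -sum_nat_const.
apply: eq_bigr => j /imsetP[A0 A0X ->].
pose f (s : 'S_n) := s @: A0.
have imD s t (A : {set 'I_n}) : (s * t)%g @: A = t @: (s @: A).
  by rewrite -[RHS]imset_comp; apply: eq_imset => i; rewrite permM.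
have im1 (A : {set 'I_n}) : (1%g : 'S_n) @: A = A.
  by rewrite -[RHS]imset_id; apply: eq_imset => i; rewrite perm1.
rewrite [RHS](_ : _ = \sum_(A in [set A in X | inv A == inv A0]) #|[set s in Young | f s == A]|)%N; last first.
  rewrite -sum1_card (partition_big f (mem [set A in X | inv A == inv A0])) /=.
    apply: eq_bigr => A _; rewrite -sum1_card; apply: eq_bigl => s; by rewrite [RHS]inE.
  by move=> s sY; rewrite inE; have [-> ->] := H1 _ _ A0X sY; rewrite eqxx.
rewrite [LHS](eq_bigl (mem [set A in X | inv A == inv A0])); last by move=> A; rewrite /= inE.
apply: eq_bigr => A; rewrite /= inE => /andP[AX /eqP EA].
have [g gY Eg] := H2 _ _ A0X AX (esym EA).
(* The block permutations carrying A0 to A form the translate by g of the stabilizer of A. *)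
rewrite -(card_imset _ (mulgI g)); apply: eq_card => s.
apply/imsetP/idP => [[t]|].
  rewrite inE => /andP[tY tA] ->; rewrite inE groupM //= /f imD Eg eqEcard card_imset ?leqnn ?andbT; last exact: perm_inj.
  by apply/subsetP => _ /imsetP[i iA ->]; rewrite (stableP _ _ tA).
rewrite inE => /andP[sY /eqP Es]; exists (g^-1 * s)%g; last by rewrite mulKVg.
rewrite inE groupM ?groupV //=; apply/stableP => i.
have E : (g^-1 * s)%g @: A = A.
  by rewrite -{1}Eg -imD mulKVg.
by rewrite -{1}E mem_imset //; apply: perm_inj.
Qed.
End Colorings.

Lemma sign_char (gT : finGroupType) (H : {group gT}) (e : gT -> bool) :
    {in H &, forall x y, e (x * y)%g = e x (+) e y} ->
  exists2 lam : 'CF(H), lam \is a character & {in H, forall x, lam x = (-1) ^+ e x}.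
Proof.
move=> eM; pose r (x : gT) : 'M[algC]_1 := ((-1) ^+ e x)%:M.
have rP : mx_repr H r.
  split=> [|x y xH yH].
    have := eM _ _ (group1 H) (group1 H).
    by rewrite mulg1 /r addbb => ->; rewrite expr0.
  by rewrite /r -scalar_mxM eM // signr_addb.
exists (cfRepr (MxRepresentation rP)); first exact: cfRepr_char.
by move=> x xH; rewrite cfunE xH mulr1n /= /r mxtrace_scalar mulr1n.
Qed.

(** * Exterior powers of the permutation representation *)

Section ExteriorPowers.
Variable n : nat.
Implicit Types s t y : 'S_n.

(* The character of the k-th exterior power of the permutation
   representation. *)
Definition pif (k : nat) s : algC :=
  \sum_(B : {set 'I_n} | (#|B| == k) && (s \in 'N(B | 'P)%g)) (-1) ^+ sgnon B s.

Lemma stableJ (A : {set 'I_n}) s y :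
  ((s ^ y)%g \in 'N(A | 'P)%g) = (s \in 'N(y @^-1: A | 'P)%g).
Proof.
apply/stableP/stableP => H i.
  by have := H (y i); rewrite !inE permJ.
by have := H ((y^-1)%g i); rewrite !inE permKV conjgE !permM.
Qed.

Lemma sgnonJ (A : {set 'I_n}) s y : s \in 'N(y @^-1: A | 'P)%g ->
  sgnon A (s ^ y)%g = sgnon (y @^-1: A) s.
Proof.
move=> sA; rewrite /sgnon -[RHS](odd_permJ _ y); congr odd_perm.
apply/permP => i; rewrite -(permKV y i) permJ.
case: (boolP (i \in A)) => iA.
  by rewrite !restr_permE ?stableJ ?permJ // ?inE permKV.
by rewrite !restr_perm_out // ?inE permKV.
Qed.

(** The exterior power is monomial: it is induced from the stabilizer of one k-set, acting through
    its sign on that set. *)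
Lemma pif_char (k : nat) : (k <= n)%N ->
  exists2 phi : 'CF([set: 'S_n]), phi \is a character & forall s, phi s = pif k s.
Proof.
move=> kn; pose A0 : {set 'I_n} := [set i : 'I_n | (i < k)%N].
have cA0 : #|A0| = k.
  rewrite -[RHS]card_ord -[RHS](card_codom (f := widen_ord kn)); last first.
    by move=> i j /(congr1 val) /= /val_inj.
  apply: eq_card => i; rewrite inE; apply/idP/codomP => [ik|[j ->]]; last exact: (ltn_ord j).
  by exists (Ordinal ik); apply: val_inj.
move: A0 cA0 => A0 cA0; pose H := ('N(A0 | 'P))%G.
have [|lam lamC lamE] := @sign_char _ H (sgnon A0).
  by move=> s t sA tA; apply: sgnonM.
exists ('Ind[[set: 'S_n]%G] lam); first exact: cfInd_char.
move=> s; rewrite cfIndE ?subsetT // /pif.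
rewrite (partition_big (fun y : 'S_n => y @^-1: A0) (fun B : {set 'I_n} => #|B| == k)) /=; last first.
  move=> y _; rewrite -cA0; apply/eqP.
  rewrite -(card_imset (mem (y @^-1: A0)) (@perm_inj _ y)).
apply: eq_card => i; apply/imsetP/idP.
    by case=> j; rewrite inE => jA ->.
  by move=> iA; exists ((y^-1)%g i); rewrite ?permKV //; move: iA; rewrite !inE permKV.
(* The y that pull A0 back to B form a coset of H, so the factor [#|H|] cancels the one in the
   formula for induced characters. *)
have E (B : {set 'I_n}) : #|B| == k ->
  \sum_(i in [set: 'S_n] | i @^-1: A0 == B) lam (s ^ i)%g = 
   #|H|%:R * (if s \in 'N(B | 'P)%g then (-1) ^+ sgnon B s else 0).
  move=> /eqP cB.
  rewrite (eq_bigr (fun=> (if s \in 'N(B | 'P)%g then (-1) ^+ sgnon B s else 0 : algC))); last first.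
    move=> y /andP[_ /eqP Ey]; rewrite -Ey -stableJ; case: ifP => sH.
      by rewrite lamE // sgnonJ // -stableJ.
    by rewrite cfun0 // /H /= sH.
  rewrite (eq_bigl (mem [set y : 'S_n | y @^-1: A0 == B])); last by move=> y; rewrite /= !inE.
  rewrite sumr_const mulr_natl; congr (_ *+ _).
  have [|g _ gE] := @Young_trans n _ (fun=> tt) A0 B.
    have K (D : {set 'I_n}) : [set i in D | tt == tt] = D by apply/setP => i; rewrite !inE eqxx andbT.
    by case; rewrite !K cA0 cB.
  have gB i : (g i \in B) = (i \in A0) by rewrite -gE mem_imset //; apply: perm_inj.
  rewrite -(card_imset _ (mulgI g)); apply: eq_card => y.
  change ((y \in [set (g * x)%g | x in [set y0 : 'S_n | y0 @^-1: A0 == B]]) = (y \in 'N(A0 | 'P)%g)).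
  apply/imsetP/idP.
    case=> z; rewrite inE => /eqP zE ->{y} ; apply/stableP => i.
    by rewrite permM -(gB i) -zE inE.
  move=> /stableP yA; exists (g^-1 * y)%g; last by rewrite mulKVg.
  rewrite inE; apply/eqP/setP => i.
  by rewrite inE permM yA -[LHS]gB permKV.
rewrite (eq_bigr _ E) -mulr_sumr mulKf.
  by rewrite -big_mkcondr.
by rewrite pnatr_eq0 -lt0n cardG_gt0.
Qed.
End ExteriorPowers.

(** * Sums of exterior powers over Young subgroups *)

Section Sums.
Variable n : nat.
Implicit Types s t y : 'S_n.

(* A set A contributes to the sum of a signed exterior power over a Young
   subgroup only when the two signs agree on the stabilizer of A. *)
Lemma pif_sum (T J : finType) (blk : 'I_n -> T) (e : 'S_n -> bool) (k : nat)
    (inv : {set 'I_n} -> J) (X : {set {set 'I_n}}) :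
    {in Young blk &, forall s t, e (s * t)%g = e s (+) e t} ->
    (forall A, A \in X -> #|A| = k /\
       forall s, s \in Young blk -> s \in 'N(A | 'P)%g -> e s = sgnon A s) ->
    (forall A : {set 'I_n}, #|A| = k -> A \notin X ->
       exists s, [/\ s \in Young blk, s \in 'N(A | 'P)%g & e s != sgnon A s]) ->
    (forall A s, A \in X -> s \in Young blk -> s @: A \in X /\ inv (s @: A) = inv A) ->
    (forall A A', A \in X -> A' \in X -> inv A = inv A' ->
       exists2 s, s \in Young blk & s @: A = A') ->
  \sum_(s in Young blk) pif k s * (-1) ^+ e s = (#|Young blk| * #|inv @: X|)%:R.
Proof.
move=> eM hX hnX H1 H2; rewrite -Young_orbits // natr_sum.
under [LHS]eq_bigr do rewrite /pif mulr_suml.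
rewrite (exchange_big_dep (fun B : {set 'I_n} => #|B| == k)) /=; last by move=> s B _ /andP[].
rewrite (bigID (mem X)) /= addrC big1 ?add0r => [|A /andP[/eqP Ak AX]].
  rewrite (eq_bigl (mem X)); last first.
    by move=> A /=; case: (boolP (A \in X)) => AX; rewrite ?andbF //= (hX _ AX).1 eqxx.
  apply: eq_bigr => A AX; have [Ak As] := hX _ AX.
  rewrite (eq_bigr (fun=> 1)); last first.
    by move=> s /andP[sY /andP[_ sA]]; rewrite As // -signr_addb addbb expr0.
  rewrite sumr_const; congr (_%:R); apply: eq_card => s.
  by rewrite [RHS]in_setI [LHS]unfold_in /= Ak eqxx.
(* Translation by s0, which stabilizes A but carries opposite signs, gives S = - S. *)
have [s0 [s0Y s0A es0]] := hnX _ Ak AX.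
set S := \sum_(i in _ | _) _.
suff /eqP : S = - S by rewrite -addr_eq0 -mulr2n mulrn_eq0 /= => /eqP.
rewrite {1}/S (reindex_inj (mulgI s0)) /= -sumrN.
rewrite (eq_bigl (fun s => (s \in Young blk) && ((#|A| == k) && (s \in 'N(A | 'P)%g)))); last first.
  by move=> s; rewrite !groupMl.
apply: eq_bigr => s /andP[sY /andP[_ sA]].
rewrite sgnonM // eM // (signr_addb _ (sgnon A s0)) (signr_addb _ (e s0)) mulrACA.
have -> : (-1) ^+ sgnon A s0 * (-1) ^+ e s0 = -1 :> algC.
  by case: (e s0) (sgnon A s0) es0 => [] [] //; rewrite ?expr0 ?expr1 ?mulr1 ?mul1r.
by rewrite mulN1r.
Qed.

Lemma card_stable_sum (k : nat) : (k <= n)%N ->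
  (\sum_(B : {set 'I_n} | #|B| == k) #|'N(B | 'P)%g| = n`!)%N.
Proof.
move=> kn; pose X := [set B : {set 'I_n} | #|B| == k].
have := @Young_orbits n _ (fun=> tt) _ (fun _ : {set 'I_n} => tt) X.
have YT : Young (fun _ : 'I_n => tt) = [set: 'S_n].
  by apply/setP => s; rewrite in_setT; apply/YoungP.
rewrite YT cardsT card_Sn.
have K (D : {set 'I_n}) : [set i in D | tt == tt] = D by apply/setP => i; rewrite !inE eqxx andbT.
have -> : (fun _ : {set 'I_n} => tt) @: X = [set tt].
  apply/setP => -[]; rewrite inE eqxx; apply/imsetP.
  have : (0 < #|[set B : {set 'I_n} | #|B| == k]|)%N by rewrite card_draws card_ord bin_gt0.
  by case/card_gt0P => B BX; exists B.
rewrite cards1 muln1 => <-.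
- by rewrite /X; apply: eq_big => B; rewrite ?inE // setTI.
- by move=> A s; rewrite !inE => /eqP <- _; rewrite card_imset //; apply: perm_inj.
move=> A A'; rewrite !inE => /eqP Ak /eqP A'k _.
have [|s _ sA] := @Young_trans n _ (fun=> tt) A A'; first by case; rewrite !K Ak.
by exists s => //; rewrite in_setT.
Qed.

(** If A has two points in one block, their transposition changes the sign on A, so A contributes
    nothing. The remaining A have at most one point per block, and their orbits are the k-sets of
    nonempty blocks. *)
Lemma pif_Young (T : finType) (blk : 'I_n -> T) (k : nat) :
  \sum_(s in Young blk) pif k s = (#|Young blk| * 'C(#|blk @: [set: 'I_n]|, k))%:R.
Proof.
pose X := [set A : {set 'I_n} | (#|A| == k) && [forall x in A, forall y in A, (blk x == blk y) ==> (x == y)]].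
have XP (A : {set 'I_n}) : reflect (#|A| = k /\ {in A &, injective blk}) (A \in X).
  rewrite inE; apply: (iffP andP) => -[/eqP Ak H]; split=> //.
    by move=> x y xA yA xy; move/forall_inP: H => /(_ x xA)/forall_inP/(_ y yA)/implyP/(_ (introT eqP xy))/eqP.
  by apply/forall_inP => x xA; apply/forall_inP => y yA; apply/implyP => /eqP/H ->.
transitivity (\sum_(s in Young blk) pif k s * (-1) ^+ false).
  by apply: eq_bigr => s _; rewrite expr0 mulr1.
rewrite (@pif_sum _ _ blk (fun=> false) k (fun A : {set 'I_n} => blk @: A) X) //.
- rewrite -cards_draws; congr (_ * #|pred_of_set _|)%:R.
  apply/setP => C; apply/imsetP/idP => [[A /XP[Ak inj] ->]|].
    by rewrite inE card_in_imset // Ak eqxx andbT imsetS ?subsetT.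
  rewrite inE => /andP[/subsetP CS /eqP Ck].
  pose A := [set i | (blk i \in C) && ([pick j | blk j == blk i] == Some i)].
  have inj : {in A &, injective blk}.
    move=> x y; rewrite !inE => /andP[_ /eqP Ex] /andP[_ /eqP Ey] xy.
    by move: Ex; rewrite xy Ey => -[].
  have imA : blk @: A = C.
    apply/setP => c; apply/imsetP/idP => [[i]|cC]; first by rewrite inE => /andP[iC _] ->.
    have /imsetP[i _ ci] := CS _ cC; have jc : blk (odflt i [pick j | blk j == c]) = c.
      by case: pickP => [j /eqP //|_]; rewrite ci.
    exists (odflt i [pick j | blk j == c]) => //; rewrite inE jc cC.
    by case: pickP => [j _|/(_ i)] /=; rewrite ?eqxx // ci eqxx.
  by exists A; rewrite ?imA //; apply/XP; rewrite -(card_in_imset inj) imA.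
- by move=> A /XP[Ak inj]; split=> // s /YoungP sY /stableP sA; rewrite sgnon_fix // => i iA; apply: inj; rewrite ?sA.
- move=> A Ak /XP AX.
  have : ~~ [forall x in A, forall y in A, (blk x == blk y) ==> (x == y)].
    apply/negP => /forall_inP H; apply: AX; split=> // x y xA yA xy.
    by have /forall_inP/(_ y yA)/implyP/(_ (introT eqP xy))/eqP := H x xA.
  rewrite negb_forall => /existsP[x]; rewrite negb_imply => /andP[xA].
  rewrite negb_forall => /existsP[y]; rewrite !negb_imply => /and3P[yA /eqP xy nxy].
  exists (tperm x y); split; first exact: tperm_Young.
    by apply/stableP => i; case: tpermP => [->|->|//]; rewrite xA yA.
  by rewrite sgnon_tperm.
- move=> A s /XP[Ak inj] /YoungP sY; split; last first.
    by rewrite -imset_comp; apply: eq_imset => i /=.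
  apply/XP; split; first by rewrite card_imset //; apply: perm_inj.
  by move=> _ _ /imsetP[x xA ->] /imsetP[y yA ->]; rewrite !sY => /inj ->.
- move=> A A' /XP[Ak inj] /XP[A'k inj'] AA'; apply: Young_trans => c.
  have K (D : {set 'I_n}) : {in D &, injective blk} -> #|[set i in D | blk i == c]| = (c \in blk @: D).
    move=> injD; case: imsetP => [[i iD ->]|H].
      apply/eqP/cards1P; exists i; apply/setP => j; rewrite !inE.
      by apply/andP/eqP => [[jD /eqP/injD ->]|->].
    apply/eqP; rewrite cards_eq0; apply/eqP/setP => j; rewrite !inE; apply/negP => /andP[jD /eqP jc].
    by apply: H; exists j.
  by rewrite !K // AA'.
Qed.

Lemma card_Young_stable (A : {set 'I_n}) : Young (fun i => i \in A) = 'N(A | 'P)%g.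
Proof. by apply/setP => s; apply/YoungP/stableP. Qed.

(** The sign of s is the product of its signs on B and on the complement of B: tensoring with the
    sign exchanges complementary exterior powers. *)
Lemma pif_mul_compl k s : (k <= n)%N -> (-1) ^+ s * pif k s = pif (n - k) s.
Proof.
move=> kn; rewrite /pif mulr_sumr (reindex_inj (@setC_inj _)) /=; apply: eq_big.
  move=> B; congr andb; first by have := cardsC B; rewrite card_ord; move: #|B| #|~: B| => p q pq; apply/eqP/eqP; lia.
  by apply/stableP/stableP => H i; have := H i; rewrite !inE; [move/negb_inj|move=> ->].
move=> B /andP[_ sC]; have sB : s \in 'N(B | 'P)%g.
  by apply/stableP => i; have := stableP _ _ sC i; rewrite !inE => /negb_inj.
have sT : s \in 'N([set: 'I_n] | 'P)%g by apply/stableP => i; rewrite !inE.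
have := sgnonD (subsetT B) sT sB; rewrite sgnonT setTD => ->.
by rewrite signr_addb -mulrA -signr_addb addbb expr0 mulr1.
Qed.

Lemma exists_subset (A : {set 'I_n}) k : (k <= #|A|)%N -> exists2 B : {set 'I_n}, B \subset A & #|B| = k.
Proof.
move=> kA; have : (0 < #|[set B : {set 'I_n} | B \subset A & #|B| == k]|)%N by rewrite cards_draws bin_gt0.
by case/card_gt0P => B; rewrite inE => /andP[BA /eqP Bk]; exists B.
Qed.

(** For n > 0, the inner product of the exterior powers a and b. Each is the sum of two neighbouring
    hook characters, except that only one is present at a = 0 and at a = n; hence the values 2, 1
    and 0. *)
Definition gram (a b : nat) : nat :=
  if a == b then (0 < a < n).+1 else (a == b.+1) || (b == a.+1).

(** Two points of A outside B, or of B outside A, give a transposition that changes only one of the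
    two signs. So each difference has at most one point. As [#|A|] and [#|B|] are fixed, the boolean
    [inv], whether one set contains the other, then determines the orbit of A under the stabilizer
    of B. *)
Lemma pif_stable (B : {set 'I_n}) (a : nat) : (a <= n)%N ->
  \sum_(s in 'N(B | 'P)%g) pif a s * (-1) ^+ sgnon B s = (#|'N(B | 'P)%g| * gram a #|B|)%:R.
Proof.
move=> an; rewrite -card_Young_stable.
pose X := [set A : {set 'I_n} | [&& #|A| == a, (#|A :\: B| <= 1)%N & (#|B :\: A| <= 1)%N]].
pose inv (A : {set 'I_n}) := (#|A :\: B| == 0)%N || (#|B :\: A| == 0)%N.
have cA (A : {set 'I_n}) : (#|A| = #|A :&: B| + #|A :\: B|)%N by rewrite cardsID.
have cB (A : {set 'I_n}) : (#|B| = #|A :&: B| + #|B :\: A|)%N by rewrite setIC cardsID.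
rewrite (@pif_sum _ _ _ (sgnon B) a inv X).
- congr (_ * _)%:R.
  have ex c p : (c <= #|B|)%N -> (#|B| + p <= n)%N -> exists A : {set 'I_n}, #|A :&: B| = c /\ #|A :\: B| = p.
    move=> cb pb; have [C CB Cc] := exists_subset cb.
    have [|D DB Dp] := @exists_subset (~: B) p; first by have := cardsC B; rewrite card_ord; lia.
    exists (C :|: D); rewrite setIUl setDUl (setIidPl CB).
    have -> : C :\: B = set0 by apply/eqP; rewrite setD_eq0.
    have -> : D :&: B = set0 by apply/eqP; rewrite setI_eq0 disjoints_subset.
    by rewrite setU0 set0U setDE (setIidPl DB).
  have bn : (#|B| <= n)%N by rewrite -[leqRHS]card_ord max_card.
  have imt : (true \in inv @: X) = ((a == #|B|) || (a == #|B|.+1) || (#|B| == a.+1)).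
    apply/imsetP/idP => [[A]|ab].
      by rewrite inE /inv => /and3P[/eqP Aa AB BA] ?; have := cA A; have := cB A; lia.
    have [||A [AB AD]] := ex (minn a #|B|) (a - #|B|)%N; try lia.
    by exists A; rewrite ?inE /inv; have := cA A; have := cB A; lia.
  have imf : (false \in inv @: X) = ((a == #|B|) && (0 < a < n)%N).
    apply/imsetP/idP => [[A]|ab].
      rewrite inE /inv => /and3P[/eqP Aa AB BA] ?; have := cA A; have := cB A.
      by have := cardsC B; have := subset_leq_card (subsetT (B :|: A)); have := cardsUI B A; rewrite cardsT setIC card_ord; lia.
    have [||A [AB AD]] := ex a.-1 1%N; try lia.
    by exists A; rewrite ?inE /inv; have := cA A; have := cB A; lia.
  rewrite -sum1_card big_mkcond big_bool imt imf /gram.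
  by case: (eqVneq a #|B|) => [E|ne] /=; [case: (0 < a < n)%N|case: (_ || _)].
- by move=> s t; rewrite !card_Young_stable; apply: sgnonM.
- move=> A; rewrite inE => /and3P[/eqP Aa AB BA]; split=> // s; rewrite card_Young_stable => sB sA.
  have sI : s \in 'N(A :&: B | 'P)%g by apply/stableP => i; rewrite !inE (stableP _ _ sA) (stableP _ _ sB).
  have sD (C D : {set 'I_n}) : s \in 'N(C | 'P)%g -> s \in 'N(D | 'P)%g -> s \in 'N(C :\: D | 'P)%g.
    by move=> sC sD; apply/stableP => i; rewrite !inE (stableP _ _ sC) (stableP _ _ sD).
  rewrite (sgnonD (subsetIl A B)) // (sgnonD (subsetIr A B)) // !setDIr !setDv set0U setU0.
  by rewrite !(@sgnon_small _ (_ :\: _)) // sD.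
- move=> A Aa; rewrite inE Aa eqxx /= negb_and -!ltnNge.
  have ts (C : {set 'I_n}) (x y : 'I_n) : (x \in C) = (y \in C) -> tperm x y \in 'N(C | 'P)%g.
    by move=> xy; apply/stableP => i; case: tpermP => [->|->|].
  have fx (C : {set 'I_n}) (x y : 'I_n) : x \notin C -> y \notin C -> sgnon C (tperm x y) = false.
    by move=> xC yC; apply: sgnon_fix => i iC; rewrite tpermD //; [apply: contraNneq xC|apply: contraNneq yC] => ->.
  by case/orP => /card_gt1P[x [y [/setDP[x1 x2] /setDP[y1 y2] xy]]]; exists (tperm x y);
    rewrite card_Young_stable !ts ?x1 ?y1 ?(negPf x2) ?(negPf y2) //; split=> //;
    first [by rewrite (fx B) // sgnon_tperm | by rewrite (fx A) // sgnon_tperm].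
- move=> A s AX; rewrite card_Young_stable => sB.
  have sBi : s @: B = B.
    rewrite [LHS]/=; apply/eqP; rewrite eqEcard card_imset ?leqnn ?andbT; last exact: perm_inj.
    by apply/subsetP => _ /imsetP[i iA ->]; rewrite (stableP _ _ sB).
  have inj := @perm_inj _ s; have cD (C D : {set 'I_n}) : #|s @: C :\: s @: D| = #|C :\: D|.
    rewrite -[RHS](card_imset _ inj); congr #|pred_of_set _|; apply/setP => i.
    by rewrite -[i](permKV s) in_setD !mem_imset // in_setD.
  have e1 : #|s @: A :\: B| = #|A :\: B| by rewrite -{1}sBi cD.
  have e2 : #|B :\: s @: A| = #|B :\: A| by rewrite -{1}sBi cD.
  by move: AX; rewrite !inE /inv e1 e2 card_imset.
- move=> A A'; rewrite !inE => /and3P[/eqP Aa AB BA] /and3P[/eqP Aa' AB' BA'] II.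
  have E : #|A :&: B| = #|A' :&: B|.
    move: II; rewrite /inv; have := cA A; have := cB A; have := cA A'; have := cB A'; lia.
  have K (D : {set 'I_n}) c : #|[set i in D | (i \in B) == c]| = if c then #|D :&: B| else #|D :\: B|.
    by case: c; congr #|pred_of_set _|; apply/setP => i; rewrite !inE ?eqb_id ?eqbF_neg // andbC.
  by apply: Young_trans; case; rewrite !K //; have := cA A; have := cA A'; lia.
Qed.
End Sums.

(** * Hook characters and their values on full cycles *)

Section Hooks.
Variable n : nat.
Hypothesis n_gt0 : (0 < n)%N.
Implicit Types s t g : 'S_n.

(** Splitting a trivial summand off the permutation representation makes each exterior power a sum
    of two neighbours. [theta k] is the k-th exterior power of the complement, of dimension n - 1:
    the hook character with leg length k. *)
Fixpoint theta (k : nat) s : algC :=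
  if k is k'.+1 then pif k s - theta k' s else pif 0 s.

Lemma pif_conj k s : (pif k s)^* = pif k s.
Proof. by rewrite /pif rmorph_sum; apply: eq_bigr => B _; rewrite rmorph_sign. Qed.

Lemma theta_conj k s : (theta k s)^* = theta k s.
Proof. by elim: k => [|k IH] /=; rewrite ?rmorphB /= ?pif_conj ?IH. Qed.

Lemma pif_dot a b : (a <= n)%N -> (b <= n)%N -> \sum_(s : 'S_n) pif a s * pif b s = (n`! * gram n a b)%:R.
Proof.
move=> an bn; under eq_bigr do rewrite [pif b _]/pif mulr_sumr.
rewrite (exchange_big_dep (fun B : {set 'I_n} => #|B| == b)) /=; last by move=> s B _ /andP[].
rewrite -(card_stable_sum bn) big_distrl /= natr_sum; apply: eq_bigr => B /eqP Bb.
by rewrite -Bb -pif_stable //; apply: eq_bigl => s; rewrite eqxx.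
Qed.

Lemma pif_theta_dot a b : (a <= n)%N -> (b < n)%N ->
  \sum_(s : 'S_n) pif a s * theta b s = (n`! * ((a == b) + (a == b.+1)))%:R.
Proof.
move=> an; elim: b => [|b IH] bn; first by rewrite pif_dot //; congr (_ * _)%:R; rewrite /gram; case: a {an} => [|[|a]].
under eq_bigr do rewrite /= mulrBr.
rewrite sumrB IH ?pif_dot //; try lia.
apply/eqP; rewrite subr_eq -natrD eqr_nat -mulnDr; apply/eqP; congr (_ * _)%N; rewrite /gram.
have [->|ab] := eqVneq a b.+1; first by rewrite ltnS leq0n bn; lia.
by rewrite eqSS; have [->|] := eqVneq a b; lia.
Qed.

Lemma theta_dot a b : (a < n)%N -> (b < n)%N ->
  \sum_(s : 'S_n) theta a s * theta b s = (n`! * (a == b))%:R.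
Proof.
move=> + bn; elim: a => [|a IH] an; first by rewrite pif_theta_dot //; congr (_ * _)%:R; lia.
under eq_bigr do rewrite /= mulrBl.
rewrite sumrB IH ?pif_theta_dot //; try lia.
by apply/eqP; rewrite subr_eq -natrD eqr_nat -mulnDr; apply/eqP; congr (_ * _)%N; lia.
Qed.

Lemma pif1 k : pif k (1 : 'S_n)%g = 'C(n, k)%:R.
Proof.
rewrite -[X in 'C(X, _)]card_ord -card_draws -sumr_const /pif; apply: eq_big => B.
  by rewrite inE group1 andbT.
by move=> _; rewrite sgnon_fix // => i; rewrite perm1.
Qed.

Lemma theta1 k : theta k (1 : 'S_n)%g = 'C(n.-1, k)%:R.
Proof.
elim: k => [|k IH] /=; first by rewrite pif1 !bin0.
by rewrite IH pif1 -[X in 'C(X, _)](prednK n_gt0) binS natrD addrK.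
Qed.

(** A virtual character of norm 1 is irreducible up to sign, and the value ['C(n.-1, k)] at the
    identity excludes the minus sign. *)
Lemma theta_irr k : (k < n)%N -> exists i : Iirr [set: 'S_n], forall s, 'chi_i s = theta k s.
Proof.
move=> kn.
have [phi phiZ phiE] : exists2 phi : 'CF([set: 'S_n]), phi \in 'Z[irr [set: 'S_n]]%g & forall s, phi s = theta k s.
  elim: k kn => [|k IH] kn.
    by have [phi /char_vchar phiC phiE] := pif_char (leq0n n); exists phi.
  have [phi phiZ phiE] := IH (ltnW kn); have [psi /char_vchar psiZ psiE] := pif_char (ltnW kn).
  by exists (psi - phi); rewrite ?rpredB // => s; rewrite !cfunE psiE phiE.
have : '[phi] = 1.
  rewrite cfdotE; under eq_bigr do rewrite !phiE theta_conj.
  rewrite (eq_bigl xpredT); last by move=> s; rewrite in_setT.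
  by rewrite theta_dot // eqxx muln1 cardsT card_Sn mulVf // pnatr_eq0 -lt0n fact_gt0.
case/(vchar_norm1P phiZ) => b [i Ei]; exists i => s; rewrite -phiE Ei.
case: b Ei => Ei; last by rewrite expr0 scale1r.
have := irr1_gt0 i; have : phi 1%g >= 0 by rewrite phiE theta1 ler0n.
by rewrite Ei expr1 scaleN1r cfunE oppr_ge0 => /le_lt_trans H /H; rewrite ltxx.
Qed.

Section Cycle.
Variable c : 'S_n.
Hypothesis c_cyc : forall A : {set 'I_n}, c \in 'N(A | 'P)%g -> A = set0 \/ A = [set: 'I_n].

Lemma pif_cycle k : (0 < k < n)%N -> pif k c = 0.
Proof.
move=> kn; rewrite /pif big1 // => B /andP[/eqP Bk /c_cyc[] E]; move: kn; rewrite -Bk E ?cards0 //.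
by rewrite cardsT card_ord ltnn andbF.
Qed.

Lemma theta_cycle k : (k < n)%N -> theta k c = (-1) ^+ k.
Proof.
elim: k => [|k IH] kn /=; last by rewrite pif_cycle // IH ?(ltnW kn) // sub0r exprS mulN1r.
rewrite /pif (big_pred1 set0) => [|B]; first by rewrite sgnon_fix // => i; rewrite inE.
rewrite cards_eq0 [in RHS]/=; apply/andb_idr => /eqP ->.
by apply/stableP => i; rewrite !inE.
Qed.

(** Elements of the centralizer that agree at one point agree on a nonempty [c]-stable set, which is
    everything. *)
Lemma card_cent_cycle : (#|'C[c]%g| <= n)%N.
Proof.
pose i0 := Ordinal n_gt0; pose f s := s i0.
have inj : {in 'C[c]%g &, injective f}.
  move=> s t /cent1P sc /cent1P tc fst; pose A := [set i | s i == t i].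
  have /c_cyc[A0|AT] : c \in 'N(A | 'P)%g.
  - apply/stableP => i; rewrite !inE -!permM.
    by rewrite -[(c * s)%g]sc -[(c * t)%g]tc !permM (inj_eq (@perm_inj _ c)).
  - by have : i0 \in A; [rewrite inE; apply/eqP|rewrite A0 inE].
  by apply/permP => i; have : i \in A; [rewrite AT inE|rewrite inE => /eqP].
by rewrite -[leqRHS]card_ord -(card_in_imset inj) max_card.
Qed.

(** Column orthogonality at c: the squared moduli add up to the order of the centralizer, at most n,
    and the n hook characters already contribute 1 each. *)
Lemma irr_cycle (i : Iirr [set: 'S_n]) :
  (forall k, (k < n)%N -> exists s, 'chi_i s != theta k s) -> 'chi_i c = 0.
Proof.
move=> nth; have [f fE] : exists f : 'I_n -> Iirr [set: 'S_n], forall k s, 'chi_(f k) s = theta k s.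
  by apply: (@fin_all_exists _ _ (fun (k : 'I_n) (i : Iirr [set: 'S_n]) => forall s, 'chi_i s = theta k s)) => k; apply: theta_irr.
have finj : injective f.
  move=> k l kl; apply/val_inj/eqP; have := theta_dot (ltn_ord k) (ltn_ord l).
  under eq_bigr do rewrite -!fE kl !fE.
  rewrite theta_dot // eqxx muln1 => /eqP; rewrite eqr_nat.
  by case: (val k == val l) => //; rewrite muln0 eqn0Ngt fact_gt0.
have := second_orthogonality_relation c (in_setT c); rewrite class_refl mulr1n.
rewrite (bigID (mem (codom f))) /= => E.
have Ef : \sum_(j in codom f) 'chi_j c * ('chi_j c)^* = n%:R.
  rewrite (eq_bigl (mem (f @: [set: 'I_n]))); last first.
    by move=> j; apply/codomP/imsetP => [[k ->]|[k _ ->]]; exists k.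
  rewrite big_imset /=; last by move=> ? ? _ _ /finj.
  rewrite (eq_bigr (fun=> 1)) ?sumr_const ?cardsT ?card_ord // => k _.
  by rewrite fE theta_conj theta_cycle // -signr_odd -signr_addb addbb expr0.
have i_f : i \notin codom f.
  by apply/codomP => -[k Ei]; have [s] := nth k (ltn_ord k); rewrite Ei fE eqxx.
have : \sum_(j | j \notin codom f) 'chi_j c * ('chi_j c)^* <= 0.
  have : (#|'C_[set: 'S_n][c]%g|%:R : algC) <= n%:R by rewrite ler_nat setTI card_cent_cycle.
  by rewrite -E Ef gerDl.
rewrite (bigD1 i) //= => H; apply/eqP; rewrite -normr_eq0 -sqrf_eq0 normCK; apply/eqP/le_anti.
rewrite mul_conjC_ge0 andbT; apply: le_trans H; rewrite lerDl sumr_ge0 // => j _; exact: mul_conjC_ge0.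
Qed.
End Cycle.

Section Mult.
Variables (T : finType) (blk : 'I_n -> T).
Local Notation l := #|blk @: [set: 'I_n]|.

Lemma blk_gt0 : (0 < l)%N.
Proof. by apply/card_gt0P; exists (blk (Ordinal n_gt0)); apply: imset_f. Qed.

Lemma theta_Young k : \sum_(s in Young blk) theta k s = (#|Young blk| * 'C(l.-1, k))%:R.
Proof.
elim: k => [|k IH] /=; first by rewrite pif_Young !bin0.
rewrite sumrB IH pif_Young -[X in 'C(X, k.+1)](prednK blk_gt0) binS.
by rewrite mulnDr natrD addrK.
Qed.

(** The sign twist replaces the exterior power k by n - k, so Pascal's rule runs from the other end
    and the leg is counted as n - 1 - k. *)
Lemma theta_Young_sign k : (k < n)%N ->
  \sum_(s in Young blk) (-1) ^+ s * theta k s = (#|Young blk| * 'C(l.-1, n.-1 - k))%:R.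
Proof.
have ln : (l <= n)%N by rewrite -[leqRHS]card_ord -cardsT leq_imset_card.
have l0 := blk_gt0.
elim: k => [|k IH] kn.
  under eq_bigr do rewrite /= pif_mul_compl //.
  rewrite pif_Young -[in LHS](prednK l0) !subn0 -[X in 'C(_.+1, X)](prednK n_gt0) binS.
  by rewrite [X in (X + _)%N]bin_small ?add0n //; lia.
under eq_bigr do rewrite /= mulrBr (pif_mul_compl _ (ltnW kn)).
rewrite sumrB IH ?(ltnW kn) // pif_Young -[X in 'C(X, n - k.+1)](prednK l0).
have -> : (n - k.+1 = (n.-1 - k.+1).+1)%N by lia.
have -> : (n.-1 - k = (n.-1 - k.+1).+1)%N by lia.
by rewrite binS mulnDr natrD addrC addKr.
Qed.
End Mult.
End Hooks.

(** The sum is [#|H|] times the multiplicity, in the restriction to H, of the linear character given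
    by e. *)
Lemma char_sum_ge0 (gT : finGroupType) (G H : {group gT}) (e : gT -> bool) (i : Iirr G) :
    H \subset G -> {in H &, forall x y, e (x * y)%g = e x (+) e y} ->
  0 <= \sum_(x in H) (-1) ^+ e x * 'chi_i x.
Proof.
move=> HG eM; have [lam lamC lamE] := sign_char eM.
have := Cnat_cfdot_char (cfRes_char H (irr_char i)) lamC.
rewrite cfdotE => /natr_ge0; rewrite pmulr_rge0 ?invr_gt0 ?ltr0n ?cardG_gt0 //.
congr (0 <= _); apply: eq_bigr => x xH; rewrite lamE // cfResE // mulrC.
by rewrite rmorph_sign.
Qed.

(** * Uniqueness of the character indexed by a hook *)

Section Hook.
Variable n : nat.
Hypothesis n_gt0 : (0 < n)%N.
Implicit Types s t g : 'S_n.
Variables (T T' : finType) (blk : 'I_n -> T) (blk' : 'I_n -> T') (X X' : {set 'I_n}) (b : nat).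
Hypotheses (YX : forall s, (s \in Young blk) = perm_on X s)
  (YX' : forall s, (s \in Young blk') = perm_on X' s)
  (bn : (b < n)%N) (cX : #|X| = (n - b)%N) (cX' : #|X'| = b.+1)
  (l1 : #|blk @: [set: 'I_n]| = b.+1) (l2 : #|blk' @: [set: 'I_n]| = (n - b)%N).

Lemma card_stable_le (Z : {set 'I_n}) : (#|'N(Z | 'P)%g| <= #|Z|`! * (n - #|Z|)`!)%N.
Proof.
pose f s := (restr_perm Z s, restr_perm (~: Z) s).
have inj : {in 'N(Z | 'P)%g &, injective f}.
  move=> s t sZ tZ [st1 st2]; apply/permP => i.
  have cN s0 : s0 \in 'N(Z | 'P)%g -> s0 \in 'N(~: Z | 'P)%g.
    by move=> H; apply/stableP => j; rewrite !in_setC (stableP _ _ H).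
  case: (boolP (i \in Z)) => iZ.
    by rewrite -(restr_permE sZ) // st1 restr_permE.
  by rewrite -(restr_permE (cN _ sZ)) ?in_setC // st2 restr_permE ?in_setC // cN.
have -> : (n - #|Z| = #|~: Z|)%N by have := cardsC Z; rewrite card_ord; lia.
rewrite -!card_perm -(card_in_imset inj) -[leqRHS]/(#|_| * #|_|)%N -cardX.
by apply: subset_leq_card; apply/subsetP => _ /imsetP[s _ ->]; rewrite inE; apply/andP; split; apply: restr_perm_on.
Qed.

(** Let Z be the complement of X, of b points. If at most one of the b + 1 points of the preimage of
    X' lies in X, then all of Z lies in that preimage, so g maps Z onto one of the b + 1 subsets of
    X' of size b. Each arises from at most b! (n - b)! permutations. *)
Lemma card_double_coset :
  (#|[set g : 'S_n | #|X :&: g @^-1: X'| <= 1]| <= (n - b)`! * b.+1`!)%N.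
Proof.
pose Z := ~: X; have cZ : #|Z| = b by have := cardsC X; rewrite card_ord /Z; lia.
pose P := [set Z' : {set 'I_n} | Z' \subset X' & #|Z'| == b].
have -> : ((n - b)`! * b.+1`! = \sum_(Z' in P) (b`! * (n - b)`!))%N.
  by rewrite sum_nat_const /P cards_draws cX' binSn factS; lia.
rewrite -sum1_card (partition_big (fun g : 'S_n => g @: Z) (mem P)) /=; last first.
  move=> g; rewrite !inE card_imset ?cZ ?eqxx ?andbT; last exact: perm_inj.
  move=> H; have cp : #|g @^-1: X'| = b.+1.
    rewrite -cX' -(card_imset (mem (g @^-1: X')) (@perm_inj _ g)).
    apply: eq_card => i; apply/imsetP/idP => [[j]|iA]; first by rewrite inE => jA ->.
    by exists ((g^-1)%g i); rewrite ?permKV //; move: iA; rewrite !inE permKV.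
  have ZS : Z \subset g @^-1: X'.
    rewrite -setD_eq0 -cards_eq0; have := cardsUI X (g @^-1: X').
    have -> : Z :\: g @^-1: X' = ~: (X :|: g @^-1: X') by rewrite setCU setDE.
    have := cardsC (X :|: g @^-1: X'); rewrite card_ord cX cp; move: H.
    by move: #|X :&: _| #|X :|: _| #|~: _| bn => p q r; lia.
  by apply/subsetP => _ /imsetP[i iZ ->]; have := subsetP ZS i iZ; rewrite inE.
apply: leq_sum => Z' _.
apply: (@leq_trans #|[set g : 'S_n | g @: Z == Z']|).
  rewrite -sum1_card [leqLHS]big_mkcond [leqRHS]big_mkcond; apply: leq_sum => g _ /=.
  by rewrite !inE; case: (_ == _); rewrite ?andbF //; case: ifP.
have [->|[g0]] := set_0Vmem [set g : 'S_n | g @: Z == Z']; first by rewrite cards0.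
rewrite inE => /eqP g0Z; rewrite -cZ; apply: leq_trans (card_stable_le Z).
rewrite -(card_imset _ (mulIg (g0^-1)%g)); apply: subset_leq_card; apply/subsetP => _ /imsetP[g gZ ->].
move: gZ; rewrite inE => /eqP gZ; apply/stableP => i; rewrite permM.
have K (h : 'S_n) (j : 'I_n) : h @: Z = Z' -> (h j \in Z') = (j \in Z).
  by move=> <-; rewrite mem_imset //; apply: perm_inj.
by rewrite -(K g0) // permKV K.
Qed.

Lemma card_Young_X : #|Young blk| = (n - b)`!.
Proof. by rewrite -cX -card_perm; apply: eq_card => s; rewrite YX. Qed.

Lemma card_Young_X' : #|Young blk'| = b.+1`!.
Proof. by rewrite -cX' -card_perm; apply: eq_card => s; rewrite YX'. Qed.

Lemma perm_on_sign_sum (D : {set 'I_n}) : (0 < #|D|)%N ->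
  \sum_(s : 'S_n | perm_on D s) (-1) ^+ s = (#|D| <= 1)%N%:R :> algC.
Proof.
move=> D0; case: leqP => [D1|/card_gt1P[x [y [xD yD xy]]]].
  rewrite (big_pred1 1%g) ?odd_perm1 ?expr0 // => s.
  apply/idP/eqP => [sD|->]; last by apply/subsetP => i; rewrite inE perm1 eqxx.
  have := card_perm D; have -> : #|D| = 1%N by lia.
  have [A E] : exists A, [set s | perm_on D s] = [set A].
    by exists 1%g; apply/eqP; rewrite eq_sym eqEcard sub1set inE perm_on1 cards1 cardsE card_perm; have -> : #|D| = 1%N by lia.
  have : s \in [set s | perm_on D s] by rewrite inE.
  have : 1%g \in [set s | perm_on D s] by rewrite inE perm_on1.
  by rewrite E !inE => /eqP -> /eqP.
set S := \sum_(s | _) _; suff /eqP : S = - S by rewrite -addr_eq0 -mulr2n mulrn_eq0 /= => /eqP.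
have tD : perm_on D (tperm x y).
  by apply/subsetP => i; rewrite inE; case: tpermP => [->|->|] //; rewrite eqxx.
rewrite {1}/S (reindex_inj (mulgI (tperm x y))) /= -sumrN; apply: eq_big => s.
  apply/idP/idP => H; last exact: perm_onM.
  by rewrite -[s](mulKg (tperm x y)) perm_onM // perm_onV.
by move=> _; rewrite odd_permM odd_tperm xy signr_addb expr1 mulN1r.
Qed.

(** Column orthogonality rewrites the left side as a signed count of triples (s, t, g) with t = s^g.
    For fixed g, s runs over the permutations supported on both X and the preimage of X', and their
    signs cancel unless this intersection has at most one point. *)
Lemma mult_sum :
  \sum_(i : Iirr [set: 'S_n]) (\sum_(s in Young blk) 'chi_i s) * (\sum_(t in Young blk') (-1) ^+ t * 'chi_i t)^* =
  #|[set g : 'S_n | #|X :&: g @^-1: X'| <= 1]|%:R%N.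
Proof.
transitivity (\sum_(s in Young blk) \sum_(t in Young blk') \sum_(g : 'S_n | (s ^ g)%g == t) (-1) ^+ t : algC).
  under eq_bigr do rewrite big_distrl /=.
  rewrite exchange_big; apply: eq_bigr => s sY.
  under eq_bigr do rewrite rmorph_sum big_distrr /=.
  rewrite exchange_big; apply: eq_bigr => t tY.
  under eq_bigr do rewrite rmorphM /= rmorph_sign mulrCA.
  rewrite -mulr_sumr second_orthogonality_relation ?in_setT // sumr_const -[RHS]mulr_natr; congr (_ * _).
  rewrite -mulrnA; congr (_%:R); rewrite setTI.
  have cE (g : 'S_n) : (g \in 'C[s]%g) = ((s ^ g)%g == s).
    rewrite cent1E; apply/eqP/eqP => [E|E]; first by rewrite conjgE -E mulKg.
    by rewrite [RHS]conjgC E.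
  case: imsetP => [[g0 _ E]|nE]; last first.
    rewrite muln0; apply/esym/eq_card0 => g; apply/negP => H; have E : (s ^ g)%g = t by apply/eqP.
    by case: nE; exists (g^-1)%g; rewrite ?in_setT // -E conjgK.
  rewrite muln1 -(card_imset _ (mulIg (g0^-1)%g)); apply: eq_card => g.
  change ((g \in [set (x * g0^-1)%g | x in 'C[s]%g]) = ((s ^ g)%g == t)).
  apply/imsetP/idP => [[h]|H]; first by rewrite cE => /eqP hs ->; rewrite conjgM hs E conjgK.
  have {H}E' : (s ^ g)%g = t by apply/eqP.
  by exists (g * g0)%g; rewrite ?mulgK // cE conjgM E' [X in _ == X]E.
transitivity (\sum_(s in Young blk) \sum_(g : 'S_n | (s ^ g)%g \in Young blk') (-1) ^+ s : algC).
  apply: eq_bigr => s _; rewrite (exchange_big_dep (fun g : 'S_n => (s ^ g)%g \in Young blk')) /=; last first.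
    by move=> t g tY /eqP ->.
  apply: eq_bigr => g gY; rewrite (big_pred1 (s ^ g)%g) ?odd_permJ // => t.
  by rewrite eq_sym /=; apply/andb_idl => /eqP ->.
rewrite (exchange_big_dep xpredT) //= -sum1_card natr_sum [RHS]big_mkcond /=.
apply: eq_bigr => g _; rewrite (eq_bigl (perm_on (X :&: g @^-1: X'))) ?perm_on_sign_sum.
- by rewrite inE; case: ifP.
- have cp : #|g @^-1: X'| = b.+1.
    rewrite -cX' -(card_imset (mem (g @^-1: X')) (@perm_inj _ g)).
    apply: eq_card => i; apply/imsetP/idP => [[j]|iA]; first by rewrite inE => jA ->.
    by exists ((g^-1)%g i); rewrite ?permKV //; move: iA; rewrite !inE permKV.
  have := cardsUI X (g @^-1: X'); have := cardsC (X :|: g @^-1: X'); rewrite card_ord cX cp.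
  by move: #|X :&: _| #|X :|: _| #|~: _| bn => p q r; lia.
move=> s; rewrite YX YX'; transitivity (perm_on X s && perm_on (g @^-1: X') s); last first.
  apply/andP/subsetP => [[/subsetP sX /subsetP sX'] i si|H]; first by rewrite inE sX ?sX'.
  by split; apply/subsetP => i /H; rewrite inE => /andP[].
  congr andb; apply/subsetP/subsetP => H i.
  rewrite !inE => si; apply: H; rewrite !inE permJ; apply: contra si => /eqP /perm_inj -> //.
rewrite -(permKV g i) !inE permJ (inj_eq (@perm_inj _ g)) => si.
by have := H (g^-1 i)%g; rewrite !inE; apply.
Qed.

(** The products of the two sums are nonnegative and add up to at most (n - b)! (b + 1)!, by
    [mult_sum] and [card_double_coset]. The product for [theta b] alone reaches this, so for every
    other irreducible character one of the two sums is 0. *)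
Lemma hook_irr_unique (i : Iirr [set: 'S_n]) :
    \sum_(s in Young blk) 'chi_i s != 0 ->
    \sum_(s in Young blk') (-1) ^+ s * 'chi_i s != 0 ->
  forall s, 'chi_i s = theta b s.
Proof.
move=> m1 m2; have [j jE] := theta_irr n_gt0 bn.
pose m (i : Iirr [set: 'S_n]) : algC := \sum_(s in Young blk) 'chi_i s.
pose m' (i : Iirr [set: 'S_n]) : algC := \sum_(s in Young blk') (-1) ^+ s * 'chi_i s.
have m_ge0 i0 : 0 <= m i0.
  have := @char_sum_ge0 _ [group of [set: 'S_n]] (Young_group blk) (fun=> false) i0 (subsetT _) (fun _ _ _ _ => erefl).
  by congr (0 <= _); apply: eq_bigr => s _; rewrite expr0 mul1r.
have m'_ge0 i0 : 0 <= m' i0.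
  apply: (@char_sum_ge0 _ [group of [set: 'S_n]] (Young_group blk') (@odd_perm _) i0 (subsetT _)).
  by move=> s t _ _; rewrite odd_permM.
have := mult_sum; rewrite (bigD1 j) //=.
have -> : \sum_(s in Young blk) 'chi_j s = (n - b)`!%:R.
  under eq_bigr do rewrite jE.
  by rewrite theta_Young // l1 binn muln1 card_Young_X.
have -> : \sum_(s in Young blk') (-1) ^+ s * 'chi_j s = b.+1`!%:R.
  under eq_bigr do rewrite jE.
  by rewrite theta_Young_sign // l2 (_ : (n - b).-1 = n.-1 - b)%N ?binn ?muln1 ?card_Young_X' //; lia.
rewrite (conj_natr (natr_nat _ _)) => E.
have [->|ij s] := eqVneq i j; first exact: jE.
have : \sum_(k | k != j) m k * (m' k)^* <= 0.
  have := card_double_coset; rewrite -(ler_nat algC) natrM -E.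
  by rewrite -subr_ge0 opprD addNKr oppr_ge0.
rewrite (bigD1 i) //= => le0.
have nn k : 0 <= m k * (m' k)^* by rewrite mulr_ge0 // conjC_ge0.
have : m i * (m' i)^* == 0.
  rewrite eq_le nn andbT; apply: le_trans le0; rewrite lerDl sumr_ge0 // => k _; exact: nn.
by rewrite mulf_eq0 conjC_eq0 (negPf m1) (negPf m2).
Qed.
End Hook.

(** * Partitions, blocks and characters at a full cycle *)

Lemma cycle_type_full n (s : 'S_n) (A : {set 'I_n}) : (0 < n)%N ->
  cycle_type_is [:: n] s -> s \in 'N(A | 'P)%g -> A = set0 \/ A = [set: 'I_n].
Proof.
move=> n0 Hs /stableP sA; have [->|[x xA]] := set_0Vmem A; [by left|right].
have cx : #|porbit s x| = n.
  have : #|porbit s x| \in [seq #|X| | X : {set 'I_n} <- enum (porbits s)].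
    by apply: map_f; rewrite mem_enum imset_f.
  by rewrite (perm_mem Hs) inE => /eqP.
have xT : porbit s x = [set: 'I_n] by apply/eqP; rewrite eqEcard subsetT cardsT card_ord cx /=.
apply/setP => y; rewrite inE; have : y \in porbit s x by rewrite xT inE.
case/porbitP => k ->; elim: k => [|k IH]; first by rewrite expg0 perm1.
by rewrite expgSr permM sA.
Qed.

Lemma exists_cycle n : (0 < n)%N -> exists s : 'S_n, cycle_type_is [:: n] s.
Proof.
move=> n0; pose s : 'S_n := perm (@ordS_inj n); exists s; rewrite /cycle_type_is.
have E k (i : 'I_n) : val ((s ^+ k)%g i) = ((i + k) %% n)%N.
  elim: k => [|k IH]; first by rewrite expg0 perm1 addn0 modn_small.
  by rewrite expgSr permM permE /= IH -addn1 modnDml addn1 addnS.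
have oT i : porbit s i = [set: 'I_n].
  apply/setP => j; rewrite inE; apply/porbitP; exists (j + (n - i))%N.
  apply/val_inj; rewrite E addnCA subnKC; last exact: ltnW.
  by rewrite modnDr modn_small.
have -> : porbits s = [set [set: 'I_n]].
  apply/setP => B; rewrite inE; apply/imsetP/eqP => [[i _ ->]|->]; first exact: oT.
  by exists (Ordinal n0).
by rewrite enum_set1 /= cardsT card_ord.
Qed.

Definition block n (mu : seq nat) (i : 'I_n) : 'I_(size mu).+1 := inord (reshape_index mu i).

Lemma blockE n mu (i : 'I_n) : sumn mu = n -> block mu i = reshape_index mu i :> nat.
Proof. by move=> mun; rewrite inordK // ltnW // ltnS reshape_indexP // mun. Qed.

Lemma young_Young n mu : sumn mu = n -> young n mu = Young (@block n mu).
Proof.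
move=> mun; apply/setP => s; rewrite !inE; apply: eq_forallb => i.
by rewrite -(inj_eq val_inj) /= !blockE.
Qed.

Lemma card_block n mu : sumn mu = n -> 0%N \notin mu -> #|@block n mu @: [set: 'I_n]| = size mu.
Proof.
move=> mun mu0; rewrite -[RHS]card_ord -(card_imset _ (f := widen_ord (leqnSn (size mu)))); last first.
  by move=> i j /(congr1 val) /= /val_inj.
apply: eq_card => j; apply/imsetP/imsetP => [[i _ ->]|[k _ ->]].
  have H : (reshape_index mu i < size mu)%N by rewrite reshape_indexP // mun.
  by exists (Ordinal H) => //; apply/val_inj; rewrite /= blockE.
have k0 : (0 < nth 0 mu k)%N by rewrite lt0n; apply: contraNneq mu0 => <-; apply: mem_nth.
have H : (flatten_index mu k 0 < n)%N by rewrite -mun flatten_indexP.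
by exists (Ordinal H) => //; apply/val_inj; rewrite /= blockE //= flatten_indexKl.
Qed.

Lemma size_conj_part mu : size (conj_part mu) = head 0%N mu.
Proof. by rewrite size_mkseq. Qed.

Lemma part_le_head mu k : is_part mu -> k \in mu -> (k <= head 0 mu)%N.
Proof.
case: mu => // h m /andP[/= hm _]; rewrite inE => /orP[/eqP -> //|km].
by have /allP/(_ k km) := order_path_min (rev_trans leq_trans) hm.
Qed.

Lemma conj_part_pos mu : 0%N \notin conj_part mu.
Proof.
apply/negP => /mapP[j]; rewrite mem_iota add0n /= => jh /esym/eqP.
rewrite -leqn0 leqNgt -has_count; case: mu jh => // h m /= ->; by [].
Qed.

Lemma sumn_conj_part mu : is_part mu -> sumn (conj_part mu) = sumn mu.
Proof.
move=> hmu; rewrite !sumnE big_map (eq_bigr (fun j => \sum_(k <- mu) (j < k)%N)%N); last first.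
  by move=> j _; rewrite -sum1_count big_mkcond; apply: eq_bigr => k _; case: ifP.
rewrite exchange_big /= big_seq [RHS]big_seq; apply: eq_bigr => k /(part_le_head hmu).
elim: (head 0%N mu) k => [|h IH] k kh; first by rewrite big_nil; lia.
rewrite -addn1 iotaD big_cat big_seq1 add0n.
case: (ltnP h k) => hk; last by rewrite IH //= ?addn0.
have -> : k = h.+1 by lia.
rewrite (eq_big_seq (fun=> 1%N)) => [|j]; last by rewrite mem_iota; lia.
by rewrite big_const_seq iter_addn_0 count_predT size_iota /=; lia.
Qed.

(** The first row and the first column share one cell. The extremal case characterizes hooks
    ([hook_part]), and is the form in which being a hook is tested below. *)
Lemma size_head_le mu : is_part mu -> (size mu + head 0 mu <= (sumn mu).+1)%N.
Proof.
case: mu => [|h m] //= /andP[_]; rewrite inE negb_or => /andP[_ m0].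
suff : (size m <= sumn m)%N by lia.
by elim: m m0 => //= k m IH; rewrite inE negb_or => /andP[k0 /IH]; lia.
Qed.

Lemma hook_part mu : is_part mu -> (0 < sumn mu)%N -> (size mu + head 0 mu = (sumn mu).+1)%N ->
  mu = head 0%N mu :: nseq (size mu).-1 1%N.
Proof.
case: mu => [|h m] //= /andP[_]; rewrite inE negb_or => /andP[_ m0] _ E; congr cons.
have {E} : sumn m = size m by lia.
elim: m m0 => //= k m IH; rewrite inE negb_or => /andP[k0 m0].
have : (size m <= sumn m)%N.
  by elim: m m0 {IH} => //= k' m IH; rewrite inE negb_or => /andP[k0' /IH]; lia.
by move=> ms E; rewrite -IH //; [congr cons|]; lia.
Qed.

Lemma conj_hook h b : (0 < h)%N -> conj_part (h :: nseq b 1%N) = b.+1 :: nseq h.-1 1%N.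
Proof.
case: h => // h _; apply: (@eq_from_nth _ 0%N); first by rewrite size_mkseq /= size_nseq.
move=> [|i]; rewrite size_mkseq => ih; rewrite /conj_part nth_mkseq // [count _ _]/= count_nseq //= ?ltnS.
  by rewrite mul1n add1n.
by rewrite nth_nseq; case: ifP; lia.
Qed.

Lemma reshape_index_hook h b i : (i < h + b)%N -> 
  reshape_index (h :: nseq b 1%N) i = if (i < h)%N then 0%N else (i - h).+1.
Proof.
move=> ihb; rewrite /reshape_index /= subn_eq0; case: ifP => // hi; congr S.
have -> : (i.+1 - h = (i - h).+1)%N by lia.
rewrite -/(reshape_index _ _); have : (i - h < b)%N by lia.
move: (i - h)%N => j jb; rewrite -{1}[j]addn0.
have -> : (j + 0 = flatten_index (nseq b 1%N) j 0)%N.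
  rewrite /flatten_index; congr addn; rewrite take_nseq ?(ltnW jb) // sumn_nseq; lia.
by rewrite flatten_indexKl // nth_nseq jb.
Qed.

Lemma Young_hook n h b : (h + b = n)%N -> (0 < h)%N -> 
  forall s : 'S_n, (s \in Young (@block n (h :: nseq b 1%N))) = perm_on [set i : 'I_n | (i < h)%N] s.
Proof.
move=> hbn h0 s; have mun : sumn (h :: nseq b 1%N) = n by rewrite /= sumn_nseq; lia.
have E (i : 'I_n) : block (h :: nseq b 1%N) i = (if (i < h)%N then 0%N else (i - h).+1) :> nat.
  by rewrite blockE // reshape_index_hook // hbn.
apply/YoungP/subsetP => [H i|H i].
  rewrite !inE; apply: contraR => ih; apply/eqP/val_inj => /=.
  have /(congr1 val) /= := H i; rewrite !E (negPf ih); move: ih; case: ltnP => // ih _; case: ltnP => // sih []; move: ih sih; move: (nat_of_ord (s i)) (nat_of_ord i) => p q; lia.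
apply/val_inj; rewrite /= !E.
case: (boolP (s i == i)) => [/eqP -> //|si].
have := H i; rewrite !inE => /(_ si) ->.
suff : (s i < h)%N by move=> ->.
by have := H (s i); rewrite !inE; apply; rewrite (inj_eq (@perm_inj _ s)).
Qed.

Lemma indexed_byE mu (i : Iirr [set: 'S_(sumn mu)]) : is_part mu ->
  indexed_by mu i = (\sum_(s in Young (@block (sumn mu) mu)) 'chi_i s != 0) &&
    (\sum_(s in Young (@block (sumn mu) (conj_part mu))) (-1) ^+ s * 'chi_i s != 0).
Proof. by move=> hmu; rewrite /indexed_by !young_Young // sumn_conj_part. Qed.

Lemma chi_full_cycle mu : is_part mu -> (0 < sumn mu)%N ->
  chi mu [:: sumn mu] = if (size mu + head 0 mu == (sumn mu).+1)%N then (-1) ^+ (size mu).-1 else 0.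
Proof.
move=> hmu n0; rewrite /chi; set n := sumn mu in n0 *.
have mu0 : 0%N \notin mu by case/andP: hmu.
have l1 : #|@block n mu @: [set: 'I_n]| = size mu by apply: card_block.
have l2 : #|@block n (conj_part mu) @: [set: 'I_n]| = head 0%N mu.
  by rewrite card_block ?size_conj_part // ?conj_part_pos // sumn_conj_part.
have sz := size_head_le hmu; have sz1 : (0 < size mu)%N by rewrite lt0n size_eq0; apply: contraL n0 => /eqP E; rewrite /n E.
have [c0 c0P] := exists_cycle n0.
case: (pickP (fun s : 'S_n => cycle_type_is [:: n] s)) => [c cP|/(_ c0)]; last by rewrite c0P.
have cA A := @cycle_type_full n c A n0 cP.
case: ifP => [/eqP hook|nhook]; last first.
  (* Not a hook: if the selected character were [theta k], its two sums would give k < [size mu] and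
     n - 1 - k < [head 0 mu], which with [size_head_le] forces a hook. If none is selected, [chi] is
     0 by default. *)
  case: pickP => // i; rewrite indexed_byE // => /andP[m1 m2].
  rewrite (irr_cycle n0 cA) ?floor0 // => k kn; apply/existsP; rewrite -negb_forall. 
  apply/negP => /forallP chiE; move: m1 m2.
  rewrite (eq_bigr (theta k)) => [|s _]; last exact/eqP/chiE.
  rewrite theta_Young // l1 pnatr_eq0 muln_eq0 negb_or -[X in _ && X]lt0n bin_gt0 => /andP[_ k1].
  rewrite (eq_bigr (fun s : 'S_n => (-1) ^+ s * theta k s)) => [|s _]; last by congr (_ * _); apply/eqP/chiE.
  rewrite theta_Young_sign // l2 pnatr_eq0 muln_eq0 negb_or -[X in _ && X]lt0n bin_gt0 => /andP[_ k2].
  have := blk_gt0 n0 (@block n (conj_part mu)); rewrite l2.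
  by move: nhook; rewrite -/n in sz *; lia.
pose b := (size mu).-1; pose h := head 0%N mu.
have muE : mu = h :: nseq b 1%N by apply: hook_part.
have h0 : (0 < h)%N by rewrite lt0n; apply: contra mu0 => /eqP E; rewrite muE E mem_head.
have hbn : (h + b = n)%N by rewrite /h /b /n; lia.
have bn : (b < n)%N by lia.
have cX k : (k <= n)%N -> #|[set i : 'I_n | (i < k)%N]| = k.
  move=> kn; rewrite -[RHS]card_ord -[RHS](card_codom (f := widen_ord kn)); last first.
    by move=> i j /(congr1 val) /= /val_inj.
  apply: eq_card => i; rewrite inE; apply/idP/codomP => [ik|[j ->]]; last exact: (ltn_ord j).
  by exists (Ordinal ik); apply: val_inj.
have YX : forall s : 'S_n, (s \in Young (@block n mu)) = perm_on [set i : 'I_n | (i < h)%N] s.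
  by rewrite muE; apply: Young_hook.
have YX' : forall s : 'S_n, (s \in Young (@block n (conj_part mu))) = perm_on [set i : 'I_n | (i < b.+1)%N] s.
  by rewrite muE conj_hook //; apply: Young_hook; lia.
have l1' : #|@block n mu @: [set: 'I_n]| = b.+1 by rewrite l1 prednK.
have l2' : #|@block n (conj_part mu) @: [set: 'I_n]| = (n - b)%N by rewrite l2 -/h; lia.
have [j jE] := theta_irr n0 bn.
(* Both binomial coefficients are 1 for leg b, so [pick] does find a character; uniqueness then
   identifies the one it finds. *)
have jI : indexed_by mu j.
  rewrite indexed_byE //; apply/andP; split.
    rewrite (eq_bigr (theta b)) // theta_Young // l1' pnatr_eq0 muln_eq0 negb_or -!lt0n.
    by rewrite binn cardG_gt0.
  rewrite (eq_bigr (fun s : 'S_n => (-1) ^+ s * theta b s)); last by move=> s _; rewrite jE.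
  rewrite theta_Young_sign // l2' pnatr_eq0 muln_eq0 negb_or -!lt0n.
  by rewrite bin_gt0 cardG_gt0 /=; lia.
case: pickP => [i|/(_ j)]; last by rewrite jI.
rewrite indexed_byE // => /andP[m1 m2].
rewrite (hook_irr_unique n0 YX YX' bn _ _ l1' l2' m1 m2) ?cX //; try lia.
rewrite theta_cycle // (_ : (-1) ^+ b = ((-1) ^+ b : int)%:~R :> algC) ?intrKfloor //.
by rewrite rmorphXn /= rmorphN1.
Qed.

Lemma chi_nil : chi [::] [::] = 1.
Proof.
rewrite /chi /=; case: pickP => [i _|/(_ 0)]; last first.
  rewrite /indexed_by /conj_part /=.
  have E (A : {set 'S_0}) : 1%g \in A -> A = [set 1%g].
    move=> A1; apply/setP => s; rewrite inE; have -> : s = 1%g by apply/permP => -[].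
    by rewrite eqxx.
  have Y mu : 1%g \in young 0 mu by rewrite inE; apply/forallP => -[].
  rewrite !(E _ (Y _)) !big_set1 odd_perm1 expr0 mul1r.
  by rewrite -[_ != 0]/(~~ ('chi_0 1%g == 0)) irr1_neq0.
case: pickP => [s _|/(_ 1%g)]; last first.
  rewrite /cycle_type_is; have -> : porbits (1%g : 'S_0) = set0.
    by apply/setP => B; rewrite inE; apply/imsetP => -[[]].
  by rewrite enum_set0.
have -> : s = 1%g by apply/permP => -[].
have : 'chi_i 1%g = 1.
  have ab : abelian [set: 'S_0].
    by apply/centsP => x _ y _; apply/permP => -[].
  by apply/eqP; have /char_abelianP/(_ i) := ab; rewrite qualifE => /andP[_ ->].
by move=> ->; rewrite floor1.
Qed.

(** * The dual Jacobi-Trudi and Cauchy identities *)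

(** The integer Vandermonde matrix at the nodes s i is the one at the nodes i with its columns
    permuted; the signs of the two determinants are compared. *)
Lemma perm_sign_prod n (s : 'S_n) :
  (-1) ^+ s = \prod_(i < n) \prod_(j < n | (i < j)%N) Num.sg ((s j)%:Z - (s i)%:Z) :> int.
Proof.
pose V (f : 'I_n -> nat) := Vandermonde n (\row_(i < n) (f i)%:Z).
have detV f : \det (V f) = \prod_(i < n) \prod_(j < n | (i < j)%N) ((f j)%:Z - (f i)%:Z).
  by rewrite det_Vandermonde; apply: eq_bigr => i _; apply: eq_bigr => j _; rewrite !mxE.
have Es : V (fun i => s i) = col_perm s (V (fun i => i)).
  by apply/matrixP => i j; rewrite !mxE.
have : \det (V (fun i => s i)) = (-1) ^+ s * \det (V (fun i => i)).
  by rewrite Es col_permE det_mulmx det_perm mulrC odd_permV.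
rewrite !detV => /(congr1 Num.sg).
have sgP (f : 'I_n -> nat) : Num.sg (\prod_(i < n) \prod_(j < n | (i < j)%N) ((f j)%:Z - (f i)%:Z)) =
   \prod_(i < n) \prod_(j < n | (i < j)%N) Num.sg ((f j)%:Z - (f i)%:Z).
  rewrite (big_morph _ (@sgrM _) (@sgr1 _)); apply: eq_bigr => i _.
  by rewrite (big_morph _ (@sgrM _) (@sgr1 _)).
rewrite sgrM !sgP [X in _ = _ * X]big1 => [->|i _]; last first.
  by apply: big1 => j ij; rewrite gtr0_sg // subr_gt0 ltz_nat.
by rewrite mulr1 sgrX sgrN sgr1.
Qed.

Lemma sum_ord_lt m L : (m <= L)%N -> (\sum_(k < L) (k < m) = m)%N.
Proof.
move=> mL; rewrite -big_mkcond sum1_card -[RHS]card_ord.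
rewrite -(card_imset _ (f := widen_ord mL)); last by move=> p q /(congr1 val) /= /val_inj.
apply: eq_card => k; apply/idP/imsetP => [km|[j _ ->]]; last exact: (ltn_ord j).
by exists (Ordinal km) => //; apply: val_inj.
Qed.

Section DualJacobiTrudi.
Variable F : comNzRingType.
Variable x : nat -> F.

Fixpoint elsym (N k : nat) : F :=
  if N is N'.+1 then elsym N' k + (if k is k'.+1 then x N' * elsym N' k' else 0)
  else (k == 0%N)%:R.

Lemma elsym0 N : elsym N 0 = 1.
Proof. by elim: N => //= N ->; rewrite addr0. Qed.

Lemma elsym_gt N k : (N < k)%N -> elsym N k = 0.
Proof.
elim: N k => [|N IH] [|k] //= Nk; rewrite !IH ?mulr0 ?addr0 //; exact: ltnW.
Qed.

Lemma coef_prod_1DX N k : (\prod_(i < N) (1 + (x i)%:P * 'X))`_k = elsym N k.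
Proof.
elim: N k => [|N IH] k; first by rewrite big_ord0 coef1.
rewrite big_ord_recr /= mulrDr mulr1 coefD IH; congr (_ + _).
rewrite mulrCA coefCM; case: k => [|k]; first by rewrite coefMX mulr0.
by rewrite coefMX IH.
Qed.

Lemma coef_prod_XsubC N m :
  (\prod_(i < N) ('X - (x i)%:P))`_m = if (m <= N)%N then (-1) ^+ (N - m) * elsym N (N - m) else 0.
Proof.
elim: N m => [|N IH] m; first by rewrite big_ord0 coef1; case: m => //=; rewrite mulr1.
rewrite big_ord_recr /= mulrBr coefB coefMX coefMC.
case: m => [|m] /=.
  by rewrite IH !subn0 /= exprS (@elsym_gt N N.+1) // add0r; ring.
rewrite ltnS !IH subSS; case: (ltngtP m N) => mN; last first.
- by rewrite mN subnn !elsym0 expr0 mulr1 /= ?mul0r ?subr0 ?addr0 ?mul1r.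
- by rewrite mul0r subr0.
have -> : (N - m = (N - m.+1).+1)%N by lia.
by rewrite exprS; ring.
Qed.

Variables (N M : nat).
Notation n := (N + M)%N.
Variables (a : 'I_N -> nat) (c : 'I_M -> nat).
Hypotheses (aM : forall j, (a j <= M)%N) (cN : forall k, (c k <= N)%N).
Hypotheses (a_dec : forall i j : 'I_N, (i <= j)%N -> (a j <= a i)%N)
           (c_dec : forall i j : 'I_M, (i <= j)%N -> (c j <= c i)%N).
Hypothesis ac : forall (j : 'I_N) (k : 'I_M), (k < a j)%N = (j < c k)%N.

(** For conjugate partitions a and c in an N by M box ([ac] is the conjugacy), the numbers a_j + N -
    1 - j and N + k - c_k together are 0, ..., N + M - 1, each once. *)
Definition jt_fun (m : 'I_n) : nat :=
  match split m with inl j => (a j + (N - j.+1))%N | inr k => (N + k - c k)%N end.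

Lemma jt_fun_lt m : (jt_fun m < n)%N.
Proof.
rewrite /jt_fun; case: splitP => [j _|k _].
  by have := aM j; have := ltn_ord j; lia.
by have := cN k; have := ltn_ord k; lia.
Qed.

Lemma jt_fun_inj : injective (fun m => Ordinal (jt_fun_lt m)).
Proof.
have lt1 (i j : 'I_N) : (i < j)%N -> (a j + (N - j.+1) < a i + (N - i.+1))%N.
  by move=> ij; have := a_dec (ltnW ij); have := ltn_ord j; lia.
have lt2 (i j : 'I_M) : (i < j)%N -> (N + i - c i < N + j - c j)%N.
  by move=> ij; have := c_dec (ltnW ij); have := cN i; lia.
have ne (j : 'I_N) (k : 'I_M) : (a j + (N - j.+1) != N + k - c k)%N.
  have := ac j k; have := ltn_ord j; have := cN k; case: (ltnP k (a j)); case: (ltnP j (c k)) => //; lia.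
move=> m m' /(congr1 val) /=; rewrite /jt_fun => E; apply: val_inj => /=; move: E.
case: splitP => [j ->|k ->]; case: splitP => [j' ->|k' ->] E.
- by case: (ltngtP j j') => // /lt1; rewrite E ltnn.
- by have := ne j k'; rewrite E eqxx.
- by have := ne j' k; rewrite E eqxx.
by case: (ltngtP k k') => [/lt2|/lt2|->]; rewrite ?E ?ltnn.
Qed.

Definition jt_perm : 'S_n := perm jt_fun_inj.

Lemma jt_permL j : jt_perm (lshift M j) = (a j + (N - j.+1))%N :> nat.
Proof. by rewrite permE /= /jt_fun; case: splitP => [j' /= /val_inj ->|k /= E] //; have := ltn_ord j; lia. Qed.

Lemma jt_permR k : jt_perm (rshift N k) = (N + k - c k)%N :> nat.
Proof.
rewrite permE /= /jt_fun; case: splitP => [j /= E|k' /= /addnI /val_inj ->] //.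
by have := ltn_ord j; lia.
Qed.

(** All pairs of the first N indices are inverted, none of the last M, and a mixed pair (j, k)
    exactly when k < a_j. Only the factor counting the cells depends on a. *)
Lemma jt_perm_sign : (-1) ^+ jt_perm =
   (\prod_(i < N) \prod_(j < N | (i < j)%N) -1) * (-1) ^+ (\sum_(j < N) a j) :> int.
Proof.
rewrite perm_sign_prod big_split_ord /= [X in _ * X]big1 ?mulr1; last first.
  move=> k _; rewrite big1 // => j; case: (split_ordP j) => [j' ->|k' ->] /=; first by have := ltn_ord j'; lia.
  rewrite !jt_permR ltn_add2l => kk'; rewrite gtr0_sg // subr_gt0 ltz_nat.
  by have := c_dec (ltnW kk'); have := cN k; lia.
rewrite (eq_bigr (fun i : 'I_N => (\prod_(j < N | (i < j)%N) -1) * (-1) ^+ a i)).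
  by rewrite big_split /= prodrXr.
move=> i _; rewrite big_mkcond big_split_ord /=; congr (_ * _).
  rewrite -big_mkcond; apply: eq_bigr => j ij; rewrite !jt_permL ltr0_sg // subr_lt0 ltz_nat.
  by have := a_dec (ltnW ij); have := ltn_ord j; lia.
rewrite (eq_bigr (fun k : 'I_M => (-1) ^+ (k < a i)%N)).
  rewrite prodrXr; congr (_ ^+ _).
  exact: sum_ord_lt.
move=> k _; rewrite /= (leq_trans (ltn_ord i) (leq_addr _ _)) jt_permL jt_permR.
have := ac i k; have := ltn_ord i; have := cN k; case: (ltnP k (a i)) => ka ck iN ick.
  by rewrite ltr0_sg ?expr1 // subr_lt0 ltz_nat; lia.
by rewrite gtr0_sg ?expr0 // subr_gt0 ltz_nat; lia.
Qed.

(** [V] evaluates polynomials at the x_i and the columns of [R] are coefficient vectors of multiples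
    of P, so [V *m R = 0] and complementary minors of [V] and [R] agree up to sign and a common
    factor. [U] completes [V] to a square matrix. *)
Let P := \prod_(i < N) ('X - (x i)%:P).
Let V : 'M[F]_(N, n) := \matrix_(i, m) x i ^+ m.
Let U : 'M[F]_(M, n) := \matrix_(k, m) (m == N + k :> nat)%:R.
Let R : 'M[F]_(n, M) := \matrix_(m, k) ('X^k * P)`_m.

(** The guard makes entries of negative index 0; truncated subtraction alone would give [elsym N 0],
    which is 1. *)
Definition jt_mx : 'M[F]_M :=
  \matrix_(k, l) (if (k <= c k + l)%N then elsym N (c k + l - k) else 0).

Lemma size_prod_X : size P = N.+1.
Proof. by rewrite size_prod_XsubC /index_enum -enumT size_enum_ord. Qed.

Lemma jt_VR : V *m R = 0.
Proof.
apply/matrixP => i k; rewrite !mxE.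
have : ('X^k * P).[x i] = 0.
  by rewrite hornerM /P (bigD1 i) //= hornerM hornerXsubC subrr mul0r mulr0.
rewrite (@horner_coef_wide _ n) => [E|].
  by rewrite -[RHS]E; apply: eq_bigr => m _; rewrite !mxE mulrC.
rewrite (leq_trans (size_polyMleq _ _)) // size_polyXn size_prod_X.
by have := ltn_ord k; lia.
Qed.

Lemma jt_UR k l : (U *m R) k l = if (l <= N + k)%N then P`_(N + k - l) else 0.
Proof.
rewrite mxE (bigD1 (rshift N k)) //= big1 ?addr0 => [|m mk]; last first.
  rewrite mxE; case: eqP => [E|_]; last by rewrite mul0r.
  by case/eqP: mk; apply: val_inj.
by rewrite !mxE eqxx mul1r coefXnM; case: ltnP => // _; rewrite if_same.
Qed.

Lemma det_jt_UR : \det (U *m R) = 1.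
Proof.
rewrite -det_tr det_trig; last first.
  apply/is_trig_mxP => l k lk; rewrite mxE jt_UR; case: ifP => // _.
  by rewrite nth_default // size_prod_X; lia.
apply: big1 => k _; rewrite mxE jt_UR leq_addl addnK coef_prod_XsubC leqnn subnn elsym0.
by rewrite expr0 mulr1.
Qed.

(** Jacobi's complementary minors: the minor of [V] in the columns a_j + N - 1 - j against that of
    [R] in the remaining rows. *)
Lemma jt_complement : (-1) ^+ jt_perm * \det (col_mx V U) * \det (\matrix_(k, l) R (jt_perm (rshift N k)) l) =
  \det (\matrix_(i < N, j < N) x i ^+ (a j + (N - j.+1))).
Proof.
pose Fp := col_perm jt_perm (col_mx V U); pose Rp := row_perm jt_perm R.
have FR : Fp *m Rp = col_mx 0 (U *m R).
  rewrite /Fp /Rp col_permE row_permE mulmxA -(mulmxA _ (perm_mx _) (perm_mx _)) -perm_mxM mulVg perm_mx1 mulmx1.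
  by rewrite mul_col_mx jt_VR.
(* Right multiplication by B replaces the last M columns of Fp by those of [Fp *m Rp], whose upper
   block vanishes and whose lower block has determinant 1. *)
pose B := block_mx (1%:M : 'M[F]_N) (usubmx Rp) 0 (dsubmx Rp).
have FB : Fp *m B = block_mx (ulsubmx Fp) 0 (dlsubmx Fp) (U *m R).
  rewrite -[X in X *m _]submxK mulmx_block !mulmx1 !mulmx0 !addr0.
  have : block_mx (ulsubmx Fp) (ursubmx Fp) (dlsubmx Fp) (drsubmx Fp) *m col_mx (usubmx Rp) (dsubmx Rp) = col_mx 0 (U *m R).
    by rewrite submxK vsubmxK.
  by rewrite mul_block_col => /eq_col_mx[-> ->].
have := congr1 (fun A => \det A) FB; rewrite det_mulmx det_lblock det_ublock det1 mul1r det_jt_UR mulr1.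
have -> : \det Fp = (-1) ^+ jt_perm * \det (col_mx V U).
  by rewrite /Fp col_permE det_mulmx det_perm odd_permV mulrC.
have -> : dsubmx Rp = \matrix_(k, l) R (jt_perm (rshift N k)) l.
  by apply/matrixP => k l; rewrite !mxE.
move=> ->; congr (\det _); apply/matrixP => i j; rewrite !mxE.
by rewrite -jt_permL; case: splitP => [i' /= /val_inj <-|k /= E]; rewrite ?mxE //; have := ltn_ord i; lia.
Qed.

Lemma det_jt_R : \det (\matrix_(k, l) R (jt_perm (rshift N k)) l) =
  (-1) ^+ (\sum_k c k) * \det jt_mx.
Proof.
(* Row signs (-1)^(c_k + k) and column signs (-1)^l absorb those of the coefficients of P. *)
pose D1 := diag_mx (\row_(k < M) ((-1) ^+ (c k) * (-1) ^+ k) : 'rV[F]_M).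
pose D2 := diag_mx (\row_(k < M) (-1) ^+ k : 'rV[F]_M).
have -> : \matrix_(k, l) R (jt_perm (rshift N k)) l = D1 *m jt_mx *m D2.
  apply/matrixP => k l; rewrite mul_mx_diag mul_diag_mx !mxE jt_permR coefXnM.
  have := cN k => ck; case: ltnP => H1.
    case: ifP => H2; last by rewrite mulr0 mul0r.
    by rewrite elsym_gt ?mulr0 ?mul0r //; lia.
  rewrite coef_prod_XsubC; have -> : (N + k - c k - l <= N)%N = (k <= c k + l)%N by lia.
  case: ifP => H2; last by rewrite mulr0 mul0r.
  have -> : (N - (N + k - c k - l) = c k + l - k)%N by lia.
  rewrite mulrAC -!exprD; congr (_ * _).
  rewrite -signr_odd -[RHS]signr_odd; congr (_ ^+ (nat_of_bool _)).
  by rewrite !oddD oddB // oddD; case: (odd _); case: (odd _); case: (odd _).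
rewrite !det_mulmx !det_diag mulrAC; congr (_ * _).
rewrite -big_split /= -prodrXr; apply: eq_bigr => k _; rewrite !mxE.
by rewrite -mulrA -exprD addnn -mul2n mulnC exprM sqrr_sign mulr1.
Qed.
End DualJacobiTrudi.

(** [jt_complement] for the given partitions and for the empty one share the factor
    [\det (col_mx V U)]. Comparing the two eliminates it without a division. *)
Lemma dual_jacobi_trudi (F : comNzRingType) (x : nat -> F) (N M : nat) (a : 'I_N -> nat) (c : 'I_M -> nat) :
    (forall j, (a j <= M)%N) -> (forall k, (c k <= N)%N) ->
    (forall i j : 'I_N, (i <= j)%N -> (a j <= a i)%N) ->
    (forall i j : 'I_M, (i <= j)%N -> (c j <= c i)%N) ->
    (forall (j : 'I_N) (k : 'I_M), (k < a j)%N = (j < c k)%N) ->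
  \det (\matrix_(i < N, j < N) x i ^+ (a j + (N - j.+1))) =
  \det (\matrix_(i < N, j < N) x i ^+ (N - j.+1)) * \det (jt_mx x N c).
Proof.
move=> aM cN a_dec c_dec ac.
have sumE (K L : nat) (f : 'I_K -> nat) : (forall j, f j <= L)%N ->
    (\sum_j f j = \sum_j \sum_(k < L) (k < f j))%N.
  by move=> fL; apply: eq_bigr => j _; rewrite sum_ord_lt.
have Eac : (\sum_j a j = \sum_k c k)%N.
  rewrite (sumE _ _ _ aM) (sumE _ _ _ cN) exchange_big; apply: eq_bigr => k _; apply: eq_bigr => j _.
  by rewrite ac.
have sgnE K (s : 'S_K) (z : int) : (-1) ^+ s = z -> (-1) ^+ s = z%:~R :> F.
  by move=> <-; rewrite rmorphXn rmorphN1.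
have E0 := @jt_complement F x N M (fun=> 0%N) (fun=> 0%N) (fun=> leq0n _) (fun=> leq0n _) (fun _ _ _ => leqnn _) (fun _ _ _ => leqnn _) (fun _ _ => erefl).
have E1 := @jt_complement F x N M a c aM cN a_dec c_dec ac.
rewrite det_jt_R (sgnE _ _ _ (jt_perm_sign _ _ _ _ _)) in E1.
rewrite det_jt_R (sgnE _ _ _ (jt_perm_sign _ _ _ _ _)) in E0.
have J0 : \det (jt_mx x N (fun _ : 'I_M => 0%N)) = 1.
  rewrite -det_tr det_trig; last by apply/is_trig_mxP => l k lk; rewrite !mxE add0n leqNgt lk.
  by apply: big1 => k _; rewrite !mxE add0n leqnn subnn elsym0.
rewrite J0 !big1_eq !expr0 !mulr1 in E0.
under [X in \det X * _]eq_mx do rewrite -[(N - _)%N]add0n.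
rewrite -E0 -E1 Eac rmorphM rmorphXn rmorphN1 /=.
rewrite mulrA; congr (_ * _); rewrite [LHS]mulrAC -[X in X * _]mulrA -exprD addnn -mul2n mulnC exprM sqrr_sign.
by rewrite mulr1.
Qed.

(** * The Cauchy-Binet formula and the dual Cauchy identity *)

Section CauchyBinet.
Variables (N L : nat).
Implicit Types f g : {ffun 'I_N -> 'I_L}.

Definition decreasing g : bool := [forall i : 'I_N, forall j : 'I_N, (i < j)%N ==> (g j < g i)%N].

Lemma decreasingP g : reflect (forall i j : 'I_N, (i < j)%N -> (g j < g i)%N) (decreasing g).
Proof.
apply: (iffP forallP) => [H i j ij|H i]; first by have /forallP/(_ j)/implyP/(_ ij) := H i.
by apply/forallP => j; apply/implyP/H.
Qed.

Lemma decreasing_inj g : decreasing g -> injective g.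
Proof.
move=> /decreasingP H i j gij; apply/val_inj.
by case: (ltngtP i j) => // /H; rewrite gij ltnn.
Qed.

Lemma sort_factor f : injective f ->
  exists g (s : 'S_N), decreasing g /\ f = [ffun i => g (s i)].
Proof.
move=> inj; pose le' (a b : 'I_L) := (b <= a)%N.
pose t := [tuple f i | i < N].
have /tuple_permP[s Es] : perm_eq (sort le' t) t by rewrite perm_sort.
pose g := [ffun i => f (s i)]; exists g, (s^-1)%g; split; last first.
  by apply/ffunP => i; rewrite !ffunE permKV.
apply/decreasingP => i j ij; rewrite ltn_neqAle; apply/andP; split.
  rewrite !ffunE; apply/eqP => /val_inj /inj /perm_inj E.
  by move: ij; rewrite E ltnn.
have srt : sorted le' (sort le' t) by apply: sort_sorted => a b; rewrite /le' leq_total.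
have x0 := f i.
have nthE (k : 'I_N) : nth x0 (sort le' t) k = g k.
  rewrite Es (nth_map k) ?size_enum_ord // nth_ord_enum tnth_mktuple ffunE //.
have := sorted_ltn_nth (leT := le') _ x0 srt i j.
rewrite !inE size_sort size_tuple !nthE; apply => //.
by move=> a b c ab bc; apply: leq_trans bc ab.
Qed.

Lemma decreasing_sorted g : decreasing g -> sorted (fun a b : 'I_L => b < a)%N (codom g).
Proof.
move=> dg; case E: (codom g) => [|x0 s0] //; rewrite -E; apply/(sortedP x0) => i.
rewrite size_codom card_ord => iN; pose i0 := Ordinal iN; have iN' := ltnW iN.
rewrite /codom !(nth_map i0) -?enumT ?size_enum_ord //.
by apply: (decreasingP _ dg); rewrite -?enumT !nth_enum_ord.
Qed.

Lemma decreasing_eq g g' : decreasing g -> decreasing g' -> codom g =i codom g' -> g = g'.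
Proof.
move=> /decreasing_sorted sg /decreasing_sorted sg' E.
have H : codom g = codom g'.
  apply: irr_sorted_eq sg sg' E => [a b c /= ab bc|a /=]; [exact: ltn_trans bc ab|exact: ltnn].
by apply/ffunP => i; rewrite -[i in LHS]enum_rankK -[i in RHS]enum_rankK -!(nth_codom (g i)) H.
Qed.

Variable F : comNzRingType.

(** The selected columns are listed decreasingly, since the exponents nu_j + N - 1 - j of a
    partition nu come in this order. *)
Lemma Cauchy_Binet (A : 'M[F]_(N, L)) (B : 'M[F]_(L, N)) :
  \det (A *m B) = \sum_(g : {ffun 'I_N -> 'I_L} | decreasing g)
    \det (\matrix_(i, j) A i (g j)) * \det (\matrix_(j, k) B (g j) k).
Proof.
pose D f := \det (\matrix_(j, k) B (f j) k).
have -> : \det (A *m B) = \sum_(f : {ffun 'I_N -> 'I_L}) (\prod_i A i (f i)) * D f.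
  rewrite /determinant; under eq_bigr => s _.
    rewrite (eq_bigr (fun i => \sum_m A i m * B m (s i))); last by move=> i _; rewrite mxE.
    rewrite bigA_distr_bigA big_distrr /=; over.
  rewrite exchange_big; apply: eq_bigr => f _; rewrite /D /determinant big_distrr /=.
  apply: eq_bigr => s _; rewrite big_split /= mulrCA; congr (_ * (_ * _)).
  by apply: eq_bigr => i _; rewrite mxE.
rewrite (bigID (fun f => injectiveb f)) /= [X in _ + X]big1 ?addr0 => [|f]; last first.
  case/injectivePn => i [j ij fij]; rewrite /D (determinant_alternate ij) ?mulr0 // => k.
  by rewrite !mxE fij.
pose h (p : {ffun 'I_N -> 'I_L} * 'S_N) := [ffun i => p.1 (p.2 i)].
pose X := [set p : {ffun 'I_N -> 'I_L} * 'S_N | decreasing p.1].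
have hinj : {in X &, injective h}.
  move=> [g s] [g' s']; rewrite !inE /= => dg dg' /ffunP E.
  have gg' : g = g'.
    apply: decreasing_eq => // y; apply/codomP/codomP => -[i ->].
      by exists (s' ((s^-1)%g i)); have := E ((s^-1)%g i); rewrite !ffunE /= permKV.
    by exists (s ((s'^-1)%g i)); have := E ((s'^-1)%g i); rewrite !ffunE /= permKV.
  move: E; rewrite -gg' => E; congr pair; apply/permP => i.
  by have := E i; rewrite !ffunE => /(decreasing_inj dg).
rewrite (eq_bigl (mem (h @: X))) => [|f]; last first.
  apply/injectiveP/imsetP => [/sort_factor[g [s [dg ->]]]|[[g s]]].
    by exists (g, s); rewrite ?inE.
  by rewrite inE /= => dg -> i j; rewrite !ffunE => /(decreasing_inj dg) /perm_inj.
rewrite big_imset //= (eq_bigl (fun p => decreasing p.1 && true)); last by move=> p; rewrite inE andbT.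
rewrite -(pair_big_dep (fun g => decreasing g) (fun _ _ => true) (fun g s => (\prod_i A i (h (g, s) i)) * D (h (g, s)))) /=.
apply: eq_bigr => g dg; rewrite -[\det (\matrix_(j, k) B (g j) k)]/(D g).
have Dh s : D (h (g, s)) = (-1) ^+ s * D g.
  have -> : D (h (g, s)) = \det (row_perm s (\matrix_(j, k) B (g j) k)).
    by rewrite /D; congr (\det _); apply/matrixP => j k; rewrite !mxE ffunE.
  by rewrite row_permE det_mulmx det_perm.
rewrite [X in _ = X * _]/determinant mulr_suml; apply: eq_bigr => s _; rewrite Dh mulrCA mulrA; congr (_ * _ * _).
by apply: eq_bigr => i _; rewrite mxE ffunE.
Qed.
End CauchyBinet.

Lemma elsym_scale (F : comNzRingType) (x : nat -> F) (y : F) N k :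
  elsym (fun j => x j * y) N k = y ^+ k * elsym x N k.
Proof.
elim: N k => [|N IH] [|k] /=; rewrite ?expr0 ?mul1r ?mulr0 ?elsym0 //.
by rewrite !IH exprS mulrDr; ring.
Qed.

Lemma eq_elsym (F : comNzRingType) (x y : nat -> F) N k : x =1 y -> elsym x N k = elsym y N k.
Proof. by move=> xy; elim: N k => //= N IH k; rewrite IH; case: k => // k; rewrite IH xy. Qed.

Section DualCauchy.
Variables (F : comNzRingType) (x y : nat -> F) (N : nat).
Local Notation L := (N + N)%N.
Implicit Types g : {ffun 'I_N -> 'I_L}.

(** Parts of the partition whose shifted exponents are the g j; [decreasing_ge] makes the
    subtraction exact. *)
Definition row_len g (j : 'I_N) : nat := (g j - (N - j.+1))%N.

Lemma decreasing_ge g (j : 'I_N) : decreasing g -> (N - j.+1 <= g j)%N.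
Proof.
move=> /decreasingP dg.
have H m : (m < N)%N -> forall k : 'I_N, (k + m.+1 = N)%N -> (m <= g k)%N.
  elim: m => // m IH mN k kN; have k1 : (k.+1 < N)%N by lia.
  have := IH (ltnW mN) (Ordinal k1) _; rewrite /= => /(_ ltac:(lia)) H.
  by apply: leq_ltn_trans H _; apply: dg.
by have jN := ltn_ord j; apply: H; lia.
Qed.

(** Cauchy-Binet for the powers of the y_i times the band matrix of the e_k X^k. Row i of the
    product is the generating function of the e_k at y_i X times powers of y_i, and the minors of
    the band matrix are dual Jacobi-Trudi determinants, with X marking the size. Exponents below 2 N
    suffice because e_k vanishes for k > N. *)
Lemma dual_Cauchy_poly :
  (\det (\matrix_(i < N, j < N) y i ^+ (N - j.+1)))%:P * \prod_(i < N) \prod_(j < N) (1 + (x j * y i)%:P * 'X) =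
  \sum_(g | decreasing g) ((\det (\matrix_(i < N, j < N) y i ^+ g j)) * \det (jt_mx x N (row_len g)))%:P * 'X^(\sum_j row_len g j).
Proof.
pose A : 'M[{poly F}]_(N, L) := \matrix_(i, m) (y i ^+ m)%:P.
pose B : 'M[{poly F}]_(L, N) := \matrix_(m, l)
  (if (N - l.+1 <= m)%N then (elsym x N (m - (N - l.+1)))%:P * 'X^(m - (N - l.+1)) else 0).
have ABE : A *m B = diag_mx (\row_(i < N) \prod_(j < N) (1 + (x j * y i)%:P * 'X)) *m
   map_mx polyC (\matrix_(i < N, j < N) y i ^+ (N - j.+1)).
  apply/matrixP => i l; rewrite mul_diag_mx !mxE mulrC; apply/polyP => d.
  rewrite coefCM (coef_prod_1DX (fun j => x j * y i)) elsym_scale coef_sum.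
  rewrite (eq_bigr (fun m : 'I_L => if (m == d + (N - l.+1) :> nat)%N then y i ^+ m * elsym x N d else 0)); last first.
    move=> m _; rewrite !mxE; case: (leqP (N - l.+1) m) => ml; last first.
      by rewrite mulr0 coef0; case: eqP => // E; lia.
    rewrite coefCM coefCM coefXn; have -> : (d == m - (N - l.+1))%N = (m == d + (N - l.+1) :> nat)%N by lia.
    by case: eqP => [->|_]; rewrite ?mulr0 // addnK mulr1.
  rewrite -big_mkcond; case: (ltnP (d + (N - l.+1)) L) => dl.
    rewrite (big_pred1 (Ordinal dl)) => [|m]; last by rewrite /= -(inj_eq val_inj).
    by rewrite /= exprD; ring.
  rewrite elsym_gt; last by have := ltn_ord l; lia.
  by rewrite big1 ?mulr0 // => m; rewrite mulr0.
have := congr1 (fun M => \det M) ABE; rewrite det_mulmx det_diag det_map_mx => E.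
rewrite mulrC; rewrite (eq_bigr (fun i => (\row_(i < N) \prod_(j < N) (1 + (x j * y i)%:P * 'X)) 0 i)); last by move=> i _; rewrite mxE.
rewrite -E Cauchy_Binet; apply: eq_bigr => g dg.
rewrite polyCM -mulrA; congr (_ * _).
  rewrite -det_map_mx; congr (\det _); apply/matrixP => i j; by rewrite !mxE.
rewrite -det_map_mx /determinant big_distrl /=; apply: eq_bigr => s _.
rewrite -mulrA; congr (_ * _).
(* If some entry falls outside the band, both products vanish; otherwise the powers of X add up to
   the size, whatever s is. *)
case: (boolP [forall k, (N - (s k).+1 <= g k)%N]) => [/forallP H|].
  have -> : (\sum_j row_len g j = \sum_j (g j - (N - (s j).+1)))%N.
    rewrite [LHS]sumnB => [|j _]; last exact: decreasing_ge.
    rewrite [RHS]sumnB => [|j _]; last exact: H.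
    by congr (_ - _)%N; rewrite [LHS](reindex_inj (@perm_inj _ s)).
  rewrite -prodrXr -big_split /=; apply: eq_bigr => k _; rewrite !mxE H.
  have := H k; have := decreasing_ge k dg; have := ltn_ord k; have := ltn_ord (s k); rewrite /row_len => *.
  have -> : (k <= g k - (N - k.+1) + s k)%N by lia.
  by congr (_%:P * _); congr (elsym _ _ _); lia.
rewrite negb_forall => /existsP[k Hk].
have C : (k <= row_len g k + s k)%N = false.
  move: Hk; rewrite -ltnNge; have := decreasing_ge k dg; have := ltn_ord k; have := ltn_ord (s k).
  rewrite /row_len; move: (nat_of_ord (g k)) (nat_of_ord k) (nat_of_ord (s k)) => p q r; lia.
by rewrite [LHS](bigD1 k) //= [in RHS](bigD1 k) //= !mxE (negPf Hk) C !mul0r.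
Qed.
End DualCauchy.

Lemma nth_part_le mu i j : is_part mu -> (i <= j)%N -> (nth 0 mu j <= nth 0 mu i)%N.
Proof.
move=> /andP[srt _] ij; case: (ltnP j (size mu)) => jm; last by rewrite nth_default.
apply: (sorted_leq_nth (rev_trans leq_trans) (fun x => leqnn x) 0%N srt) => //; rewrite inE //.
exact: leq_ltn_trans jm.
Qed.

Lemma nth_conj_part mu j : is_part mu -> nth 0%N (conj_part mu) j = count (fun k => j < k)%N mu.
Proof.
move=> hmu; case: (ltnP j (head 0%N mu)) => jh; first by rewrite nth_mkseq.
rewrite nth_default ?size_mkseq //; apply/esym/eqP; rewrite -leqn0 leqNgt -has_count.
by apply/hasPn => k /(part_le_head hmu) kh; rewrite -leqNgt (leq_trans kh).
Qed.

(** The parts larger than j form an initial segment of mu, since mu is weakly decreasing. *)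
Lemma conj_partP mu j k : is_part mu -> (k < nth 0%N (conj_part mu) j)%N = (j < nth 0%N mu k)%N.
Proof.
move=> hmu; rewrite nth_conj_part //.
have Em : mu = take k mu ++ drop k mu by rewrite cat_take_drop.
apply/idP/idP => [H|H].
  rewrite ltnNge; apply/negP => jk; move: H; rewrite ltnNge Em count_cat => /negP; apply.
  rewrite [X in (_ + X)%N](_ : _ = 0%N) ?addn0.
    by rewrite (leq_trans (count_size _ _)) // size_take_min geq_minl.
  apply/eqP; rewrite -leqn0 leqNgt -has_count; apply/hasPn => m /(nthP 0%N)[i _ <-].
  by rewrite nth_drop -leqNgt (leq_trans _ jk) // nth_part_le // leq_addr.
have km : (k < size mu)%N by rewrite ltnNge; apply/negP => mk; rewrite nth_default in H.
rewrite -[X in (X < _)%N]/(k.+1.-1); have -> : k.+1.-1 = k by [].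
have : (count (fun m => j < m)%N (take k.+1 mu) = k.+1)%N.
  rewrite (_ : k.+1 = size (take k.+1 mu)) 1?{1}size_takel //.
  apply/eqP; rewrite -all_count; apply/allP => m /(nthP 0%N)[i].
  rewrite size_takel // => ik <-; rewrite nth_take //; apply: leq_trans H _.
  exact: nth_part_le.
by move=> E; rewrite -[X in count _ X](cat_take_drop k.+1) count_cat E leq_addr.
Qed.

Lemma is_part_conj mu : is_part mu -> is_part (conj_part mu).
Proof.
move=> hmu; rewrite /is_part conj_part_pos andbT.
apply/(sortedP 0%N) => i; rewrite size_mkseq => ih; rewrite !nth_conj_part //.
by apply: sub_count => k /=; apply: ltn_trans.
Qed.

Lemma conj_jt (F : comNzRingType) (x : nat -> F) (N M : nat) mu : is_part mu -> (size mu <= N)%N -> (head 0 mu <= M)%N ->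
  \det (\matrix_(i < N, j < N) x i ^+ (nth 0%N mu j + (N - j.+1))) =
  \det (\matrix_(i < N, j < N) x i ^+ (N - j.+1)) * \det (jt_mx x N (fun k : 'I_M => nth 0%N (conj_part mu) k)).
Proof.
move=> hmu sN hM; have hmu' := is_part_conj hmu.
apply: (@dual_jacobi_trudi F x N M (fun j : 'I_N => nth 0%N mu j)) => [j|k|i j|i j|j k].
- case: (ltnP j (size mu)) => jm; last by rewrite nth_default.
  by rewrite (leq_trans (part_le_head hmu _) hM) // mem_nth.
- by rewrite nth_conj_part // (leq_trans (count_size _ _)).
- exact: nth_part_le.
- exact: nth_part_le.
by rewrite -conj_partP.
Qed.

Lemma part_eqP mu nu : is_part mu -> is_part nu -> (forall j, nth 0%N mu j = nth 0%N nu j) -> mu = nu.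
Proof.
have sz a b : is_part a -> is_part b -> (forall j, nth 0%N a j = nth 0%N b j) -> (size a <= size b)%N.
  move=> /andP[_ a0] hb E; rewrite leqNgt; apply/negP => ba.
  by move: a0; rewrite -(nth_default 0%N (leqnn (size b))) -E mem_nth.
move=> hm hn E; apply: (@eq_from_nth _ 0%N) => // ; apply/eqP; rewrite eqn_leq !sz //.
Qed.

Lemma conj_partK mu : is_part mu -> conj_part (conj_part mu) = mu.
Proof.
move=> hmu; apply: part_eqP => // [|j]; first by do 2!apply: is_part_conj.
apply/eqP; rewrite eqn_leq; apply/andP; split.
  by rewrite leqNgt conj_partP ?is_part_conj // conj_partP // ltnn.
by rewrite leqNgt -conj_partP // -conj_partP ?is_part_conj // ltnn.
Qed.

Lemma alternant_neq0 (F : idomainType) N (x : nat -> F) : injective x ->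
  \det (\matrix_(i < N, j < N) x i ^+ (N - j.+1)) != 0.
Proof.
move=> inj.
have -> : \matrix_(i < N, j < N) x i ^+ (N - j.+1) = col_perm (perm (@rev_ord_inj N)) (Vandermonde N (\row_i x i))^T.
  by apply/matrixP => i j; rewrite !mxE permE.
rewrite col_permE det_mulmx det_perm det_tr det_Vandermonde mulf_neq0 ?signr_eq0 //.
apply/prodf_neq0 => i _; apply/prodf_neq0 => j ij; rewrite !mxE subr_eq0.
by apply/eqP => /inj E; rewrite E ltnn in ij.
Qed.

Lemma prod_skip (F : comNzRingType) (f : nat -> F) b m :
  \prod_(j < b + m.+1 | j != b :> nat) f j = \prod_(k < b) f (b - k.+1)%N * \prod_(k < m) f (b + k.+1)%N.
Proof.
rewrite big_mkcond big_split_ord big_ord_recl /= addn0 eqxx mul1r; congr (_ * _).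
  rewrite (reindex_inj rev_ord_inj) /=; apply: eq_bigr => k _.
  by case: eqP => // E; have := ltn_ord k; lia.
by apply: eq_bigr => k _; rewrite /bump leq0n add1n; case: eqP => [E|_] //; lia.
Qed.

(** Pairs without b are unchanged, and the signs of the pairs with b depend only on the order of the
    indices. The application is to hooks, whose alternant differs from the standard one in a single
    exponent. *)
Lemma vandermonde_change (F : fieldType) N (z z' : 'I_N -> F) (b : 'I_N) :
    injective z -> (forall j, j != b -> z' j = z j) ->
  \prod_(i < N) \prod_(j < N | (i < j)%N) (z' j - z' i) =
  \prod_(i < N) \prod_(j < N | (i < j)%N) (z j - z i) * \prod_(j < N | j != b) ((z' b - z j) / (z b - z j)).
Proof.
move=> zi zz'.
have split (w : 'I_N -> F) : (forall j, j != b -> w j = z j) ->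
  \prod_(i < N) \prod_(j < N | (i < j)%N) (w j - w i) =
  (\prod_(i < N | i != b) \prod_(j < N | (i < j)%N && (j != b)) (z j - z i)) *
  ((-1) ^+ (\sum_(j < N | j != b) (b < j)) * \prod_(j < N | j != b) (w b - z j)).
  move=> wz; rewrite (bigD1 b) //= mulrC.
  rewrite (eq_bigr (fun i : 'I_N => (\prod_(j < N | (i < j)%N && (j != b)) (z j - z i)) * (if (i < b)%N then w b - z i else 1))); last first.
    move=> i ib; rewrite (bigID (fun j => j != b)) /=; congr (_ * _).
      by apply: eq_bigr => j /andP[_ jb]; rewrite !wz.
    rewrite (eq_bigl (fun j => (i < b)%N && (j == b))); last first.
      by move=> j; rewrite negbK andbC [RHS]andbC; case: eqP => // ->.
    by case: (i < b)%N; [rewrite (big_pred1 b) // (wz i)|rewrite big_pred0].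
  rewrite big_split /= -mulrA; congr (_ * _).
  rewrite -prodrXr [X in _ * X](_ : _ = \prod_(j < N | j != b) (if (b < j)%N then z j - w b else 1)); last first.
    rewrite big_mkcond [RHS]big_mkcond; apply: eq_bigr => j _.
    case: eqP => [->|/eqP jb] /=; first by rewrite ltnn.
    by rewrite wz.
  rewrite -!big_split /=; apply: eq_bigr => j jb.
  case: (ltngtP b j) => bj; rewrite ?expr0 ?expr1 ?mul1r ?mulr1 ?mulN1r ?opprB //.
  by rewrite (val_inj bj) eqxx in jb.
rewrite (split z') // (split z) // -!mulrA; congr (_ * (_ * _)).
rewrite -big_split /=; apply: eq_bigr => j jb; rewrite mulrC divfK //.
by rewrite subr_eq0; apply: contra_neq jb => /zi.
Qed.

(** At geometric variables rows and exponents exchange roles: (t^i)^(e_j) = (t^(e_j))^i, a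
    Vandermonde matrix with nodes t^(e_j). *)
Lemma det_geometric (F : comNzRingType) N (x0 t : F) (e : 'I_N -> nat) :
  \det (\matrix_(i < N, j < N) (x0 * t ^+ i) ^+ e j) =
  \prod_j x0 ^+ e j * \prod_(i < N) \prod_(j < N | (i < j)%N) (t ^+ e j - t ^+ e i).
Proof.
have -> : \matrix_(i < N, j < N) (x0 * t ^+ i) ^+ e j =
   Vandermonde N (\row_j t ^+ e j) *m diag_mx (\row_j x0 ^+ e j).
  apply/matrixP => i j; rewrite mul_mx_diag !mxE exprMn mulrC; congr (_ * _).
  by rewrite -!exprM mulnC.
rewrite det_mulmx det_Vandermonde det_diag mulrC; congr (_ * _).
  by apply: eq_bigr => j _; rewrite mxE.
by apply: eq_bigr => i _; apply: eq_bigr => j _; rewrite !mxE.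
Qed.

(** With N = b + m + 1, the hook exponents are N - 1, ..., 0 with N - 1 - b raised by n. The raised
    one stands first; bringing it to place b is a cycle of length b + 1, of sign (-1)^b. *)
Lemma hook_alternant (F : comNzRingType) (x : nat -> F) n b m : (b < n)%N ->
  \det (\matrix_(i < b + m.+1, j < b + m.+1) x i ^+ (nth 0%N ((n - b)%N :: nseq b 1%N) j + (b + m.+1 - j.+1))) =
  (-1) ^+ b * \det (\matrix_(i < b + m.+1, j < b + m.+1) x i ^+ (b + m.+1 - j.+1 + (j == b :> nat) * n)).
Proof.
move=> bn; rewrite addnS.
have bm : (b < (b + m).+1)%N by rewrite ltnS leq_addr.
pose s := lift_perm ord0 (Ordinal bm) 1%g.
have sE : (-1) ^+ s = (-1) ^+ b :> F by rewrite odd_lift_perm odd_perm1 addbF /= signr_odd.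
rewrite -sE; set A := \matrix_(i, j) x i ^+ (_ + _ * _).
have -> : (-1) ^+ s * \det A = \det (col_perm s A).
  by rewrite col_permE det_mulmx det_perm odd_permV mulrC.
congr (\det _); apply/matrixP => i j; rewrite !mxE; congr (_ ^+ _).
case: (unliftP ord0 j) => [k ->|->].
  rewrite lift_perm_lift perm1 /= /bump leq0n add1n /= nth_nseq.
  by have := ltn_ord k; case: (leqP b k) => bk /= kl; case: eqP; rewrite ?add1n ?add0n ?mul1n ?mul0n => E; move: (nat_of_ord k) bk kl E => p bk kl E; clear s sE A; lia.
by rewrite lift_perm_id /= eqxx; lia.
Qed.

From mathcomp Require Import complex.
From mathcomp Require Import all_classical all_reals all_analysis.
Import Order.TTheory GRing.Theory Num.Theory.
Import numFieldNormedType.Exports.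
Import ComplexField.Normc.
Local Open Scope classical_set_scope.
Local Open Scope ring_scope.

(** * Schur functions in infinitely many variables *)

(** Device for deducing a = b from a known c = d: the remaining goal a - b = c - d is left to
    [ring]. *)
Lemma eq_by (V : zmodType) (a b c d : V) : c = d -> a - b = c - d -> a = b.
Proof. by move=> -> /eqP; rewrite subrr subr_eq0 => /eqP. Qed.

(** * Limits of complex sequences *)

Section ComplexLimits.
Variable R : realType.
Local Notation C := R[i].
Implicit Types (f g : nat -> C) (a b z : C).

Lemma normcE' z : `|z| = (normc z)%:C%C. Proof. by []. Qed.

Lemma normc_ge0 z : 0 <= normc z.
Proof. by rewrite -lecR; apply: (normr_ge0 z). Qed.

Lemma normcN' z : normc (- z) = normc z.
Proof. by apply: complexI; rewrite -!normcE' normrN. Qed.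

Lemma le_normcD' z z' : normc (z + z') <= normc z + normc z'.
Proof. by rewrite -lecR rmorphD /=; exact: (@ler_normD _ C). Qed.

(** Passes to real bounds on the real-valued modulus [normc], since the order of [R[i]] is only
    partial. *)
Lemma cvgCP f a : f @ \oo --> a <->
  forall e : R, 0 < e -> exists N, forall n, (N <= n)%N -> normc (a - f n) < e.
Proof.
split=> [/(@cvgrPdist_lt C C nat \oo _ f a).1 H e e0|H].
  have /H[N _ HN] : (0 : C) < e%:C%C by rewrite ltcR.
  by exists N => n Nn; rewrite -ltcR; apply: HN.
apply: (@cvgrPdist_lt C C nat \oo _ f a).2 => e e0.
have eR : e = (complex.Re e)%:C%C by rewrite RRe_real // gtr0_real.
have /H[N HN] : 0 < complex.Re e by rewrite -ltcR -eR.
by exists N => // n Nn; rewrite eR /= ltcR; apply: HN.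
Qed.

Lemma cvgC_cst a : (fun _ : nat => a) @ \oo --> a.
Proof. exact: (@cvg_cst C a nat \oo _). Qed.
Arguments cvgC_cst : clear implicits.

Lemma cvgCD f g a b : f @ \oo --> a -> g @ \oo --> b -> (fun n => f n + g n) @ \oo --> a + b.
Proof. by move=> fa gb; exact: (@cvgD C C nat \oo _ f g a b fa gb). Qed.

Lemma cvgCM f g a b : f @ \oo --> a -> g @ \oo --> b -> (fun n => f n * g n) @ \oo --> a * b.
Proof. by move=> fa gb; exact: (@cvgM C nat \oo _ f g a b fa gb). Qed.

Lemma cvgC_lim f a : f @ \oo --> a -> limn f = a.
Proof. by move=> fa; exact: (@cvg_lim C (@norm_hausdorff C C) _ _ _ f a fa). Qed.

Lemma cvgC_unique f a b : f @ \oo --> a -> f @ \oo --> b -> a = b.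
Proof. by move=> /cvgC_lim <- /cvgC_lim. Qed.

Lemma cvgC_near f g a N : (forall n, (N <= n)%N -> f n = g n) -> f @ \oo --> a -> g @ \oo --> a.
Proof.
move=> fg /cvgCP H; apply/cvgCP => e /H[M HM]; exists (maxn M N) => n.
by rewrite geq_max => /andP[Mn Nn]; rewrite -fg // HM.
Qed.

Lemma cvgC_eq f g a : f @ \oo --> a -> (forall n, f n = g n) -> g @ \oo --> a.
Proof. by move=> fa fg; apply: (@cvgC_near f g a 0%N) => // n _. Qed.

Lemma cvgCN f a : f @ \oo --> a -> (fun n => - f n) @ \oo --> - a.
Proof.
move=> fa; have := cvgCM (cvgC_cst (-1)) fa; rewrite mulN1r => /cvgC_eq; apply=> n.
exact: mulN1r.
Qed.

Lemma cvgCB f g a b : f @ \oo --> a -> g @ \oo --> b -> (fun n => f n - g n) @ \oo --> a - b.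
Proof. by move=> fa gb; apply: cvgCD fa (cvgCN gb). Qed.

Lemma cvgC_sum (I : Type) (r : seq I) (P : pred I) (F : I -> nat -> C) (L : I -> C) :
  (forall i, P i -> F i @ \oo --> L i) ->
  (fun n => \sum_(i <- r | P i) F i n) @ \oo --> \sum_(i <- r | P i) L i.
Proof.
move=> H; elim: r => [|i r IH].
  by rewrite big_nil; apply/(cvgC_eq (cvgC_cst 0)) => n; rewrite big_nil.
rewrite big_cons; case: ifP => Pi.
  by apply/(cvgC_eq (cvgCD (H i Pi) IH)) => n; rewrite big_cons Pi.
by apply/(cvgC_eq IH) => n; rewrite big_cons Pi.
Qed.

Lemma cvgC_prod (I : Type) (r : seq I) (P : pred I) (F : I -> nat -> C) (L : I -> C) :
  (forall i, P i -> F i @ \oo --> L i) ->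
  (fun n => \prod_(i <- r | P i) F i n) @ \oo --> \prod_(i <- r | P i) L i.
Proof.
move=> H; elim: r => [|i r IH].
  by rewrite big_nil; apply/(cvgC_eq (cvgC_cst 1)) => n; rewrite big_nil.
rewrite big_cons; case: ifP => Pi.
  by apply/(cvgC_eq (cvgCM (H i Pi) IH)) => n; rewrite big_cons Pi.
by apply/(cvgC_eq IH) => n; rewrite big_cons Pi.
Qed.

Lemma cvgC_det m (A : nat -> 'M[C]_m) (B : 'M[C]_m) :
  (forall i j, (fun n => A n i j) @ \oo --> B i j) ->
  (fun n => \det (A n)) @ \oo --> \det B.
Proof.
move=> H; rewrite /determinant; apply: cvgC_sum => s _; apply: cvgCM; first exact: cvgC_cst.
by apply: cvgC_prod => i _; apply: H.
Qed.

Lemma normcX z n : normc (z ^+ n) = normc z ^+ n.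
Proof. by elim: n => [|n IH]; [rewrite normc1|rewrite !exprS normcM IH]. Qed.

Lemma cvgC_expr z : normc z < 1 -> (fun n => z ^+ n) @ \oo --> (0 : C).
Proof.
move=> z1; apply/cvgCP => e e0.
have /cvgrPdist_lt/(_ e e0)[N _ HN] : (fun n => normc z ^+ n) @ \oo --> (0 : R).
  by apply: cvg_expr; rewrite ger0_norm ?normc_ge0.
exists N => n /HN /=; rewrite !sub0r normcN' normcX normrN ger0_norm ?exprn_ge0 //.
exact: normc_ge0.
Qed.
End ComplexLimits.
Arguments cvgC_cst : clear implicits.

(** * Rational functions determined by their values at |u| > 1 *)

Section Rational.
Variable R : realType.
Local Notation C := R[i].
Local Notation ratfun := {fraction {poly R[i]}}.
Implicit Types (w : ratfun) (f g : C -> C).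

(** The property by which [ratfun_of] chooses. It is stable under the field operations, and
    [rep_unique] turns equal values into equality in the fraction field. *)
Definition rep w f := exists P D, is_frac w P D /\
  forall u : C, 1 < `|u| -> D.[u] != 0 /\ f u = P.[u] / D.[u].

Definition rational f := exists w, rep w f.

Lemma poly_eq0_outside (P : {poly C}) : (forall u : C, 1 < `|u| -> P.[u] = 0) -> P = 0.
Proof.
move=> H; apply/eqP/negPn/negP => P0.
(* The integers from 2 on have modulus larger than 1 and supply more roots than the degree
   allows. *)
pose s := [seq (k.+2)%:R : C | k <- iota 0 (size P)].
have : (size s < size P)%N.
  apply: (max_poly_roots P0); last by rewrite map_inj_uniq ?iota_uniq // => i j /eqP; rewrite eqr_nat => /eqP[].
  apply/allP => _ /mapP[k _ ->]; apply/eqP/H.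
  by rewrite normr_nat ltr1n.
by rewrite size_map size_iota ltnn.
Qed.

Lemma rep_unique w w' f g : rep w f -> rep w' g -> (forall u : C, 1 < `|u| -> f u = g u) -> w = w'.
Proof.
move=> [P [D [[D0 ->] H]]] [P' [D' [[D'0 ->] H']]] fg.
have tD : tofrac D != 0 by rewrite tofrac_eq0.
have tD' : tofrac D' != 0 by rewrite tofrac_eq0.
have E : P * D' = P' * D.
  apply/eqP; rewrite -subr_eq0; apply/eqP.
  apply: poly_eq0_outside => u u1; have [d0 E] := H u u1; have [d'0 E'] := H' u u1.
  apply/eqP; rewrite hornerD hornerN !hornerM subr_eq0 -eqr_div //.
  by rewrite -E -E' fg.
apply/eqP. rewrite (eqr_div _ _ tD tD'). rewrite -(tofracM P D') -(tofracM P' D). by rewrite E.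
Qed.

Lemma rep_eq w f g : (forall u : C, 1 < `|u| -> f u = g u) -> rep w f -> rep w g.
Proof.
by move=> fg [P [D [wPD H]]]; exists P, D; split=> // u u1; have [? <-] := H u u1; rewrite fg.
Qed.

Lemma rep_poly P : rep (tofrac P) (fun u => P.[u]).
Proof.
exists P, 1; split; first by split; rewrite ?oner_eq0 // tofrac1 divr1.
by move=> u _; rewrite hornerC oner_eq0 divr1.
Qed.

Lemma rep_cst (c : C) : rep (tofrac c%:P) (fun=> c).
Proof. by apply: rep_eq (rep_poly _) => u _; rewrite hornerC. Qed.

Lemma repD w w' f g : rep w f -> rep w' g -> rep (w + w') (fun u => f u + g u).
Proof.
move=> [P [D [[D0 ->] H]]] [P' [D' [[D'0 ->] H']]].
exists (P * D' + P' * D), (D * D'); split.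
  by split; rewrite ?mulf_neq0 // addf_div ?tofrac_eq0 // !tofracM tofracD !tofracM.
move=> u u1; have [d0 ->] := H u u1; have [d'0 ->] := H' u u1.
by rewrite hornerM mulf_neq0 // hornerD !hornerM addf_div.
Qed.

Lemma repM w w' f g : rep w f -> rep w' g -> rep (w * w') (fun u => f u * g u).
Proof.
move=> [P [D [[D0 ->] H]]] [P' [D' [[D'0 ->] H']]].
exists (P * P'), (D * D'); split.
  by split; rewrite ?mulf_neq0 // mulf_div !tofracM.
move=> u u1; have [d0 ->] := H u u1; have [d'0 ->] := H' u u1.
by rewrite !hornerM mulf_neq0 // mulf_div.
Qed.

Lemma repV w f : (forall u : C, 1 < `|u| -> f u != 0) -> rep w f -> rep w^-1 (fun u => (f u)^-1).
Proof.
move=> f0 [P [D [[D0 ->] H]]].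
have PH u : 1 < `|u| -> P.[u] != 0.
  move=> u1; have [d0 E] := H u u1; have := f0 u u1.
  by rewrite E mulf_eq0 negb_or => /andP[].
exists D, P; split; first split; rewrite ?invf_div //.
  have := PH 2 _; rewrite normr_nat ltr1n => /(_ isT).
  by apply: contraNneq => ->; rewrite horner0.
by move=> u u1; have [d0 ->] := H u u1; rewrite PH // invf_div.
Qed.

Lemma rep_sum (I : Type) (r : seq I) (P : pred I) (w : I -> ratfun) (f : I -> C -> C) :
  (forall i, P i -> rep (w i) (f i)) ->
  rep (\sum_(i <- r | P i) w i) (fun u => \sum_(i <- r | P i) f i u).
Proof.
move=> H; elim: r => [|i r IH].
  rewrite big_nil; apply: rep_eq (_ : rep 0 (fun=> 0)) => [u _|]; first by rewrite big_nil.
  by have := rep_cst 0; rewrite tofrac0.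
rewrite big_cons; case: ifP => Pi.
  by apply: rep_eq (repD (H i Pi) IH) => u _; rewrite big_cons Pi.
by apply: rep_eq IH => u _; rewrite big_cons Pi.
Qed.

Lemma rep_prod (I : Type) (r : seq I) (P : pred I) (w : I -> ratfun) (f : I -> C -> C) :
  (forall i, P i -> rep (w i) (f i)) ->
  rep (\prod_(i <- r | P i) w i) (fun u => \prod_(i <- r | P i) f i u).
Proof.
move=> H; elim: r => [|i r IH].
  rewrite big_nil; apply: rep_eq (_ : rep 1 (fun=> 1)) => [u _|]; first by rewrite big_nil.
  by have := rep_cst 1; rewrite tofrac1.
rewrite big_cons; case: ifP => Pi.
  by apply: rep_eq (repM (H i Pi) IH) => u _; rewrite big_cons Pi.
by apply: rep_eq IH => u _; rewrite big_cons Pi.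
Qed.

Lemma norm1_neq0 (u : C) : 1 < `|u| -> u != 0.
Proof. by move=> u1; rewrite -normr_gt0; apply: lt_trans u1; apply: ltr01. Qed.

Lemma rep_qhalf (k : int) : rep (qhalf R ^ k) (fun u => u ^ k).
Proof.
have H n : rep (qhalf R ^+ n) (fun u => u ^+ n).
  by rewrite /qhalf -tofracXn; apply: rep_eq (rep_poly _) => u _; rewrite hornerXn.
case: k => n; first exact: H.
apply: (repV (f := fun u => u ^+ n.+1)) (H n.+1) => u u1.
by rewrite expf_neq0 // norm1_neq0.
Qed.

Lemma ratfun_ofP f : rational f -> rep (ratfun_of f) f.
Proof. by move=> [w wf]; rewrite /ratfun_of; case: xgetP => [w' _ //|/(_ w)]. Qed.

Lemma rat_eq f g : (forall u : C, 1 < `|u| -> f u = g u) -> rational f -> rational g.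
Proof. by move=> fg [w wf]; exists w; apply: rep_eq wf. Qed.

Lemma rat_cst (c : C) : rational (fun=> c). Proof. by eexists; apply: rep_cst. Qed.

Lemma ratD f g : rational f -> rational g -> rational (fun u => f u + g u).
Proof. by move=> [w wf] [w' wg]; eexists; apply: repD wf wg. Qed.

Lemma ratM f g : rational f -> rational g -> rational (fun u => f u * g u).
Proof. by move=> [w wf] [w' wg]; eexists; apply: repM wf wg. Qed.

Lemma ratN f : rational f -> rational (fun u => - f u).
Proof. by move=> /(ratM (rat_cst (-1))); apply: rat_eq => u _; rewrite mulN1r. Qed.

Lemma ratV f : (forall u : C, 1 < `|u| -> f u != 0) -> rational f -> rational (fun u => (f u)^-1).
Proof. by move=> f0 [w wf]; eexists; apply: repV wf. Qed.

Lemma rat_exprz (k : int) : rational (fun u => u ^ k).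
Proof. by eexists; apply: rep_qhalf. Qed.

Lemma rat_sum (I : Type) (r : seq I) (P : pred I) (f : I -> C -> C) :
  (forall i, P i -> rational (f i)) -> rational (fun u => \sum_(i <- r | P i) f i u).
Proof.
move=> H; elim: r => [|i r IH].
  by apply: rat_eq (rat_cst 0) => u _; rewrite big_nil.
case: (boolP (P i)) => Pi; last by apply: rat_eq IH => u _; rewrite big_cons (negPf Pi).
by apply: rat_eq (ratD (H i Pi) IH) => u _; rewrite big_cons Pi.
Qed.

Lemma rat_prod (I : Type) (r : seq I) (P : pred I) (f : I -> C -> C) :
  (forall i, P i -> rational (f i)) -> rational (fun u => \prod_(i <- r | P i) f i u).
Proof.
move=> H; elim: r => [|i r IH].
  by apply: rat_eq (rat_cst 1) => u _; rewrite big_nil.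
case: (boolP (P i)) => Pi; last by apply: rat_eq IH => u _; rewrite big_cons (negPf Pi).
by apply: rat_eq (ratM (H i Pi) IH) => u _; rewrite big_cons Pi.
Qed.

Lemma rat_det m (A : C -> 'M[C]_m) :
  (forall i j, rational (fun u => A u i j)) -> rational (fun u => \det (A u)).
Proof.
move=> H; apply: rat_sum => s _; apply: ratM; first exact: rat_cst.
by apply: rat_prod => i _; apply: H.
Qed.
End Rational.

(** * Elementary symmetric and Schur functions at q^(mu + rho) *)

Section Schur.
Variable R : realType.
Local Notation C := R[i].
Implicit Types (u : C) (mu nu : seq nat).

Definition cvg_coef (f : nat -> {poly C}) (c : nat -> C) := forall k, (fun N => (f N)`_k) @ \oo --> c k.

(** The recurrence of c' is the coefficient form of c'(X) (1 + a0 X) = c(X) (1 + b X); solving it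
    for one coefficient at a time replaces the division of series. *)
Lemma cvg_coef_ratio (f g : nat -> {poly C}) (a : nat -> C) (b : C) (a0 : C) (c c' : nat -> C) N0 :
    (forall N, (N0 <= N)%N -> f N * (1 + (a N)%:P * 'X) = g N * (1 + b%:P * 'X)) ->
    a @ \oo --> a0 -> cvg_coef g c -> c' 0%N = c 0%N ->
    (forall k, c' k.+1 = c k.+1 + b * c k - a0 * c' k) ->
  cvg_coef f c'.
Proof.
move=> E aa gc c'0 c'S.
have co (p : {poly C}) (e : C) k : (p * (1 + e%:P * 'X))`_k = p`_k + e * (if k is k'.+1 then p`_k' else 0).
  rewrite mulrDr mulr1 coefD mulrCA coefCM; congr (_ + _ * _); case: k => [|k]; by rewrite coefMX.
elim=> [|k IH].
  rewrite c'0; apply: (@cvgC_near _ _ _ _ N0 _ (gc 0%N)) => N NN.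
  by have := congr1 (fun p : {poly C} => p`_0) (E N NN); rewrite !co !mulr0 !addr0.
rewrite c'S; apply: (@cvgC_near _ (fun N => (g N)`_k.+1 + b * (g N)`_k - a N * (f N)`_k) _ _ N0 _).
  move=> N NN; have := congr1 (fun p : {poly C} => p`_k.+1) (E N NN); rewrite !co => <-.
  by rewrite addrK.
exact (cvgCB (cvgCD (gc k.+1) (cvgCM (cvgC_cst _ b) (gc k))) (cvgCM aa IH)).
Qed.

Definition gf (x : nat -> C) N : {poly C} := \prod_(i < N) (1 + (x i)%:P * 'X).

Lemma gf_coef x N k : (gf x N)`_k = elsym x N k.
Proof. exact: coef_prod_1DX. Qed.

(** The product E(X) of the 1 + x0 t^j X satisfies E(tX) (1 + x0 X) = E(X) (1 + x0 t^N X); this is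
    the coefficient of X^(k+1). *)
Lemma elsym_geometric (x0 t : C) N k :
  t ^+ k.+1 * elsym (fun j => x0 * t ^+ j) N k.+1 + x0 * t ^+ k * elsym (fun j => x0 * t ^+ j) N k =
  elsym (fun j => x0 * t ^+ j) N k.+1 + x0 * t ^+ N * elsym (fun j => x0 * t ^+ j) N k.
Proof.
elim: N k => [|N IH] k.
  by case: k => [|k] /=; rewrite ?expr0 ?mulr0 ?mul0r ?addr0 ?add0r ?mulr1.
case: k => [|k].
  rewrite /= !elsym0; apply: (eq_by (IH 0%N)); rewrite !elsym0 !exprS !expr0; ring.
have E1 := congr1 (fun z => x0 * t ^+ N * t * z) (IH k).
rewrite /=; apply: (eq_by (f_equal2 +%R (IH k.+1) E1)).
rewrite !exprS; ring.
Qed.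

Lemma normcV' (z : C) : normc z^-1 = (normc z)^-1. Proof. exact: normcV. Qed.

Lemma inv_lt1 u : 1 < `|u| -> normc (u ^- 2) < 1.
Proof.
move=> u1; have n1 : 1 < normc u by rewrite -ltcR.
rewrite normcV' normcX invf_lt1 ?exprn_egt1 // exprn_gt0 //.
by apply: lt_trans n1; apply: ltr01.
Qed.

Lemma expn_neq1 u k : 1 < `|u| -> u ^- 2 ^+ k.+1 != 1.
Proof.
move=> u1; apply/eqP => /(congr1 (@normc R)); rewrite normcX normc1 => E.
have := inv_lt1 u1 => lt1; have : normc (u ^- 2) ^+ k.+1 < 1 by rewrite exprn_ilt1 // normc_ge0.
by rewrite E ltxx.
Qed.

(* Limit of the elementary symmetric functions of q^rho, u = q^(1/2) *)
Fixpoint elim0 u k : C :=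
  if k is k'.+1 then u^-1 * (u ^- 2) ^+ k' / (1 - (u ^- 2) ^+ k) * elim0 u k' else 1.

Lemma qpow_nil u j : u != 0 -> qpow [::] u j = u^-1 * (u ^- 2) ^+ j.
Proof.
move=> u0; rewrite /qpow nth_nil exprnN -[(u ^ _) ^+ j]/((u ^ (- 2%:Z)) ^ j%:Z) exprz_exp.
rewrite -[u^-1]/(u ^ (-1)) -expfzDr //; congr (u ^ _); lia.
Qed.

(** As N grows, t^N tends to 0 and [elsym_geometric] becomes (1 - t^(k+1)) e_(k+1) = u^-1 t^k
    e_k. *)
Lemma elim0_cvg u : 1 < `|u| -> cvg_coef (gf (qpow [::] u)) (elim0 u).
Proof.
move=> u1; have u0 := norm1_neq0 u1; pose t := u ^- 2.
have E N k : elsym (qpow [::] u) N k = elsym (fun j => u^-1 * t ^+ j) N k.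
  by apply: eq_elsym => j; apply: qpow_nil.
move=> k; apply: (@cvgC_eq _ (fun N => elsym (qpow [::] u) N k)); last by move=> N; rewrite gf_coef.
elim: k => [|k IH].
  by apply: (cvgC_eq (cvgC_cst _ 1)) => N; rewrite elsym0.
have tk : 1 - t ^+ k.+1 != 0 by rewrite subr_eq0 eq_sym expn_neq1.
have L1 : (fun N => t ^+ N) @ \oo --> (0 : C) by apply: cvgC_expr; exact: inv_lt1.
have L2 := cvgCB (cvgC_cst _ (u^-1 * t ^+ k)) (cvgCM (cvgC_cst _ u^-1) L1).
rewrite mulr0 subr0 in L2.
have L3 := cvgCM (cvgCM L2 (cvgC_cst _ (1 - t ^+ k.+1)^-1)) IH.
apply: (cvgC_eq L3) => N /=; have := elsym_geometric u^-1 t N k; rewrite -!E => H.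
apply: (mulfI tk); rewrite mulrA mulrCA divff // mulr1; apply: (eq_by H); ring.
Qed.
Lemma rat_elim0 k : rational (fun u => elim0 u k).
Proof.
elim: k => [|k IH] /=; first exact: rat_cst.
have rt j : rational (fun u : C => u ^- 2 ^+ j).
  apply: rat_eq (rat_exprz R (- (2 * j)%N%:Z)) => u u1.
  by rewrite -exprVn -!exprM exprVn exprnN.
apply: ratM => //; apply: ratM; first by apply: ratM => //; exact: rat_exprz R (-1).
apply: ratV => [u u1|]; first by rewrite subr_eq0 eq_sym expn_neq1.
by apply: ratD; [exact: rat_cst|apply: ratN].
Qed.

Fixpoint ratio_seq (c : nat -> C) (b a0 : C) k : C :=
  if k is k'.+1 then c k + b * c k' - a0 * ratio_seq c b a0 k' else c 0%N.

(** q^(mu+rho) and q^rho differ only in the first [size mu] variables. These are changed one at a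
    time: a factor 1 + a X becomes 1 + b X, [cvg_coef_ratio] gives the limit, and its recurrence
    keeps the coefficients rational in u. *)
Lemma elim_ex mu : exists c : C -> nat -> C,
  (forall k, rational (fun u => c u k)) /\
  forall u, 1 < `|u| -> cvg_coef (gf (qpow mu u)) (c u).
Proof.
suff H l : exists c : C -> nat -> C, (forall k, rational (fun u => c u k)) /\
    forall u, 1 < `|u| -> cvg_coef (gf (qpow (take l mu) u)) (c u).
  by have := H (size mu); rewrite take_size.
elim: l => [|l [c [rc cc]]].
  exists elim0; split; first exact: rat_elim0.
  by rewrite take0; apply: elim0_cvg.
case: (ltnP l (size mu)) => lm; last first.
  by exists c; split=> // u u1; rewrite take_oversize ?(leqW lm) // -(take_oversize lm); apply: cc.
pose b u := u ^ (((nth 0%N mu l).*2)%:Z - (l.*2)%:Z - 1) : C.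
pose a u := u ^ (- (l.*2)%:Z - 1) : C.
exists (fun u => ratio_seq (c u) (b u) (a u)); split.
  elim=> [|k IH] /=; first exact: rc.
  by apply: ratD; [apply: ratD; [exact: rc|apply: ratM; [exact: rat_exprz|exact: rc]]|apply: ratN; apply: ratM => //; exact: rat_exprz].
move=> u u1; apply: (@cvg_coef_ratio _ _ (fun=> a u) (b u) (a u) (c u) _ l.+1 _ (cvgC_cst _ (a u)) (cc u u1)) => // N lN.
have ql j : qpow (take l.+1 mu) u j = if j == l then b u else qpow (take l mu) u j.
  rewrite /qpow; case: eqP => [->|/eqP jl]; first by rewrite nth_take.
  congr (_ ^ (_.*2%:Z - _ - _)); case: (ltnP j l) => jl'; first by rewrite !nth_take // ltnW.
  by rewrite !nth_default // size_take_min; lia.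
have ql' : qpow (take l mu) u l = a u.
  by rewrite /qpow nth_default ?size_take_min ?geq_minl // sub0r.
rewrite /gf (bigD1 (Ordinal lN)) //= [in RHS](bigD1 (Ordinal lN)) //= ql eqxx ql'.
rewrite (eq_bigr (fun i : 'I_N => 1 + (qpow (take l mu) u i)%:P * 'X)); last first.
  by move=> i il; rewrite ql ifN //; apply: contra_neq il => E; apply: val_inj.
by rewrite mulrC [X in _ * X]mulrC mulrA.
Qed.

Lemma qpow_inj mu u : is_part mu -> 1 < `|u| -> injective (qpow mu u).
Proof.
move=> hmu u1; have u0 := norm1_neq0 u1.
have n1 : 1 < normc u by rewrite -ltcR.
have nz k : normc (u ^ k) = normc u ^ k.
  by case: k => k; rewrite ?NegzE -?exprnN ?normcV' normcX.
move=> i j /(congr1 (@normc R)); rewrite !nz => /ieexprIz.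
rewrite (lt_trans ltr01 n1) gt_eqF // => /(_ isT isT).
by case: (ltngtP i j) => // ij; have := nth_part_le hmu (ltnW ij); lia.
Qed.

(** Unlike the ratio of alternants, this determinant has size M for every N, so its limit can be
    taken entry by entry. *)
Lemma schur_polyE mu N (x : nat -> C) M : is_part mu -> (size mu <= N)%N -> (head 0 mu <= M)%N -> injective x ->
  schur_poly mu x N = \det (jt_mx x N (fun k : 'I_M => nth 0%N (conj_part mu) k)).
Proof.
move=> hmu sN hM inj; rewrite /schur_poly sN (conj_jt _ hmu sN hM) mulrAC divff ?mul1r //.
exact: alternant_neq0.
Qed.

Lemma schur_ex mu nu : is_part mu -> is_part nu -> exists f : C -> C, rational f /\
  forall u, 1 < `|u| -> schur_poly nu (qpow mu u) @ \oo --> f u.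
Proof.
move=> hmu hnu; have [c [rc cc]] := elim_ex mu; set M := head 0%N nu.
pose A u : 'M[C]_M := \matrix_(k, l) (if (k <= nth 0%N (conj_part nu) k + l)%N then c u (nth 0%N (conj_part nu) k + l - k)%N else 0).
exists (fun u => \det (A u)); split.
  by apply: rat_det => k l; apply: (@rat_eq _ (fun u => if (k <= nth 0%N (conj_part nu) k + l)%N then c u (nth 0%N (conj_part nu) k + l - k)%N else 0)) => [u _|]; [by rewrite mxE|case: (_ <= _)%N; [exact: rc|exact: (@rat_cst R 0)]].
move=> u u1.
have H : (fun N => \det (jt_mx (qpow mu u) N (fun k : 'I_M => nth 0%N (conj_part nu) k))) @ \oo --> \det (A u).
  apply: cvgC_det => k l; rewrite mxE; case: ifP => kl; last by apply: (cvgC_eq (cvgC_cst _ 0)) => N; rewrite mxE kl.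
  by apply: (cvgC_eq (cc u u1 (nth 0%N (conj_part nu) k + l - k)%N)) => N; rewrite mxE kl gf_coef.
apply: (@cvgC_near _ _ _ _ (size nu) _ H) => N sN; rewrite (schur_polyE (M := M)) //.
exact: qpow_inj.
Qed.
End Schur.

Lemma nth_filter_pos s j : sorted geq s -> nth 0%N [seq k <- s | (0 < k)%N] j = nth 0%N s j.
Proof.
elim: s j => [|k s IH] j //= srt; case: k srt => [|k] srt /=; last by case: j => //= j; rewrite IH // (path_sorted srt).
have s0 : all (fun k => k == 0)%N s.
  apply/allP => k ks; have /allP/(_ k ks) := order_path_min (rev_trans leq_trans) srt.
  by rewrite /= leqn0.
rewrite (eq_in_filter (a2 := pred0)) ?filter_pred0; last first.
  by move=> k /(allP s0) /eqP ->.
rewrite nth_nil; case: j => //= j; case: (ltnP j (size s)) => js; last by rewrite nth_default.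
by rewrite (eqP (allP s0 _ (mem_nth 0%N js))).
Qed.

(** * Partitions as decreasing maps *)

Section Parts.
Variable N : nat.
Implicit Types g : {ffun 'I_N -> 'I_(N + N)}.

Definition part_of g : seq nat := [seq k <- [seq row_len g j | j <- enum 'I_N] | (0 < k)%N].

Lemma row_len_sorted g : decreasing g -> sorted geq [seq row_len g j | j <- enum 'I_N].
Proof.
move=> dg; apply/(sortedP 0%N) => i; rewrite size_map size_enum_ord => iN.
have i0 := Ordinal iN; have iN' := ltnW iN.
rewrite !(nth_map i0) -?enumT ?size_enum_ord //.
have E k : (k < N)%N -> nat_of_ord (nth i0 (enum 'I_N) k) = k by apply: nth_enum_ord.
have := decreasingP _ dg (nth i0 (enum 'I_N) i) (nth i0 (enum 'I_N) i.+1).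
rewrite /row_len /geq /= -?enumT !E // => /(_ (ltnSn _)).
by lia.
Qed.

Lemma nth_part_of g (j : 'I_N) : decreasing g -> nth 0%N (part_of g) j = row_len g j.
Proof.
by move=> dg; rewrite nth_filter_pos ?row_len_sorted // (nth_map j) ?size_enum_ord // nth_ord_enum.
Qed.

Lemma part_of_part g : decreasing g -> is_part (part_of g).
Proof.
move=> dg; rewrite /is_part mem_filter andbT; apply: sorted_filter (row_len_sorted dg).
by move=> a b c /= ab bc; apply: leq_trans bc ab.
Qed.

Lemma sumn_part_of g : sumn (part_of g) = \sum_j row_len g j.
Proof.
rewrite sumnE big_filter big_map big_enum_cond /= big_mkcond; apply: eq_bigr => j _.
by case: posnP.
Qed.

Lemma part_of_inj g g' : decreasing g -> decreasing g' -> part_of g = part_of g' -> g = g'.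
Proof.
move=> dg dg' E; apply/ffunP => j; apply: val_inj => /=.
have := nth_part_of j dg; rewrite E nth_part_of // /row_len.
by have := decreasing_ge j dg; have := decreasing_ge j dg'; lia.
Qed.

Lemma part_of_surj nu : is_part nu -> (sumn nu <= N)%N -> exists2 g, decreasing g & part_of g = nu.
Proof.
move=> hnu nuN.
have nle j : (nth 0%N nu j <= sumn nu)%N.
  elim: (nu) j => [|k s IH] [|j] //=; first exact: leq_addr.
  by rewrite (leq_trans (IH j)) // leq_addl.
have szN : (size nu <= N)%N.
  apply: leq_trans nuN; case/andP: hnu => _; elim: (nu) => //= k s IH.
  by rewrite inE negb_or => /andP[k0 /IH]; lia.
have lt (j : 'I_N) : (nth 0%N nu j + (N - j.+1) < N + N)%N.
  by have := nle j; have := ltn_ord j; lia.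
pose g : {ffun 'I_N -> 'I_(N + N)} := [ffun j => Ordinal (lt j)].
have dg : decreasing g.
  apply/decreasingP => i j ij; rewrite !ffunE /=.
  by have := nth_part_le hnu (ltnW ij); have := ltn_ord j; lia.
exists g => //; apply: part_eqP => // [|j]; first exact: part_of_part.
case: (ltnP j N) => jN.
  by rewrite (nth_part_of (Ordinal jN) dg) /row_len ffunE /= addnK.
rewrite !nth_default // ?(leq_trans szN) //.
by rewrite (leq_trans _ jN) // size_filter (leq_trans (count_size _ _)) // size_map size_enum_ord.
Qed.

(** Every N at least d indexes the same sum. Taking N = d fixes the index set while the number of
    variables tends to infinity. *)
Lemma fsbig_parts (V : nmodType) (d : nat) (F : seq nat -> V) : (d <= N)%N ->
  \sum_(nu \in parts d) F nu = \sum_(g | decreasing g && (\sum_j row_len g j == d)%N) F (part_of g).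
Proof.
move=> dN; pose s := [seq part_of g | g <- enum [pred g | decreasing g && (\sum_j row_len g j == d)%N]].
have sP nu : (nu \in s) = `[< parts d nu >].
  apply/mapP/asboolP => [[g]|[hnu nud]].
    rewrite mem_enum inE => /andP[dg /eqP gd] ->; split; first exact: part_of_part.
    by rewrite sumn_part_of.
  have [|g dg gE] := part_of_surj hnu; first by rewrite nud.
  by exists g => //; rewrite mem_enum inE dg -sumn_part_of gE nud eqxx.
have us : uniq s.
  rewrite map_inj_in_uniq ?enum_uniq // => g g'; rewrite !mem_enum !inE => /andP[dg _] /andP[dg' _].
  exact: part_of_inj.
have -> : parts d = [set` s].
  by apply/seteqP; split => nu /=; rewrite sP => /asboolP.
rewrite -fsbig_seq // /s big_map big_enum /=; apply: eq_bigl => g; by rewrite inE.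
Qed.
End Parts.

Lemma size_le_sumn nu : is_part nu -> (size nu <= sumn nu)%N.
Proof.
case/andP => _; elim: nu => //= k s IH.
by rewrite inE negb_or => /andP[k0 /IH]; lia.
Qed.

Lemma head_le_sumn nu : (head 0 nu <= sumn nu)%N.
Proof. by case: nu => //= k s; apply: leq_addr. Qed.

(** * The dual Cauchy identity in the limit *)

Section SchurValues.
Variable R : realType.
Local Notation C := R[i].
Implicit Types (u : C) (mu nu : seq nat).

Lemma schur_cvg mu nu u : is_part mu -> is_part nu -> 1 < `|u| ->
  schur_poly nu (qpow mu u) @ \oo --> schur nu (qpow mu u).
Proof.
move=> hmu hnu u1; have [f [_ fc]] := @schur_ex R mu nu hmu hnu.
by rewrite /schur (cvgC_lim (fc u u1)); apply: fc.
Qed.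

Lemma rational_schur mu nu : is_part mu -> is_part nu -> rational (fun u => schur nu (qpow mu u)).
Proof.
move=> hmu hnu; have [f [rf fc]] := @schur_ex R mu nu hmu hnu.
by apply: rat_eq rf => u u1; rewrite /schur (cvgC_lim (fc u u1)).
Qed.

Lemma rep_W mu nu : is_part mu -> is_part nu ->
  rep (W R mu nu) (fun u => schur mu (qpow [::] u) * schur nu (qpow mu u)).
Proof. by move=> hmu hnu; apply: ratfun_ofP; apply: ratM; apply: rational_schur. Qed.

Lemma rep_W1 nu : is_part nu -> rep (W1 R nu) (fun u => schur nu (qpow [::] u)).
Proof. by move=> hnu; apply: ratfun_ofP; apply: rational_schur. Qed.

Definition double_prod (x y : nat -> C) N : {poly C} :=
  \prod_(i < N) \prod_(j < N) (1 + (x j * y i)%:P * 'X).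

(** The bound d <= N ensures that neither the partitions of d nor their conjugates have more parts
    than there are variables, where [schur_poly] would be 0. *)
Lemma schur_dual_Cauchy mu u N d : is_part mu -> 1 < `|u| -> (d <= N)%N ->
  \sum_(nu \in parts d) schur_poly nu (qpow mu u) N * schur_poly (conj_part nu) (qpow [::] u) N =
  (double_prod (qpow [::] u) (qpow mu u) N)`_d.
Proof.
move=> hmu u1 dN; set x := qpow [::] u; set y := qpow mu u.
have yi : injective y by apply: qpow_inj.
have xi : injective x by apply: qpow_inj.
have a0 := alternant_neq0 N yi.
rewrite (fsbig_parts _ dN).
have := congr1 (fun p : {poly C} => p`_d) (dual_Cauchy_poly x y N); rewrite coefCM => /(canRL (mulKf a0)) ->.
rewrite coef_sum mulr_sumr big_mkcondr /=; apply: eq_bigr => g dg.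
rewrite coefCM coefXn eq_sym; case: eqP => [gd|_]; last by rewrite !mulr0.
rewrite mulr1; have hp := part_of_part dg; have sp := sumn_part_of g; rewrite -gd in sp.
have szN : (size (part_of g) <= N)%N by rewrite (leq_trans (size_le_sumn hp)) // sp.
have hdN : (head 0 (part_of g) <= N)%N by rewrite (leq_trans (head_le_sumn _)) // sp.
rewrite (@schur_polyE _ _ N x N (is_part_conj hp)) ?size_conj_part //; last first.
  by rewrite -nth0 nth_conj_part // (leq_trans (count_size _ _)).
rewrite conj_partK // /schur_poly szN.
have -> : \matrix_(i < N, j < N) y i ^+ (nth 0%N (part_of g) j + (N - j.+1)) = \matrix_(i < N, j < N) y i ^+ g j.
  by apply/matrixP => i j; rewrite !mxE nth_part_of // subnK // decreasing_ge.
have -> : jt_mx x N (fun k : 'I_N => nth 0%N (part_of g) k) = jt_mx x N (row_len g).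
  by apply/matrixP => k l; rewrite !mxE nth_part_of.
by rewrite [X in X * _]mulrC mulrA.
Qed.

Lemma double_prod_cvg mu u d : is_part mu -> 1 < `|u| ->
  (fun N => (double_prod (qpow [::] u) (qpow mu u) N)`_d) @ \oo -->
  \sum_(nu \in parts d) schur nu (qpow mu u) * schur (conj_part nu) (qpow [::] u).
Proof.
move=> hmu u1; rewrite (fsbig_parts _ (leqnn d)).
have H : (fun N => \sum_(g : {ffun 'I_d -> 'I_(d + d)} | decreasing g && (\sum_j row_len g j == d)%N)
    schur_poly (part_of g) (qpow mu u) N * schur_poly (conj_part (part_of g)) (qpow [::] u) N) @ \oo -->
  \sum_(g : {ffun 'I_d -> 'I_(d + d)} | decreasing g && (\sum_j row_len g j == d)%N)
    schur (part_of g) (qpow mu u) * schur (conj_part (part_of g)) (qpow [::] u).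
  apply: cvgC_sum => g /andP[dg _]; have hp := part_of_part dg.
  exact (cvgCM (schur_cvg hmu hp u1) (schur_cvg (isT : is_part [::]) (is_part_conj hp) u1)).
apply: (@cvgC_near _ _ _ _ d _ H) => N dN.
by rewrite -(schur_dual_Cauchy hmu u1 dN) (fsbig_parts _ (leqnn d)).
Qed.
End SchurValues.

(** * Dependence on mu through the contents of its cells *)

Section Contents.
Variable R : realType.
Local Notation C := R[i].
Implicit Types (u : C) (mu nu : seq nat).

Definition conv (P : {poly C}) (c : nat -> C) k := \sum_(i < k.+1) P`_i * c (k - i)%N.

Lemma conv1 c k : conv 1 c k = c k.
Proof.
rewrite /conv big_ord_recl coef1 mul1r subn0 big1 ?addr0 // => i _.
by rewrite coef1 mul0r.
Qed.

Lemma conv_1DX P (b : C) c k : conv (P * (1 + b%:P * 'X)) c k.+1 = conv P c k.+1 + b * conv P c k.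
Proof.
have co i : (P * (1 + b%:P * 'X))`_i = P`_i + b * (if i is i'.+1 then P`_i' else 0).
  by rewrite mulrDr mulr1 coefD mulrCA coefCM; congr (_ + _ * _); case: i => [|i]; rewrite coefMX.
rewrite /conv; under eq_bigr do rewrite co mulrDl.
rewrite big_split /=; congr (_ + _).
rewrite big_ord_recl mulr0 mul0r add0r mulr_sumr; apply: eq_bigr => i _.
by rewrite /= mulrA subSS.
Qed.

Lemma conv_1DX0 P (b : C) c : conv (P * (1 + b%:P * 'X)) c 0 = conv P c 0.
Proof.
by rewrite /conv !big_ord1 mulrDr mulr1 coefD mulrCA coefCM coefMX /= mulr0 addr0.
Qed.

(** Product over the cells of mu of 1 + q^c X, where q = u^2 and c = m - l is the content of the
    cell. *)
Definition content_poly mu u : {poly C} :=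
  \prod_(l < size mu) \prod_(m < nth 0%N mu l) (1 + (u ^ ((m.*2)%:Z - (l.*2)%:Z))%:P * 'X).

(** Passing from y to y' shifts the row of factors p_1, ..., p_N to p_0, ..., p_(N-1); only the end
    factors fail to cancel. *)
Lemma double_prod_row (x y y' : nat -> C) N l (p : nat -> C) : (l < N)%N ->
    (forall j, j != l -> y' j = y j) -> (forall j, x j * y' l = p j) -> (forall j, x j * y l = p j.+1) ->
  double_prod x y' N * (1 + (p N)%:P * 'X) = double_prod x y N * (1 + (p 0%N)%:P * 'X).
Proof.
move=> lN yy' y'l yl; rewrite /double_prod (bigD1 (Ordinal lN)) //= [in RHS](bigD1 (Ordinal lN)) //=.
have -> : \prod_(i < N | i != Ordinal lN) \prod_(j < N) (1 + (x j * y' i)%:P * 'X) =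
    \prod_(i < N | i != Ordinal lN) \prod_(j < N) (1 + (x j * y i)%:P * 'X).
  apply: eq_bigr => i il; apply: eq_bigr => j _; rewrite yy' //.
rewrite mulrAC [RHS]mulrAC; congr (_ * _).
under eq_bigr do rewrite y'l; under [in RHS]eq_bigr do rewrite yl.
rewrite -(big_ord_recr N (fun i => 1 + (p i)%:P * 'X)) /= big_ord_recl mulrC; congr (_ * _).
Qed.

(** The partition is built cell by cell: a new cell in row l multiplies y_l by q, and since p_N
    tends to 0 only the factor 1 + q^c X remains in the limit. *)
Lemma content_cvg mu u (c : nat -> C) : 1 < `|u| ->
  cvg_coef (double_prod (qpow [::] u) (qpow [::] u)) c ->
  cvg_coef (double_prod (qpow [::] u) (qpow mu u)) (conv (content_poly mu u) c).
Proof.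
move=> u1 c0; have u0 := norm1_neq0 u1.
suff H l : (l <= size mu)%N -> cvg_coef (double_prod (qpow [::] u) (qpow (take l mu) u)) (conv
   (\prod_(i < l) \prod_(m < nth 0%N mu i) (1 + (u ^ ((m.*2)%:Z - (i.*2)%:Z))%:P * 'X)) c).
  by have := H _ (leqnn _); rewrite take_size.
elim: l => [|l IH] lm.
  by rewrite take0 big_ord0 => k; rewrite conv1.
have {}IH := IH (ltnW lm).
pose y m j := if j == l then u ^ ((m.*2)%:Z - (l.*2)%:Z - 1) else qpow (take l mu) u j.
rewrite big_ord_recr /=; set P := \prod_(i < l) _ in IH *.
have yE : qpow (take l.+1 mu) u =1 y (nth 0%N mu l).
  move=> j; rewrite /y /qpow; case: eqP => [->|/eqP jl]; first by rewrite nth_take.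
  congr (_ ^ (_.*2%:Z - _ - _)); case: (ltnP j l) => jl'; first by rewrite !nth_take // ltnW.
  by rewrite !nth_default // size_take_min; lia.
have -> : qpow (take l.+1 mu) u = y (nth 0%N mu l) by apply: funext.
elim: (nth 0%N mu l) => [|m IHm].
  rewrite big_ord0 mulr1 (_ : y 0%N = qpow (take l mu) u) //; apply: funext => j.
  rewrite /y /qpow; case: eqP => // ->; rewrite nth_default // size_take_min; exact: geq_minl.
rewrite big_ord_recr /= mulrA; set P' := P * _ in IHm *.
pose p j := u ^ ((m.*2)%:Z - (l.*2)%:Z - (j.*2)%:Z).
apply: (@cvg_coef_ratio _ _ (double_prod (qpow [::] u) (y m)) p (p 0%N) 0 (conv P' c) _ l.+1) => //.
- move=> N lN; apply: double_prod_row lN _ _ _ => //.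
  + by move=> j jl; rewrite /y (negPf jl).
  + by move=> j; rewrite /y eqxx /qpow nth_nil -expfzDr //; congr (u ^ _); lia.
  by move=> j; rewrite /y eqxx /qpow nth_nil -expfzDr //; congr (u ^ _); lia.
- have L := cvgCM (cvgC_cst _ (p 0%N)) (cvgC_expr (inv_lt1 u1)).
  rewrite mulr0 in L; apply: (cvgC_eq L) => N; rewrite /p.
  rewrite exprnN -[(u ^ _) ^+ N]/((u ^ (- 2%:Z)) ^ N%:Z) exprz_exp -expfzDr //; congr (u ^ _); lia.
- by rewrite conv_1DX0.
by move=> k; rewrite conv_1DX mul0r subr0 /p subr0.
Qed.
End Contents.

(** * Hook Schur functions at q^rho and their sum over the leg *)

Section HookValues.
Variable R : realType.
Local Notation C := R[i].
Implicit Types (u t : C) (mu nu : seq nat).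

Definition hook n b : seq nat := (n - b)%N :: nseq b 1%N.

Lemma is_part_hook n b : (b < n)%N -> is_part (hook n b).
Proof.
move=> bn; rewrite /is_part inE negb_or mem_nseq andbF andbT /=; apply/andP; split; last by lia.
case: b bn => //= b bn; apply/andP; split; first by rewrite /geq /=; lia.
by elim: b {bn} => //= b IH; rewrite IH /geq /= leqnn.
Qed.

(** Both sides are the Gaussian binomial coefficient of n + m over n in t. This trades m factors, a
    number that grows, for n factors. *)
Lemma telescope_ratio t n m : (forall k, t ^+ k.+1 != 1) ->
  \prod_(k < m) ((1 - t ^+ (n + k).+1) / (1 - t ^+ k.+1)) =
  \prod_(k < n) ((1 - t ^+ (m + k).+1) / (1 - t ^+ k.+1)).
Proof.
move=> t1; have nz k : 1 - t ^+ k.+1 != 0 by rewrite subr_eq0 eq_sym.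
have p0 l : \prod_(k < l) (1 - t ^+ k.+1) != 0 by apply/prodf_neq0 => k _.
rewrite !big_split /= !prodfV; apply/eqP; rewrite eqr_div ?p0 //; apply/eqP.
have E l l' : \prod_(k < l) (1 - t ^+ k.+1) * \prod_(k < l') (1 - t ^+ (l + k).+1) = \prod_(k < l + l') (1 - t ^+ k.+1).
  by rewrite big_split_ord.
by rewrite mulrC E mulrC E addnC.
Qed.

(** The Schur function of the hook at q^rho without its sign (-1)^b, which will cancel against the
    sign of the character. *)
Definition hook_val u n b : C :=
  u^-1 ^+ n * \prod_(k < b) (((u ^- 2) ^+ n - (u ^- 2) ^+ k.+1) / (1 - (u ^- 2) ^+ k.+1)) *
  \prod_(k < n) (1 - (u ^- 2) ^+ k.+1)^-1.

(** By [det_geometric] both alternants are Vandermonde products in powers of t that differ in node b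
    only. The nodes before b give the product over k < b, those after b a Gaussian binomial
    coefficient. *)
Lemma schur_poly_hook u n b m : 1 < `|u| -> (b < n)%N ->
  schur_poly (hook n b) (qpow [::] u) (b + m.+1) = (-1) ^+ b * (u^-1 ^+ n *
    \prod_(k < b) (((u ^- 2) ^+ n - (u ^- 2) ^+ k.+1) / (1 - (u ^- 2) ^+ k.+1)) *
    \prod_(k < n) ((1 - (u ^- 2) ^+ (m + k).+1) / (1 - (u ^- 2) ^+ k.+1))).
Proof.
move=> u1 bn; have u0 := norm1_neq0 u1; set t := u ^- 2.
have t1 k : t ^+ k.+1 != 1 by apply: expn_neq1.
have t0 : t != 0 by rewrite invr_neq0 // expf_neq0.
have tinj : injective (fun k : nat => t ^+ k).
  have H i j : (i < j)%N -> t ^+ i != t ^+ j.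
    move=> ij; rewrite -(subnKC ij) addSnnS exprD -[X in X != _]mulr1 (inj_eq (mulfI _)) ?expf_neq0 //.
    by rewrite eq_sym t1.
  move=> i j /eqP E; case: (ltngtP i j) => // /H; first by rewrite E.
  by rewrite eq_sym E.
have bN : (b < b + m.+1)%N by lia.
rewrite /schur_poly /hook /= size_nseq ifT; last by lia.
rewrite hook_alternant //.
have xE j : qpow [::] u j = u^-1 * t ^+ j by apply: qpow_nil.
have mE (e : 'I_(b + m.+1) -> nat) : \matrix_(i < b + m.+1, j < b + m.+1) qpow [::] u i ^+ e j =
   \matrix_(i < b + m.+1, j < b + m.+1) (u^-1 * t ^+ i) ^+ e j.
  by apply/matrixP => i j; rewrite !mxE xE.
rewrite !mE !det_geometric.
pose z (j : 'I_(b + m.+1)) := t ^+ (b + m.+1 - j.+1).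
rewrite (@vandermonde_change _ _ z (fun j => t ^+ (b + m.+1 - j.+1 + (j == b :> nat) * n)) (Ordinal bN)); last 2 first.
- by move=> i j /tinj E; apply: val_inj => /=; have := ltn_ord i; have := ltn_ord j; lia.
- by move=> j jb; rewrite (_ : (j == b :> nat) = false) ?mul0n ?addn0 //; apply: contra_neqF jb => /eqP E; apply: val_inj.
have -> : \prod_j u^-1 ^+ (b + m.+1 - (j : 'I_(b + m.+1)).+1 + (j == b :> nat) * n) =
  u^-1 ^+ n * \prod_(j < b + m.+1) u^-1 ^+ (b + m.+1 - j.+1).
  rewrite !prodrXr -exprD; congr (_ ^+ _); rewrite big_split /= addnC; congr addn.
  rewrite (bigD1 (Ordinal bN)) //= eqxx mul1n big1 ?addn0 // => j jb.
  by rewrite (_ : (j == b :> nat) = false) //; apply: contra_neqF jb => /eqP E; apply: val_inj.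
have V0 : \prod_(i < b + m.+1) \prod_(j < b + m.+1 | (i < j)%N) (z j - z i) != 0.
  apply/prodf_neq0 => i _; apply/prodf_neq0 => j ij; rewrite subr_eq0; apply/eqP => /tinj E.
  by have := ltn_ord j; lia.
have U0 : \prod_(j < b + m.+1) u^-1 ^+ (b + m.+1 - j.+1) != 0.
  by apply/prodf_neq0 => j _; rewrite expf_neq0 // invr_eq0.
rewrite -/z; set U := \prod_(j < _) _ in U0 *; set V := \prod_(i < _) \prod_(j < _ | _) (z j - _) in V0 *.
set P := \prod_(j < _ | _) _.
have -> : (-1) ^+ b * (u^-1 ^+ n * U * (V * P)) / (U * V) = (-1) ^+ b * (u^-1 ^+ n * P).
  by field; rewrite U0 V0.
rewrite -telescope_ratio // -mulrA; congr (_ * (_ * _)); rewrite /P /z /= eqxx mul1n.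
rewrite (prod_skip (fun j => (t ^+ (b + m.+1 - b.+1 + n) - t ^+ (b + m.+1 - j.+1)) / (t ^+ (b + m.+1 - b.+1) - t ^+ (b + m.+1 - j.+1))) b m).
have e1 : (b + m.+1 - b.+1 = m)%N by lia.
rewrite e1; congr (_ * _); apply: eq_bigr => k _; have kk := ltn_ord k.
  have -> : (b + m.+1 - (b - k.+1).+1 = m + k.+1)%N by lia.
  rewrite !exprD -mulrBr -[X in _ / (X - _)]mulr1 -mulrBr -mulf_div divff ?mul1r // expf_neq0 //.
have -> : (b + m.+1 - (b + k.+1).+1 = m - k.+1)%N by lia.
set r := (m - k.+1)%N; have e2 : t ^+ m = t ^+ r * t ^+ k.+1 by rewrite -exprD subnK.
have e3 : t ^+ (m + n) = t ^+ r * t ^+ (n + k).+1 by rewrite -exprD; congr (_ ^+ _); rewrite /r; lia.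
rewrite e2 e3; have r0 : t ^+ r != 0 by rewrite expf_neq0.
have k0 : 1 - t ^+ k.+1 != 0 by rewrite subr_eq0 eq_sym.
move: (t ^+ r) (t ^+ k.+1) (t ^+ (n + k).+1) r0 k0 => T B A r0 k0; field; rewrite k0 /=.
by rewrite -oppr_eq0 opprB -{1}[T]mulr1 -mulrBr mulf_neq0.
Qed.

Lemma schur_hook u n b : 1 < `|u| -> (b < n)%N ->
  schur (hook n b) (qpow [::] u) = (-1) ^+ b * hook_val u n b.
Proof.
move=> u1 bn; set t := u ^- 2.
pose K := u^-1 ^+ n * \prod_(k < b) ((t ^+ n - t ^+ k.+1) / (1 - t ^+ k.+1)).
have L (k : 'I_n) : (fun m => (1 - t ^+ (m + k).+1) / (1 - t ^+ k.+1)) @ \oo --> (1 - t ^+ k.+1)^-1.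
  have := cvgCM (cvgC_cst _ (t ^+ k.+1)) (cvgC_expr (inv_lt1 u1)) => L0; rewrite mulr0 in L0.
  have L1 := cvgCM (cvgCB (cvgC_cst _ 1) L0) (cvgC_cst _ (1 - t ^+ k.+1)^-1).
  rewrite subr0 mul1r in L1; apply: (cvgC_eq L1) => m.
  by rewrite -exprD; congr ((1 - t ^+ _) / _); lia.
have L2 := cvgCM (cvgC_cst _ ((-1) ^+ b)) (cvgCM (cvgC_cst _ K) (cvgC_prod (r := index_enum 'I_n) (P := xpredT) (fun k _ => L k))).
apply: cvgC_lim; apply/cvgCP => e e0.
have [M HM] := (cvgCP _ _).1 L2 e e0; exists (b + M.+1)%N => N NM.
have {NM}[m mM ->] : exists2 m, (M <= m)%N & N = (b + m.+1)%N.
  by exists (N - b.+1)%N; lia.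
by rewrite schur_poly_hook //; apply: HM.
Qed.

(** e_d(1, q, ..., q^(n-1)) in product form, for q = u^2. *)
Definition eps u n d : C := \prod_(j < d) (((u ^+ 2) ^+ j - (u ^+ 2) ^+ n) / (1 - (u ^+ 2) ^+ j.+1)).

Lemma sqr_expn_neq1 u k : 1 < `|u| -> u ^+ 2 ^+ k.+1 != 1.
Proof.
move=> /(expn_neq1 k); apply: contra_neq => E.
by rewrite exprVn E invr1.
Qed.

Lemma elsym_eps u n d : 1 < `|u| -> elsym (fun j => (u ^+ 2) ^+ j) n d = eps u n d.
Proof.
move=> u1; elim: d => [|d IH]; first by rewrite elsym0 /eps big_ord0.
rewrite /eps big_ord_recr /= -/(eps u n d) -IH; set q := u ^+ 2.
have q1 : 1 - q ^+ d.+1 != 0 by rewrite subr_eq0 eq_sym sqr_expn_neq1.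
have H := elsym_geometric 1 q n d.
rewrite (_ : (fun j => 1 * q ^+ j) = (fun j => q ^+ j)) in H; last by apply: funext => j; rewrite mul1r.
rewrite -[LHS](mulfK q1) [RHS]mulrA; congr (_ / _).
by apply: (eq_by (esym H)); ring.
Qed.

(** Writes the product over k < b in [hook_val u n.+1 b] as an elementary symmetric function of -t,
    ..., -t^n, so that summing over b becomes evaluating a generating polynomial. *)
Lemma elsym_hook u n b : 1 < `|u| -> 
  elsym (fun j => - (u ^- 2) * (u ^- 2) ^+ j) n b =
  \prod_(k < b) (((u ^- 2) ^+ n.+1 - (u ^- 2) ^+ k.+1) / (1 - (u ^- 2) ^+ k.+1)).
Proof.
move=> u1; elim: b => [|b IH]; first by rewrite elsym0 big_ord0.
rewrite big_ord_recr /= -IH; set t := u ^- 2.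
have t1 : 1 - t ^+ b.+1 != 0 by rewrite subr_eq0 eq_sym expn_neq1.
have H := elsym_geometric (- t) t n b.
rewrite -[LHS](mulfK t1) [RHS]mulrA; congr (_ / _).
by apply: (eq_by (esym H)); rewrite !exprS; ring.
Qed.

Definition one_point_val u n d : C :=
  u^-1 ^+ n * \prod_(k < n) (1 - (u ^- 2) ^+ k.+1)^-1 *
  \prod_(k < n.-1) (1 - (u ^- 2) ^+ (d + k).+1) * eps u n d.

(** The contents of the hook are -b, ..., n - 1 - b, so its content polynomial is the generating
    polynomial of 1, q, ..., q^(n-1) with the variable scaled by q^-b. *)
Lemma content_poly_hook u n b d : 1 < `|u| -> (b < n)%N ->
  (content_poly (hook n b) u)`_d = (u ^- 2) ^+ (b * d) * eps u n d.
Proof.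
move=> u1 bn; have u0 := norm1_neq0 u1.
rewrite -elsym_eps // exprM -elsym_scale -gf_coef; congr (polyseq _)`_d.
have qt i j : (u ^+ 2) ^+ i * (u ^- 2) ^+ j = u ^ ((i.*2)%:Z - (j.*2)%:Z).
  rewrite exprVn -!exprM !exprnP exprnN -expfzDr //; congr (u ^ _); lia.
rewrite /content_poly /gf /= size_nseq big_ord_recl /=.
have [p np] : exists p, n = (b + p)%N by exists (n - b)%N; lia.
rewrite np addKn big_split_ord /= [LHS]mulrC; congr (_ * _).
  rewrite (reindex_inj rev_ord_inj) /=; apply: eq_bigr => l _; have lb := ltn_ord l.
  rewrite /bump leq0n add1n /= nth_nseq (_ : (b - l.+1 < b)%N) ?big_ord1 ?qt; last by lia.
  by congr (1 + (u ^ _)%:P * 'X); rewrite /=; lia.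
by apply: eq_bigr => m _; rewrite qt; congr (1 + (u ^ _)%:P * 'X); lia.
Qed.

(** The q-binomial theorem: the leg b occurs only through e_b(-t, ..., -t^(n-1)) t^(db), and the sum
    over b is the generating polynomial at t^d. *)
Lemma hook_val_sum u n d : 1 < `|u| -> (0 < n)%N ->
  \sum_(b < n) hook_val u n b * (content_poly (hook n b) u)`_d = one_point_val u n d.
Proof.
move=> u1; case: n => // n _; rewrite /one_point_val /=.
set t := u ^- 2; set x := fun j => - t * t ^+ j.
pose K := u^-1 ^+ n.+1 * \prod_(k < n.+1) (1 - t ^+ k.+1)^-1 * eps u n.+1 d.
transitivity (K * \sum_(b < n.+1) elsym x n b * (t ^+ d) ^+ b).
  rewrite mulr_sumr; apply: eq_bigr => b _; have bn := ltn_ord b.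
  rewrite content_poly_hook // /hook_val -elsym_hook // -/t -/x mulnC exprM /K; ring.
have -> : \prod_(k < n) (1 - t ^+ (d + k).+1) = (gf x n).[t ^+ d].
  rewrite /gf horner_prod; apply: eq_bigr => k _.
  by rewrite hornerD hornerM hornerX !hornerC /x -addnS !exprD exprS; ring.
have sz : (size (gf x n) <= n.+1)%N.
  by apply/leq_sizeP => j nj; rewrite gf_coef elsym_gt.
have -> : (gf x n).[t ^+ d] = \sum_(b < n.+1) elsym x n b * (t ^+ d) ^+ b.
  by rewrite (horner_coef_wide _ sz); apply: eq_bigr => b _; rewrite gf_coef.
by rewrite /K; ring.
Qed.
End HookValues.

(** * The one-point function *)

Section FormalLinear.
Variable K : fieldType.
Implicit Types f g : fps K.

Lemma splits_nil : splits [::] = [set` [:: ([::] : seq nat, [::] : seq nat)]].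
Proof.
apply/seteqP; split => [[a b] /= [_ _ H]|[a b]] /=; rewrite inE.
  by move: (perm_size H); rewrite size_cat; case: a H; case: b.
by case/eqP => -> ->.
Qed.

Lemma splits_one n : (0 < n)%N -> splits [:: n] = [set` [:: ([:: n], [::]); ([::], [:: n])]].
Proof.
move=> n0; apply/seteqP; split => [[a b] /= [_ _ H]|[a b]] /=; rewrite !inE.
  have {H}H : a ++ b = [:: n] by apply: perm_small_eq.
  case: a H => [|x a] /= H; first by rewrite H eqxx ?orbT.
  by case: H => -> /eqP; rewrite -size_eq0 size_cat addn_eq0 !size_eq0 => /andP[/eqP -> /eqP ->]; rewrite eqxx.
have pn : is_part [:: n] by rewrite /is_part /= inE; lia.
by case/orP => /eqP[-> ->]; split.
Qed.

Lemma fmul_nil f g d : fmul f g d [::] = \sum_(k < d.+1) f k [::] * g (d - k)%N [::].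
Proof.
rewrite /fmul; apply: eq_bigr => k _.
by rewrite splits_nil -fsbig_seq // big_seq1.
Qed.

Lemma fmul_one f g d n : (0 < n)%N ->
  fmul f g d [:: n] = \sum_(k < d.+1) (f k [:: n] * g (d - k)%N [::] + f k [::] * g (d - k)%N [:: n]).
Proof.
move=> n0; rewrite /fmul; apply: eq_bigr => k _.
by rewrite splits_one // -fsbig_seq // big_cons big_seq1.
Qed.

Definition trunc D (c : nat -> K) : {poly K} := \poly_(i < D.+1) c i.

Lemma coef_trunc D c d : (d <= D)%N -> (trunc D c)`_d = c d.
Proof. by move=> dD; rewrite coef_poly ltnS dD. Qed.

Lemma coef_truncM D c c' d : (d <= D)%N -> (trunc D c * trunc D c')`_d = \sum_(k < d.+1) c k * c' (d - k)%N.
Proof.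
move=> dD; rewrite coefM; apply: eq_bigr => k _; rewrite !coef_trunc //; first by lia.
by have := ltn_ord k; lia.
Qed.

Lemma fpow_nil f D d k : (d <= D)%N -> fpow f k d [::] = (trunc D (fun i => f i [::]) ^+ k)`_d.
Proof.
elim: k d => [|k IH] d dD; first by rewrite /fpow /= /fone coef1 eqxx andbT.
rewrite -[fpow f k.+1]/(fmul f (fpow f k)) fmul_nil exprS coefM; apply: eq_bigr => j _.
by rewrite coef_trunc ?IH //; [lia|have := ltn_ord j; lia].
Qed.

Lemma coef_pow_small (p : {poly K}) k d : p`_0 = 0 -> (d < k)%N -> (p ^+ k)`_d = 0.
Proof.
move=> p0; elim: k d => // k IH d dk; rewrite exprS coefM big1 // => j _.
case: (posnP j) => [->|j0]; first by rewrite p0 mul0r.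
by have jd := ltn_ord j; rewrite IH ?mulr0 //; lia.
Qed.

(** Truncated geometric series: 1 - p times it is 1 - p^(d+1), and p has no constant term, so the
    error starts beyond degree d. *)
Lemma finv_nil f d : f 0%N [::] = 1 -> \sum_(k < d.+1) f k [::] * Defs.finv f (d - k)%N [::] = (d == 0%N)%:R.
Proof.
move=> f0; pose h i := fsub (fone K) f i [::]; pose p := trunc d h.
have p0 : p`_0 = 0 by rewrite coef_trunc // /h /fsub /fone f0 subrr.
have fE : trunc d (fun i => f i [::]) = 1 - p.
  apply/polyP => i; rewrite coefB coef1 !coef_poly; case: ltnP => id.
    by rewrite /h /fsub /fone eqxx andbT opprB addrC subrK.
  by case: i id => // i; rewrite subr0.
have IE j : (j <= d)%N -> Defs.finv f j [::] = (\sum_(k < d.+1) p ^+ k)`_j.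
  move=> jd; rewrite /Defs.finv /= addn0 coef_sum -(subnKC (_ : j.+1 <= d.+1)%N) //= .
  rewrite big_split_ord /= [X in _ + X]big1 ?addr0; last first.
    by move=> k _; rewrite coef_pow_small //; lia.
  by apply: eq_bigr => k _; rewrite (fpow_nil _ _ jd).
have -> : \sum_(k < d.+1) f k [::] * Defs.finv f (d - k)%N [::] = ((1 - p) * \sum_(k < d.+1) p ^+ k)`_d.
  rewrite -fE coefM; apply: eq_bigr => k _.
  by rewrite coef_trunc ?IE //; [exact: leq_subr|have := ltn_ord k; lia].
rewrite -opprB mulNr -subrX1 opprB coefB coef1 coef_pow_small // subr0.
by [].
Qed.

Lemma fpow_p0_one f k d n : (0 < n)%N -> fpow (fsub (fone K) (at_p0 f)) k d [:: n] = 0.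
Proof.
move=> n0; elim: k d => [|k IH] d; first by rewrite /fpow /= /fone andbF.
rewrite -[fpow _ k.+1]/(fmul _ (fpow _ k)) fmul_one // big1 // => j _.
by rewrite IH mulr0 addr0 /fsub /fone /at_p0 /= andbF subrr mul0r.
Qed.

Lemma finv_p0_one f d n : (0 < n)%N -> Defs.finv (at_p0 f) d [:: n] = 0.
Proof. by move=> n0; rewrite /Defs.finv big1 // => k _; rewrite fpow_p0_one. Qed.

(* The part of log (f / f(p = 0)) linear in p_n is the linear part of f divided by f(p = 0). *)
Lemma log_normalized_one f (w : nat -> K) n d : (0 < n)%N -> f 0%N [::] = 1 ->
    (forall e, f e [:: n] = \sum_(k < e.+1) w k * f (e - k)%N [::]) ->
  flog (fmul f (Defs.finv (at_p0 f))) d [:: n] = w d.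
Proof.
move=> n0 f0 fw; set g := at_p0 f; set h := fmul f (Defs.finv g).
have gE e : g e [::] = f e [::] by rewrite /g /at_p0 eqxx.
have h_nil e : h e [::] = (e == 0%N)%:R.
  by rewrite /h fmul_nil -(@finv_nil g e) ?gE //; apply: eq_bigr => k _; rewrite gE.
have h_one : h d [:: n] = w d.
  rewrite /h fmul_one //; under eq_bigr do rewrite finv_p0_one // mulr0 addr0 fw.
  pose I i := Defs.finv g i [::]; pose F i := f i [::].
  have -> : \sum_(k < d.+1) (\sum_(j < k.+1) w j * f (k - j)%N [::]) * Defs.finv g (d - k)%N [::] =
    (trunc d w * trunc d F * trunc d I)`_d.
    rewrite coefM; apply: eq_bigr => k _; have kd := ltn_ord k.
    by rewrite coef_truncM // coef_trunc ?leq_subr.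
  rewrite -mulrA coefM (bigD1 ord_max) //= big1 ?addr0 => [|k kd].
    rewrite subnn coef_trunc // coef_truncM // big_ord1 /F /I -gE.
    have E := @finv_nil g 0 (etrans (gE _) f0); rewrite big_ord1 in E.
    by rewrite -[RHS]mulr1; congr (_ * _); exact: E.
  have kd' : (k < d)%N.
    by rewrite ltn_neqAle -ltnS ltn_ord andbT; apply: contra_neq kd => E; apply: val_inj.
  rewrite coef_truncM ?leq_subr //.
  have := @finv_nil g (d - k)%N; rewrite gE => /(_ f0).
  rewrite (eq_bigr (fun j : 'I_(d - k).+1 => F j * I (d - k - j)%N)) => [->|j _]; last by rewrite gE.
  by rewrite (_ : (d - k == 0)%N = false) ?mulr0 //; lia.
(* The normalized series is 1 at p = 0, so q vanishes there and only its first power has a part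
   linear in p_n. *)
pose q := fsub (fone K) h.
have q_nil e : q e [::] = 0 by rewrite /q /fsub h_nil /fone eqxx andbT subrr.
have pow_nil k e : fpow q k.+1 e [::] = 0.
  rewrite -[fpow q k.+1]/(fmul q (fpow q k)) fmul_nil big1 // => j _.
  by rewrite q_nil mul0r.
rewrite /flog /= addn1 big_ltn // big_nat_cond big1 ?addr0 => [|k /andP[/andP[k1 _] _]]; last first.
  case: k k1 => [|[|k]] // _; rewrite -[fpow _ k.+2]/(fmul q (fpow q k.+1)) fmul_one // big1 ?mul0r // => j _.
  by rewrite pow_nil mulr0 q_nil mul0r addr0.
rewrite -[fpow _ 1]/(fmul q (fone K)) fmul_one // (bigD1 ord_max) //= big1 ?addr0 => [|k kd].
  rewrite subnn /fone /= ?andbF mulr0 addr0 mulr1 divr1 /q /fsub /fone ?andbF.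
  by rewrite sub0r opprK.
rewrite q_nil mul0r addr0 /fone eqxx andbT (_ : (d - k == 0)%N = false) ?mulr0 //.
have : (k : nat) != d by apply: contra_neq kd => E; apply: val_inj.
by have := ltn_ord k; lia.
Qed.
End FormalLinear.

(** * Evaluation of the one-point function *)

Section OnePoint.
Variable R : realType.
Local Notation C := R[i].
Local Notation ratfun := {fraction {poly R[i]}}.
Implicit Types (u : C) (mu nu : seq nat).

(* [k], for v = q^(1/2) *)
Definition qint (F : fieldType) (v : F) (k : nat) : F := v ^+ k - v ^- k.

(** Stated over any field, so that v is a complex number in computations and the rational function
    q^(1/2) in the result. For d > n the factor j = n is 0. *)
Definition one_point (F : fieldType) (v : F) (n d : nat) : F :=
  (qint v n)^-1 * \prod_(k < n.-1) (qint v (d + k).+1 / qint v k.+1) *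
  \prod_(j < d) (qint v (n - j) / qint v j.+1).

Lemma qint_neq0 u k : 1 < `|u| -> (0 < k)%N -> qint u k != 0.
Proof.
move=> u1; case: k => // k _; have u0 := norm1_neq0 u1.
have := expn_neq1 k u1; rewrite /qint subr_eq0; apply: contra_neq => E.
by rewrite exprVn -exprM mulnC exprM -exprVn expr2 -[in X in X * _]E mulfV // expf_neq0.
Qed.

(** Every difference of powers is, up to sign, a bracket times a power of u; the signs and the
    powers cancel. For d > n both sides are 0. *)
Lemma one_point_valE u n d : 1 < `|u| -> (0 < n)%N -> one_point_val u n d = one_point u n d.
Proof.
move=> u1; case: n => // n _; have u0 := norm1_neq0 u1; set t := u ^- 2.
have tE k : 1 - t ^+ k = u ^- k * qint u k.
  by rewrite /qint mulrBr mulVf ?expf_neq0 // -invfM -exprD addnn -mul2n exprVn exprM.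
have qE k : 1 - u ^+ 2 ^+ k = - (u ^+ k * qint u k).
  by rewrite /qint mulrBr mulfV ?expf_neq0 // -exprD addnn -mul2n exprM opprB.
rewrite /one_point_val /one_point /eps big_ord_recr /= -/t.
case: (leqP d n.+1) => dn; last first.
  rewrite [X in _ * X = _](bigD1 (Ordinal dn)) //= subrr mul0r mul0r mulr0.
  rewrite [X in _ = _ * X](bigD1 (Ordinal dn)) //= subnn /qint expr0 invr1 subrr !mul0r mulr0 //.
have -> : \prod_(j < d) ((u ^+ 2 ^+ j - u ^+ 2 ^+ n.+1) / (1 - u ^+ 2 ^+ j.+1)) =
   (u ^+ n) ^+ d * \prod_(j < d) (qint u (n.+1 - j) / qint u j.+1).
  rewrite -[in (u ^+ n) ^+ d](card_ord d) -prodr_const -big_split; apply: eq_bigr => j _ /=.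
  have jd := ltn_ord j; have q0 := qint_neq0 u1 (ltn0Sn j).
  have -> : u ^+ 2 ^+ j - u ^+ 2 ^+ n.+1 = - (u ^+ (n.+1 + j) * qint u (n.+1 - j)).
    rewrite [in RHS]/qint mulrBr opprB; congr (_ - _); last by rewrite -exprD -exprM; congr (_ ^+ _); lia.
    have -> : (n.+1 + j = 2 * j + (n.+1 - j))%N by lia.
    by rewrite exprD mulfK ?expf_neq0 // exprM.
  rewrite qE invrN mulrNN addSnnS exprD invfM; have := expf_neq0 j.+1 u0.
  by move=> ?; field; rewrite q0.
have -> : \prod_(k < n) (qint u (d + k).+1 / qint u k.+1) =
   (u ^+ d) ^+ n * (\prod_(k < n) (1 - t ^+ k.+1)^-1 * \prod_(k < n) (1 - t ^+ (d + k).+1)).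
  rewrite -big_split -[in (u ^+ d) ^+ n](card_ord n) -prodr_const -big_split; apply: eq_bigr => k _ /=.
  rewrite !tE; have q0 := qint_neq0 u1 (ltn0Sn k); have := expf_neq0 k.+1 u0; have := expf_neq0 d u0.
  by rewrite -addnS [u ^+ (d + _)]exprD => ? ?; field; rewrite q0; apply/and3P.
rewrite tE invfM invrK exprVn; have := qint_neq0 u1 (ltn0Sn n); have := expf_neq0 n.+1 u0.
by rewrite -!exprM [(d * n)%N]mulnC => ? ?; field; apply/andP.
Qed.

Lemma repN (w : ratfun) (f : C -> C) : rep w f -> rep (- w) (fun u => - f u).
Proof.
move=> [P [D [[D0 ->] H]]]; exists (- P), D; split; first by split=> //; rewrite tofracN mulNr.
by move=> u u1; have [d0 ->] := H u u1; rewrite hornerN mulNr.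
Qed.

Lemma rep_qint k : rep (qint (qhalf R) k) (fun u => qint u k).
Proof.
apply: repD; first exact: (rep_qhalf R k).
apply: repN; apply: (repV (f := fun u => u ^+ k)) => [u u1|]; first by rewrite expf_neq0 // norm1_neq0.
exact: (rep_qhalf R k).
Qed.

Lemma rep_one_point n d : (0 < n)%N -> rep (one_point (qhalf R) n d) (fun u => one_point u n d).
Proof.
move=> n0; have H k : rep (qint (qhalf R) k.+1)^-1 (fun u => (qint u k.+1)^-1).
  by apply: (repV (f := fun u => qint u k.+1)) => [u u1|]; [exact: qint_neq0|exact: rep_qint].
apply: repM; last by apply: rep_prod => j _; apply: repM; [exact: rep_qint|exact: H].
apply: repM; first by rewrite -(prednK n0); exact: H.
by apply: rep_prod => k _; apply: repM; [exact: rep_qint|exact: H].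
Qed.

Lemma rep_parts d (w : seq nat -> ratfun) (f : seq nat -> C -> C) :
  (forall nu, is_part nu -> sumn nu = d -> rep (w nu) (f nu)) ->
  rep (\sum_(nu \in parts d) w nu) (fun u => \sum_(nu \in parts d) f nu u).
Proof.
move=> H; rewrite (fsbig_parts _ (leqnn d)).
apply: (@rep_eq _ _ (fun u => \sum_(g : {ffun 'I_d -> 'I_(d + d)} | decreasing g && (\sum_j row_len g j == d)%N) f (part_of g) u)).
  by move=> u _; rewrite (fsbig_parts _ (leqnn d)).
apply: rep_sum => g /andP[dg /eqP gd]; apply: H; first exact: part_of_part.
by rewrite sumn_part_of.
Qed.

Lemma hook_ex mu : is_part mu -> (0 < sumn mu)%N -> (size mu + head 0 mu = (sumn mu).+1)%N ->
  exists2 b, (b < sumn mu)%N & mu = hook (sumn mu) b.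
Proof.
move=> hmu n0 E; have muE := hook_part hmu n0 E.
have sz : (0 < size mu)%N by rewrite muE.
have h0 : (0 < head 0 mu)%N.
  by case/andP: hmu => _; case: (mu) sz => //= h m _; rewrite inE negb_or lt0n eq_sym => /andP[].
exists (size mu).-1; first by lia.
by rewrite {1}muE /hook; congr cons; lia.
Qed.

Lemma parts_sum_hooks (V : nmodType) n (F : seq nat -> V) : (0 < n)%N ->
    (forall mu, is_part mu -> sumn mu = n -> (size mu + head 0 mu != n.+1)%N -> F mu = 0) ->
  \sum_(mu \in parts n) F mu = \sum_(b < n) F (hook n b).
Proof.
move=> n0 H; pose s := [seq hook n b | b <- iota 0 n].
have us : uniq s by rewrite map_inj_uniq ?iota_uniq // => i j /(congr1 size); rewrite /= !size_nseq => -[].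
have sP : [set` s] `<=` parts n.
  move=> mu /= /mapP[b]; rewrite mem_iota add0n => /= bn ->; split; first exact: is_part_hook.
  by rewrite /= sumn_nseq mul1n subnK // ltnW.
rewrite -(@fsbig_widen _ _ _ _ [set` s] (parts n)) //; last first.
  move=> mu [[hmu mun]] /= nmu; apply: H => //; apply/eqP => E; apply: nmu => /=.
  have [||b bn muE] := hook_ex hmu; rewrite ?mun //.
  by apply/mapP; rewrite mun in bn muE; exists b; rewrite // mem_iota.
rewrite -fsbig_seq // /s big_map -{1}[n]subn0 -/(index_iota 0 n) big_mkord.
by [].
Qed.

(** Coefficient of Q^d in the amplitude at p = 0. Only its constant term is computed; the rest
    cancels in the normalization. *)
Definition base_sum d u : C :=
  \sum_(nu \in parts d) schur nu (qpow [::] u) * schur (conj_part nu) (qpow [::] u).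

(** Both sides are limits of the same coefficient of [double_prod], one by the dual Cauchy identity
    and the other by adding the cells of mu. *)
Lemma framed_sum mu d u : is_part mu -> 1 < `|u| ->
  \sum_(nu \in parts d) schur nu (qpow mu u) * schur (conj_part nu) (qpow [::] u) =
  conv (content_poly mu u) (base_sum ^~ u) d.
Proof.
move=> hmu u1; have H1 := @double_prod_cvg R mu u d hmu u1.
have H0 : cvg_coef (double_prod (qpow [::] u) (qpow [::] u)) (base_sum ^~ u).
  by move=> k; exact: (@double_prod_cvg R [::] u k isT u1).
have H2 := @content_cvg R mu u _ u1 H0 d.
by rewrite -(cvgC_lim H1) -(cvgC_lim H2).
Qed.

Lemma schur_nil (x : nat -> C) : injective x -> schur [::] x = 1.
Proof.
move=> xi; apply: cvgC_lim; apply: (cvgC_eq (cvgC_cst _ 1)) => N.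
rewrite /schur_poly /= (_ : \matrix_(_, _) _ = \matrix_(i < N, j < N) x i ^+ (N - j.+1)).
  by rewrite divff // alternant_neq0.
by apply/matrixP => i j; rewrite !mxE nth_nil.
Qed.

Lemma parts0 : parts 0 = [set [::]].
Proof.
apply/seteqP; split => [mu [hmu]|mu ->] //=.
by case: mu hmu => // h m /andP[_]; rewrite inE negb_or => /andP[h0 _] /eqP; rewrite addn_eq0 => /andP[/eqP E]; rewrite E in h0.
Qed.

Lemma rep_Z_nil d : rep (Z R 0 d [::]) (base_sum d).
Proof.
rewrite /Z parts0 fsbig_set1; apply: rep_parts => nu hnu nud.
have E : schur [::] (qpow [::] (2 : C)) = 1 by apply: schur_nil; apply: qpow_inj; rewrite // normr_nat ltr1n.
have -> : qhalf R ^ (0 * kappa [::]) = 1 by rewrite mul0r expr0z.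
rewrite mul1r chi_nil expr0 mulr1 (_ : zpart [::] = 1%N) ?divr1 ?mulr1; last by rewrite /zpart /= big_nil.
apply: rep_eq (repM (rep_W R (isT : is_part [::]) hnu) (rep_W1 R (is_part_conj hnu))) => u u1.
by rewrite schur_nil ?mul1r //; apply: qpow_inj.
Qed.

Lemma base_sum0 u : 1 < `|u| -> base_sum 0 u = 1.
Proof.
move=> u1; rewrite /base_sum parts0 fsbig_set1.
by rewrite schur_nil ?mulr1 //; apply: qpow_inj.
Qed.

Definition one_point_free n d : ratfun := one_point (qhalf R) n d / (n%:R * iconst R).

Lemma rep_nat_i n : rep (n%:R * iconst R) (fun=> n%:R * 'i%C).
Proof.
have := rep_cst (n%:R * 'i%C : C); rewrite polyCM tofracM -/(iconst R); congr (rep (_ * _) _).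
by rewrite polyC_natr rmorph_nat.
Qed.

Lemma i_neq0 : ('i%C : C) != 0.
Proof.
apply/eqP => /(congr1 (fun z : C => z ^+ 2)).
by rewrite sqr_i expr0n /= => /eqP; rewrite oppr_eq0 oner_eq0.
Qed.

Lemma nat_i_neq0 n : (0 < n)%N -> n%:R * 'i%C != 0 :> C.
Proof. by move=> n0; rewrite mulf_neq0 ?i_neq0 // pnatr_eq0 -lt0n. Qed.

Lemma rep_one_point_free n d : (0 < n)%N ->
  rep (one_point_free n d) (fun u => one_point u n d / (n%:R * 'i%C)).
Proof.
move=> n0; apply: repM; first exact: rep_one_point.
apply: (repV (f := fun=> n%:R * 'i%C)); last exact: rep_nat_i.
by move=> u _; apply: nat_i_neq0.
Qed.

Lemma rep_Z_one n d : (0 < n)%N ->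
  rep (Z R 0 d [:: n]) (fun u => \sum_(mu \in parts n) \sum_(nu \in parts d)
     schur mu (qpow [::] u) * schur nu (qpow mu u) * schur (conj_part nu) (qpow [::] u) *
     ((chi mu [:: n])%:~R / (n%:R * 'i%C))).
Proof.
move=> n0; rewrite /Z (_ : sumn [:: n] = n); last by rewrite /= addn0.
apply: rep_parts => mu hmu mun; apply: rep_parts => nu hnu nud.
have -> : qhalf R ^ (0 * kappa mu) = 1 by rewrite mul0r expr0z.
rewrite mul1r; apply: repM; first by apply: repM; [exact: rep_W|apply: rep_W1; exact: is_part_conj].
apply: repM.
  by have := rep_cst ((chi mu [:: n])%:~R : C); rewrite -[X in tofrac X]/((polyC \o intmul 1) _) /= rmorph_int rmorph_int.
rewrite expr1 (_ : zpart [:: n] = n); last by rewrite /zpart /= big_seq1 /= eqxx expn1 muln1.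
apply: (repV (f := fun=> n%:R * 'i%C)); last exact: rep_nat_i.
by move=> u _; apply: nat_i_neq0.
Qed.

(** Puts the linear part into the form required by [log_normalized_one]: only hooks survive, each
    sum over nu is a content polynomial convolved with [base_sum], and the sum over the leg is
    [hook_val_sum]. *)
Lemma Z_one_sum n d u : (0 < n)%N -> 1 < `|u| ->
  \sum_(mu \in parts n) \sum_(nu \in parts d)
     schur mu (qpow [::] u) * schur nu (qpow mu u) * schur (conj_part nu) (qpow [::] u) *
     ((chi mu [:: n])%:~R / (n%:R * 'i%C)) =
  \sum_(k < d.+1) (one_point u n k / (n%:R * 'i%C)) * base_sum (d - k)%N u.
Proof.
move=> n0 u1.
pose F mu := schur mu (qpow [::] u) * ((chi mu [:: n])%:~R / (n%:R * 'i%C)) *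
  \sum_(nu \in parts d) schur nu (qpow mu u) * schur (conj_part nu) (qpow [::] u).
rewrite (eq_fsbigr F); last first.
  move=> mu _; rewrite /F !(fsbig_parts _ (leqnn d)) mulr_sumr; apply: eq_bigr => g _.
  have gen (a b c e : C) : a * b * c * e = a * e * (b * c) by ring.
  exact: gen.
rewrite parts_sum_hooks //; last first.
  move=> mu hmu mun ne; rewrite /F -mun chi_full_cycle ?mun // (negPf ne).
  have gen (a c e : C) : a * ((0 : int)%:~R / e) * c = 0 by rewrite mulr0z mul0r mulr0 mul0r.
  exact: gen.
rewrite (eq_bigr (fun b : 'I_n => \sum_(k < d.+1) hook_val u n b * (content_poly (hook n b) u)`_k * (base_sum (d - k)%N u / (n%:R * 'i%C)))).
  rewrite exchange_big; apply: eq_bigr => k _; rewrite -mulr_suml hook_val_sum // one_point_valE //.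
  have gen (a b c : C) : a * (b / c) = a / c * b by ring.
  exact: gen.
move=> b _; have bn := ltn_ord b; have hb := is_part_hook bn.
rewrite /F framed_sum // schur_hook //.
have sb : sumn (hook n b) = n by rewrite /= sumn_nseq mul1n subnK // ltnW.
have := @chi_full_cycle (hook n b) hb; rewrite sb /= size_nseq => ->//.
rewrite ifT; last by apply/eqP; lia.
rewrite rmorphXn rmorphN1 /conv mulr_sumr; apply: eq_bigr => k _.
(* The signs of the hook Schur function and of the hook character cancel. *)
have E : (-1) ^+ b * (-1) ^+ b = 1 :> C by rewrite -expr2 sqrr_sign.
have gen (s h c z e : C) : s * s = 1 -> s * h * (s / e) * (c * z) = h * c * (z / e).
  by move=> ss; transitivity (s * s * (h * c * (z / e))); [ring|rewrite ss mul1r].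
exact: gen.
Qed.

Lemma Fone_value n d : (0 < n)%N -> Fone R 0 n d = one_point_free n d.
Proof.
move=> n0; rewrite /Fone /Ffree /Zhat; apply: (log_normalized_one (w := one_point_free n)) => // [|e].
  apply: rep_unique (rep_Z_nil 0) (rep_cst 1) _ => u u1; exact: base_sum0.
have H : rep (\sum_(k < e.+1) one_point_free n k * Z R 0 (e - k)%N [::])
   (fun u => \sum_(k < e.+1) (one_point u n k / (n%:R * 'i%C)) * base_sum (e - k)%N u).
  by apply: rep_sum => k _; apply: repM; [exact: rep_one_point_free|exact: rep_Z_nil].
by apply: rep_unique (rep_Z_one e n0) H _ => u u1; apply: Z_one_sum.
Qed.
End OnePoint.

(** * Genus expansion *)

Section GenusExpansion.
Variable R : realType.
Local Notation C := R[i].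
Local Notation ratfun := {fraction {poly R[i]}}.
Implicit Types (P D p q : {poly C}) (c r s : nat -> C).

(** Congruence modulo X^M: series in lambda are compared through their polynomial truncations. *)
Definition eqm M p q := forall m, (m < M)%N -> p`_m = q`_m.

Lemma eqm_refl M p : eqm M p p. Proof. by []. Qed.
Lemma eqm_sym M p q : eqm M p q -> eqm M q p. Proof. by move=> H m mM; rewrite H. Qed.
Lemma eqm_trans M p q p' : eqm M p q -> eqm M q p' -> eqm M p p'.
Proof. by move=> H H' m mM; rewrite H // H'. Qed.

Lemma eqmM M p p' q q' : eqm M p p' -> eqm M q q' -> eqm M (p * q) (p' * q').
Proof.
move=> H H' m mM; rewrite !coefM; apply: eq_bigr => j _; have := ltn_ord j => jm.
by rewrite H ?H' //; lia.
Qed.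

Lemma eqm_comp2 M p q : eqm M p q -> eqm M (p \Po 'X^2) (q \Po 'X^2).
Proof.
move=> H m mM; rewrite !coef_comp_poly_Xn //; case: ifP => // _; apply: H.
by apply: leq_ltn_trans mM; apply: leq_div.
Qed.

(* Truncations of the power series P(e^(i lambda/2)) *)
Definition ser M P : {poly C} := trunc M (lcoef P).

Lemma coef_ser M P m : (m < M)%N -> (ser M P)`_m = lcoef P m.
Proof. by move=> mM; rewrite coef_trunc // ltnW. Qed.

Lemma lcoef_wide P N m : (size P <= N)%N -> lcoef P m = \sum_(k < N) P`_k * ('i%C * k%:R / 2) ^+ m / m`!%:R.
Proof.
move=> sN; rewrite /lcoef (big_ord_widen _ (fun k => P`_k * ('i%C * k%:R / 2) ^+ m / m`!%:R) sN).
rewrite big_mkcond; apply: eq_bigr => k _; case: ltnP => // sk.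
by rewrite nth_default // mul0r mul0r.
Qed.

Lemma lcoefD P D m : lcoef (P + D) m = lcoef P m + lcoef D m.
Proof.
pose N := maxn (size P) (size D).
rewrite !(@lcoef_wide _ N) ?leq_maxl ?leq_maxr //; last exact: size_polyD.
by rewrite -big_split; apply: eq_bigr => k _ /=; rewrite coefD !mulrDl.
Qed.

Lemma lcoefZ (a : C) P m : lcoef (a *: P) m = a * lcoef P m.
Proof.
rewrite (@lcoef_wide _ (size P)) ?size_scale_leq // mulr_sumr.
by apply: eq_bigr => k _; rewrite coefZ !mulrA.
Qed.

Lemma lcoef_Xn k m : lcoef ('X^k : {poly C}) m = ('i%C * k%:R / 2) ^+ m / m`!%:R.
Proof.
rewrite /lcoef size_polyXn big_ord_recr /= coefXn eqxx mul1r big1 ?add0r // => j _.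
by rewrite coefXn ltn_eqF // mul0r mul0r.
Qed.

Lemma fact_neq0 m : (m`!%:R : C) != 0.
Proof. by rewrite pnatr_eq0 -lt0n fact_gt0. Qed.

Lemma exp_conv (a b : C) m :
  (a + b) ^+ m / m`!%:R = \sum_(j < m.+1) (a ^+ j / j`!%:R) * (b ^+ (m - j) / (m - j)`!%:R).
Proof.
rewrite exprDn_comm ?mulr_suml; last exact: mulrC.
rewrite (reindex_inj rev_ord_inj) /=; apply: eq_bigr => j _; have jm := ltn_ord j.
rewrite subSS subKn // -mulr_natr -(bin_fact (_ : j <= m)%N) // !natrM bin_sub //.
have := fact_neq0 j; have := fact_neq0 (m - j); have : 'C(m, j)%:R != 0 :> C by rewrite pnatr_eq0 -lt0n bin_gt0.
move: ('C(m, j)%:R) (j`!%:R) ((m - j)`!%:R) => x y z x0 z0 y0; field; by rewrite x0 y0 z0.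
Qed.

Lemma lcoefM P D m : lcoef (P * D) m = \sum_(j < m.+1) lcoef P j * lcoef D (m - j)%N.
Proof.
have lin1 (I : Type) (rr : seq I) (F : I -> {poly C}) k : lcoef (\sum_(i <- rr) F i) k = \sum_(i <- rr) lcoef (F i) k.
  elim: rr => [|i rr IH]; last by rewrite !big_cons lcoefD IH.
  by rewrite !big_nil /lcoef size_poly0 big_ord0.
rewrite -{1}[P]coefK -{1}[D]coefK !poly_def mulr_suml lin1.
transitivity (\sum_(k < size P) \sum_(l < size D) P`_k * D`_l * lcoef ('X^(k + l) : {poly C}) m).
  apply: eq_bigr => k _; rewrite mulr_sumr lin1; apply: eq_bigr => l _.
  by rewrite -scalerAl -scalerAr -exprD scalerA lcoefZ.
transitivity (\sum_(k < size P) \sum_(l < size D) \sum_(j < m.+1) (P`_k * lcoef ('X^k : {poly C}) j) * (D`_l * lcoef ('X^l : {poly C}) (m - j))).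
  apply: eq_bigr => k _; apply: eq_bigr => l _.
  rewrite lcoef_Xn natrD mulrDr mulrDl exp_conv mulr_sumr; apply: eq_bigr => j _.
  by rewrite !lcoef_Xn mulrACA.
under eq_bigr do rewrite exchange_big /=.
rewrite exchange_big; apply: eq_bigr => j _ /=.
rewrite [lcoef P j]/lcoef [RHS]mulr_suml; apply: eq_bigr => k _; rewrite [lcoef D _]/lcoef [RHS]mulr_sumr.
by apply: eq_bigr => l _; rewrite !lcoef_Xn !mulrA.
Qed.

Lemma serM M P D : eqm M (ser M (P * D)) (ser M P * ser M D).
Proof.
move=> m mM; rewrite coef_ser // lcoefM coefM; apply: eq_bigr => j _; have jm := ltn_ord j.
by rewrite !coef_ser //; lia.
Qed.

(** The substitution q^(1/2) = e^(i lambda/2) is injective on polynomials: if all coefficients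
    vanish, the sum of D_k k^m is 0 for every m, hence also the sum of D_k f(k) for every polynomial
    f. *)
Lemma lcoef_eq0 D : (forall m, lcoef D m = 0) -> D = 0.
Proof.
move=> H; apply/polyP => k0; rewrite coef0.
case: (ltnP k0 (size D)) => k0D; last by rewrite nth_default.
have H1 (f : {poly C}) : \sum_(k < size D) D`_k * f.[k%:R] = 0.
  under eq_bigr do rewrite horner_coef mulr_sumr.
  rewrite exchange_big big1 // => m _.
  have z0 : ('i%C / 2 : C) ^+ m / m`!%:R != 0.
    by rewrite mulf_neq0 ?expf_neq0 ?invr_eq0 ?fact_neq0 // mulf_neq0 ?i_neq0 // invr_eq0 pnatr_eq0.
  apply: (mulfI z0); rewrite mulr0; transitivity (f`_m * lcoef D m); last by rewrite H mulr0.
  rewrite /lcoef !mulr_sumr; apply: eq_bigr => k _.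
  have -> : 'i%C * k%:R / 2 = 'i%C / 2 * k%:R :> C by rewrite mulrAC.
  rewrite (exprMn _ ('i%C / 2)); move: (('i%C / 2) ^+ m) (k%:R ^+ m) (m`!%:R^-1) (D`_k) (f`_m) => x y u v w.
  by ring.
(* Vanishing at every k < [size D] other than k0, this polynomial isolates the coefficient at k0. *)
pose f : {poly C} := \prod_(j < size D | j != k0 :> nat) ('X - (j%:R)%:P).
have := H1 f; rewrite (bigD1 (Ordinal k0D)) //= big1 ?addr0 => [/eqP|k kk0].
  rewrite mulf_eq0 => /orP[/eqP //|]; rewrite /f horner_prod => /eqP H2.
  exfalso; move/eqP: H2; apply/negP/prodf_neq0 => j jk; rewrite hornerXsubC subr_eq0 eqr_nat.
  by rewrite eq_sym.
have kk : (k : nat) != k0 by apply: contra_neq kk0 => E; apply: val_inj.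
by rewrite /f horner_prod (bigD1 k) //= hornerXsubC subrr mul0r mulr0.
Qed.

Definition cauchy_prod (r s : nat -> C) : nat -> C := fun g => \sum_(k < g.+1) r k * s (g - k)%N.

Definition even M r : {poly C} := trunc M r \Po 'X^2.

Lemma even_conv M r s : eqm M (even M (cauchy_prod r s)) (even M r * even M s).
Proof.
rewrite -comp_polyM; apply: eqm_comp2 => m mM.
by rewrite coef_truncM ?coef_trunc // ltnW.
Qed.

Lemma evenZ M (a : C) r : even M (fun g => a * r g) = a *: even M r.
Proof.
rewrite /even -comp_polyZ; congr (_ \Po _); apply/polyP => m.
by rewrite coefZ !coef_poly; case: ifP => // _; rewrite mulr0.
Qed.

Lemma coef_evenM M r P m : (m < M)%N ->
  (even M r * ser M P)`_m = \sum_(g < m.+1 | (g.*2 <= m)%N) r g * lcoef P (m - g.*2).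
Proof.
move=> mM; rewrite coefM.
transitivity (\sum_(j < m.+1) \sum_(g < m.+1) (if (j : nat) == g.*2 then r g * lcoef P (m - g.*2) else 0)).
  apply: eq_bigr => j _; have jm := ltn_ord j; rewrite coef_comp_poly_Xn // coef_ser; last by lia.
  case: ifP => j2; last first.
    rewrite mul0r big1 // => g _; case: eqP => // jg; move: j2; rewrite jg dvdn2 odd_double //.
  have hj : (j %/ 2 < m.+1)%N by apply: leq_ltn_trans jm; apply: leq_div.
  rewrite (bigD1 (Ordinal hj)) //= big1 => [|g gj]; last first.
    case: eqP => // jg; case/eqP: gj; apply: val_inj => /=; rewrite jg; lia.
  have -> : (j %/ 2).*2 = j :> nat by rewrite -muln2 divnK.
  by rewrite eqxx addr0 coef_trunc //; lia.
rewrite exchange_big [RHS]big_mkcond; apply: eq_bigr => g _ /=.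
case: ifP => gm; last first.
  by rewrite big1 // => j _; case: eqP => // jg; have := ltn_ord j; lia.
rewrite (bigD1 (Ordinal (gm : (g.*2 < m.+1)%N))) //= eqxx big1 ?addr0 // => j jg.
by case: eqP => // E; case/eqP: jg; apply: val_inj.
Qed.

Lemma coef_even_low r P v : (forall k, (k < v)%N -> lcoef P k = 0) ->
  (even v.+1 r * ser v.+1 P)`_v = r 0%N * lcoef P v.
Proof.
move=> low; rewrite coef_evenM // (bigD1 ord0) //= subn0 big1 ?addr0 // => g /andP[g2 g0].
rewrite low ?mulr0 //; have : (g : nat) != 0%N by apply: contra_neq g0 => ?; apply: val_inj.
by lia.
Qed.

Lemma genus_expansionP w c : genus_expansion w c <->
  exists P D, is_frac w P D /\ forall M, eqm M ('X * ser M P) (even M c * ser M D).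
Proof.
split=> -[P [D [wPD H]]]; exists P, D; split=> //; first move=> M m mM; last move=> m.
  by rewrite coef_evenM // -H coefXM; case: m mM => //= m mM; rewrite coef_ser //; lia.
have := H m.+1 m (ltnSn m); rewrite coef_evenM // => <-; rewrite coefXM; case: m => //= m.
by rewrite coef_ser //; lia.
Qed.

(** [Fcoef] takes some expansion, so its genus 0 term must be shown unique. After clearing
    denominators both series multiply [D * D'], and they are compared at the lowest nonzero
    coefficient of this product, which exists by [lcoef_eq0]. *)
Lemma genus_expansion_head w c c' : genus_expansion w c -> genus_expansion w c' -> c 0%N = c' 0%N.
Proof.
move=> /genus_expansionP[P [D [[D0 ->] H]]] /genus_expansionP[P' [D' [[D'0 /eqP E] H']]].
have {}E : P * D' = P' * D.
  by apply/eqP; move: E; rewrite eqr_div ?tofrac_eq0 // -!tofracM tofrac_eq => /eqP ->.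
have DD0 : D * D' != 0 by rewrite mulf_neq0.
have [m Hm] : exists m, lcoef (D * D') m != 0.
  apply: contrapT => Hn; move/eqP: DD0; apply; apply: lcoef_eq0 => m.
  by apply/eqP/negPn/negP => Hm; apply: Hn; exists m.
have [v v0 vmin] := @ex_minnP (fun m => lcoef (D * D') m != 0) (ex_intro _ m Hm).
have HH : eqm v.+1 (even v.+1 c * ser v.+1 (D * D')) (even v.+1 c' * ser v.+1 (D * D')).
  apply: eqm_trans (_ : eqm v.+1 _ (even v.+1 c * (ser v.+1 D * ser v.+1 D'))) _.
    by apply: eqmM; [exact: eqm_refl|exact: serM].
  rewrite mulrA; apply: eqm_trans (eqmM (eqm_sym (H _)) (@eqm_refl _ (ser v.+1 D'))) _.
  rewrite -mulrA; apply: eqm_trans (eqmM (@eqm_refl _ 'X) (eqm_sym (@serM _ P D'))) _.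
  rewrite E; apply: eqm_trans (eqmM (@eqm_refl _ 'X) (@serM _ P' D)) _.
  rewrite mulrA; apply: eqm_trans (eqmM (H' _) (@eqm_refl _ (ser v.+1 D))) _.
  rewrite -mulrA; apply: eqmM; first exact: eqm_refl.
  by rewrite mulrC; apply: eqm_sym; exact: serM.
have low k : (k < v)%N -> lcoef (D * D') k = 0.
  by move=> kv; apply/eqP/negPn/negP => /vmin; rewrite leqNgt kv.
by have := HH v (ltnSn v); rewrite (coef_even_low _ low) (coef_even_low _ low) => /(mulIf v0).
Qed.

(** Unlike [genus_expansion], no factor lambda^-1: ratios of brackets are power series in lambda^2,
    a class closed under products. *)
Definition evexp w r := exists P D, is_frac w P D /\ forall M, eqm M (ser M P) (even M r * ser M D).

Lemma evexpM w w' r s : evexp w r -> evexp w' s -> evexp (w * w') (cauchy_prod r s).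
Proof.
move=> [P [D [[D0 ->] H]]] [P' [D' [[D'0 ->] H']]]; exists (P * P'), (D * D'); split.
  by split; rewrite ?mulf_neq0 // mulf_div !tofracM.
move=> M; apply: eqm_trans (@serM _ _ _) _; apply: eqm_trans (eqmM (H M) (H' M)) _.
rewrite mulrACA; apply: eqm_sym; apply: eqmM; [exact: even_conv|exact: serM].
Qed.

Lemma lcoef1 m : lcoef (1 : {poly C}) m = (m == 0%N)%:R.
Proof.
rewrite -(expr0 'X) lcoef_Xn mulr0 mul0r; case: m => [|m]; first by rewrite expr0 fact0 divr1.
by rewrite expr0n mul0r.
Qed.

Lemma ser1 M : ser M 1 = 1.
Proof.
apply/polyP => m; rewrite coef_poly coef1; case: ltnP => mM; first by rewrite lcoef1.
by case: m mM.
Qed.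

Definition edelta : nat -> C := fun g => (g == 0%N)%:R.

Lemma even_delta M : even M edelta = 1.
Proof.
rewrite /even (_ : trunc M edelta = 1) ?comp_polyC //; apply/polyP => m; rewrite coef_poly coef1.
by case: ltnP => // mM; case: m mM.
Qed.

Lemma evexp1 : evexp 1 edelta.
Proof.
exists 1, 1; split; first by split; rewrite ?oner_neq0 // tofrac1 divr1.
by move=> M; rewrite ser1 even_delta mulr1; exact: eqm_refl.
Qed.

Lemma evexp_prod m (w : nat -> ratfun) (h : nat -> C) :
  (forall k, (k < m)%N -> exists2 r, evexp (w k) r & r 0%N = h k) ->
  exists2 r, evexp (\prod_(k < m) w k) r & r 0%N = \prod_(k < m) h k.
Proof.
elim: m => [|m IH] H; first by exists edelta; rewrite ?big_ord0; [exact: evexp1|].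
have [r rm r0] := IH (fun k km => H k (ltnW km)); have [s sm s0] := H m (ltnSn m).
exists (cauchy_prod r s); first by rewrite big_ord_recr; apply: evexpM.
by rewrite /cauchy_prod big_ord1 subnn r0 s0 big_ord_recr.
Qed.

(* [k] = i k lambda sum_g (qser k g) lambda^(2g) *)
Definition qser (a : nat) (g : nat) : C := (-1) ^+ g * (a%:R / 2) ^+ g.*2 / (g.*2.+1)`!%:R.

(** e^(i a lambda) - 1 = e^(i a lambda/2) 2i sin(a lambda/2), and 2 sin(a lambda/2) is a lambda
    times the even series [qser a]. *)
Lemma ser_qint M a : eqm M (ser M ('X^(2 * a) - 1))
  (('i%C * a%:R) *: ('X * (even M (qser a) * ser M 'X^a))).
Proof.
move=> m mM; rewrite coef_ser // coefZ coefXM.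
pose z : C := 'i%C * a%:R / 2; pose x j := z ^+ j / j`!%:R - (- z) ^+ j / j`!%:R.
have -> : lcoef ('X^(2 * a) - 1) m = \sum_(j < m.+1) x j * lcoef ('X^a : {poly C}) (m - j).
  rewrite -[- 1]scaleN1r lcoefD lcoefZ lcoef_Xn lcoef1.
  under eq_bigr do rewrite lcoef_Xn mulrBl.
  rewrite sumrB -!exp_conv -/z addNr.
  have -> : 'i%C * (2 * a)%:R / 2 = z + z :> C.
    by rewrite /z natrM; field.
  congr (_ + _); case: m {mM} => [|m]; first by rewrite expr0 fact0 divr1 mulr1.
  by rewrite expr0n mul0r mulr0 oppr0.
have xE j : x j = if odd j then 'i%C * a%:R * qser a j./2 else 0.
  rewrite /x exprNn -signr_odd -{1 2 4 5}(odd_double_half j); case: (odd j); last by rewrite mul1r subrr.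
  rewrite add1n expr1 mulN1r mulNr opprK /qser exprS.
  have -> : z ^+ (j./2).*2 = (-1) ^+ j./2 * (a%:R / 2) ^+ (j./2).*2.
    by rewrite /z -mulrA exprMn -mul2n [in LHS]exprM sqr_i.
  rewrite /z; have := fact_neq0 (j./2).*2.+1; move: (_ ^+ j./2) (_ ^+ _.*2) (_`!%:R) => A B D D0.
  by field.
rewrite big_ord_recl xE mul0r add0r; case: m mM => [|m] mM /=; first by rewrite big_ord0 mulr0.
rewrite coefM mulr_sumr; apply: eq_bigr => j _; have jm := ltn_ord j.
rewrite coef_ser ?lcoef_Xn; last by lia.
rewrite coef_comp_poly_Xn // xE /bump /= add1n subSS dvdn2 /=; case: (boolP (odd j)) => jo /=.
  by rewrite !mul0r mulr0.
rewrite coef_trunc; last by lia.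
rewrite -mulrA; congr (_ * (_ * _)); congr (qser a _); lia.
Qed.

(** Reciprocal of [qser b], obtained from the inverse of formal series by letting Q stand for
    lambda^2 and ignoring p. *)
Definition qinv (b : nat) : nat -> C := fun g => Defs.finv (fun d _ => qser b d) g [::].

Lemma qser0 b : qser b 0 = 1.
Proof. by rewrite /qser expr0 mul1r expr0 divr1. Qed.

Lemma conv_qinv b : cauchy_prod (qser b) (qinv b) = edelta.
Proof.
apply: funext => g; rewrite /cauchy_prod /qinv.
by rewrite (@finv_nil _ (fun d _ => qser b d)) // qser0.
Qed.

Lemma qinv0 b : qinv b 0 = 1.
Proof.
by have := congr1 (@^~ 0%N) (conv_qinv b); rewrite /cauchy_prod big_ord1 qser0 mul1r.
Qed.

Lemma even_qinv M b : eqm M (even M (qinv b) * even M (qser b)) 1.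
Proof. by rewrite mulrC -(even_delta M) -(conv_qinv b); apply: eqm_sym; exact: even_conv. Qed.

Lemma polyXn1_neq0 b : (0 < b)%N -> 'X^(2 * b) - 1 != 0 :> {poly C}.
Proof. by move=> b0; apply: monic_neq0; apply: monicXnsubC; lia. Qed.

Lemma qint_frac b : qint (qhalf R) b = tofrac ('X^(2 * b) - 1) / tofrac 'X^b.
Proof.
have X0 : tofrac 'X^b != 0 :> ratfun by rewrite tofrac_eq0 monic_neq0 ?monicXn.
by rewrite /qint /qhalf tofracB tofrac1 mulrBl mul1r mul2n -addnn exprD tofracM mulfK // tofracXn.
Qed.

(** The factors lambda of numerator and denominator cancel, which leaves a / b as leading term. *)
Lemma evexp_ratio a b : (0 < b)%N ->
  exists2 r, evexp (qint (qhalf R) a / qint (qhalf R) b) r & r 0%N = a%:R / b%:R.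
Proof.
move=> b0; exists (fun g => (a%:R / b%:R) * cauchy_prod (qser a) (qinv b) g); last first.
  by rewrite /cauchy_prod big_ord1 qser0 qinv0 !mulr1.
exists (('X^(2 * a) - 1) * 'X^b), (('X^(2 * b) - 1) * 'X^a); split.
  split; first by rewrite mulf_neq0 ?polyXn1_neq0 // monic_neq0 ?monicXn.
  by rewrite !qint_frac invf_div mulf_div -!tofracM [X in _ / tofrac X]mulrC.
move=> M; apply: eqm_trans (@serM _ _ _) _.
apply: eqm_trans (eqmM (@ser_qint _ _) (@eqm_refl _ _)) _; rewrite evenZ.
apply: eqm_sym; apply: eqm_trans (eqmM (@eqm_refl _ _) (@serM _ _ _)) _.
apply: eqm_trans (eqmM (@eqm_refl _ _) (eqmM (@ser_qint _ _) (@eqm_refl _ _))) _.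
rewrite -!mul_polyC; set A := even M (qser a); set X := 'X; set sa := ser M 'X^a; set sb := ser M 'X^b.
have cE : (a%:R / b%:R)%:P * ('i%C * b%:R)%:P = ('i%C * a%:R)%:P :> {poly C}.
  rewrite -polyCM; congr (_%:P); have : (b%:R : C) != 0 by rewrite pnatr_eq0 -lt0n.
  by move=> bb; field.
apply: eqm_trans (_ : eqm M _ ((a%:R / b%:R)%:P * (A * even M (qinv b)) * (('i%C * b%:R)%:P * (X * (even M (qser b) * sb)) * sa))) _.
  apply: eqmM (@eqm_refl _ _); apply: eqmM (@eqm_refl _ _) _; exact: even_conv.
have gen (T : comNzRingType) (k l h x y z u v w : T) :
    k * l = h -> k * (x * y) * (l * (z * (u * v)) * w) = h * (z * (x * w)) * v * (y * u).
  by move=> <-; ring.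
rewrite (gen _ _ _ _ _ _ _ _ _ _ cE) -[X in eqm M _ X]mulr1.
by apply: eqmM; [exact: eqm_refl|exact: even_qinv].
Qed.

(** The products of ratios have no pole. The remaining 1/[n] starts with 1/(i n lambda), and the
    factor 1/(n i) of the amplitude turns it into -1/(n^2 lambda). *)
Lemma genus_expansion_free n d : (0 < n)%N -> exists2 c, genus_expansion (one_point_free R n d) c &
  c 0%N = - (n%:R ^+ 2)^-1 * (\prod_(k < n.-1) ((d + k).+1%:R / k.+1%:R) * \prod_(j < d) ((n - j)%:R / j.+1%:R)).
Proof.
move=> n0.
have [r1 H1 r10] := @evexp_prod n.-1 (fun k => qint (qhalf R) (d + k).+1 / qint (qhalf R) k.+1) _
  (fun k _ => @evexp_ratio (d + k).+1 k.+1 isT).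
have [r2 H2 r20] := @evexp_prod d (fun j => qint (qhalf R) (n - j) / qint (qhalf R) j.+1) _
  (fun j _ => @evexp_ratio (n - j) j.+1 isT).
have [P [D [[D0 wE] H]]] := evexpM H1 H2.
have nn : (n%:R : C) != 0 by rewrite pnatr_eq0 -lt0n.
have ni0 : (n%:R * 'i%C : C) != 0 by rewrite mulf_neq0 ?i_neq0.
exists (fun g => - (n%:R ^+ 2)^-1 * cauchy_prod (cauchy_prod r1 r2) (qinv n) g); last first.
  by rewrite /cauchy_prod !big_ord1 /= qinv0 mulr1 r10 r20.
apply/genus_expansionP; exists ('X^n * P), (('X^(2 * n) - 1) * D * (n%:R * 'i%C)%:P); split.
  split; first by rewrite !mulf_neq0 ?polyXn1_neq0 // polyC_eq0.
  rewrite /one_point_free /one_point -mulrA wE qint_frac invf_div mulf_div.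
  have -> : n%:R * iconst R = tofrac (n%:R * 'i%C)%:P by rewrite polyCM tofracM polyC_natr tofracMn tofrac1.
  by rewrite -!mulrA -invfM !tofracM !mulrA.
move=> M; apply: eqm_trans (eqmM (@eqm_refl _ _) (@serM _ _ _)) _.
apply: eqm_trans (eqmM (@eqm_refl _ _) (eqmM (@eqm_refl _ _) (H M))) _.
apply: eqm_sym; rewrite evenZ.
have cE : ser M (n%:R * 'i%C)%:P = (n%:R * 'i%C)%:P.
  apply/polyP => m; rewrite coef_poly -[(_ * _)%:P]mulr1 mul_polyC lcoefZ lcoef1 coefZ coef1.
  by case: ltnP => // mM; rewrite gtn_eqF ?mulr0 //; lia.
have HD : eqm M (ser M (('X^(2 * n) - 1) * D * (n%:R * 'i%C)%:P))
    ((('i%C * n%:R) *: ('X * (even M (qser n) * ser M 'X^n))) * ser M D * (n%:R * 'i%C)%:P).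
  apply: eqm_trans (@serM M (('X^(2 * n) - 1) * D) (n%:R * 'i%C)%:P) _; rewrite cE.
  apply: eqmM (@eqm_refl M _); apply: eqm_trans (@serM M ('X^(2 * n) - 1) D) _.
  by apply: eqmM (@eqm_refl M _); exact: ser_qint.
apply: eqm_trans (eqmM (@eqm_refl M _) HD) _.
rewrite -!mul_polyC; set E := even M (cauchy_prod r1 r2); set X := 'X; set sn := ser M 'X^n; set sD := ser M D.
apply: eqm_trans (_ : eqm M _ ((- (n%:R ^+ 2)^-1)%:P * (E * even M (qinv n)) * (('i%C * n%:R)%:P * (X * (even M (qser n) * sn)) * sD * (n%:R * 'i%C)%:P))) _.
  apply: eqmM (@eqm_refl _ _); apply: eqmM (@eqm_refl _ _) _; exact: even_conv.
have kE : (- (n%:R ^+ 2)^-1)%:P * ('i%C * n%:R)%:P * (n%:R * 'i%C)%:P = 1 :> {poly C}.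
  rewrite -!polyCM (_ : _ * _ = 1) //.
  have := sqr_i R; move: ('i%C : C) => z zz.
  have -> : - (n%:R ^+ 2)^-1 * (z * n%:R) * (n%:R * z) = - (z ^+ 2) :> C by field.
  by rewrite zz opprK.
have gen (T : comNzRingType) (k l h x y z u v w : T) :
    k * l * h = 1 -> k * (x * y) * (l * (z * (u * v)) * w * h) = z * (v * (x * w)) * (y * u).
  by move=> E1; transitivity (k * l * h * (z * (v * (x * w)) * (y * u))); [ring|rewrite E1 mul1r].
rewrite (gen _ _ _ _ _ _ _ _ _ _ kE) -[X in eqm M _ X]mulr1.
by apply: eqmM; [exact: eqm_refl|exact: even_qinv].
Qed.

Lemma Fcoef_value n d : (0 < n)%N ->
  Fcoef R 0 0 n d = - (n%:R ^+ 2)^-1 * ('C(n.-1 + d, d) * 'C(n, d))%:R.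
Proof.
move=> n0; have [c gc c0] := genus_expansion_free d n0.
rewrite /Fcoef; case: xgetP => [c' _ /=|/(_ c)]; rewrite Fone_value //.
move/genus_expansion_head/(_ gc) ->; rewrite c0; congr (_ * _).
rewrite natrM; congr (_ * _).
  elim: n.-1 => [|m IH]; first by rewrite big_ord0 add0n binn.
  rewrite big_ord_recr /= IH; apply: (mulIf (_ : (m.+1%:R : C) != 0)); first by rewrite pnatr_eq0.
  rewrite -mulrA mulfVK ?pnatr_eq0 // -!natrM; congr (_%:R).
  by have := mul_bin_down (m.+1 + d) d; rewrite addnK /= addSn addnC => E; rewrite mulnC E mulnC addnC.
elim: d {c gc c0} => [|m IH]; first by rewrite big_ord0 bin0.
rewrite big_ord_recr /= IH; apply: (mulIf (_ : (m.+1%:R : C) != 0)); first by rewrite pnatr_eq0.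
by rewrite -mulrA mulfVK ?pnatr_eq0 // -!natrM; congr (_%:R); rewrite mulnC -mul_bin_left mulnC.
Qed.
End GenusExpansion.

(** * Legendre polynomials *)

Section Legendre.
Variable R : realType.
Local Notation C := R[i].
Variable Q : C.

Definition leg_coef (n d : nat) : nat := 'C(n, d) * 'C(n + d, d).

(* P_n(1 + 2 Q), for P_n the n-th Legendre polynomial *)
Definition leg (n : nat) : C := \sum_(d < n.+1) (leg_coef n d)%:R * Q ^+ d.

Lemma leg_coef_small n d : (n < d)%N -> leg_coef n d = 0%N.
Proof. by move=> nd; rewrite /leg_coef bin_small. Qed.

Lemma leg_coefn0 n : leg_coef n 0 = 1%N.
Proof. by rewrite /leg_coef !bin0. Qed.

Lemma leg_coefS n d : ((n.+1 - d) * leg_coef n.+1 d = (n.+1 + d) * leg_coef n d)%N.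
Proof.
apply/eqP; rewrite -(eqn_pmul2l (ltn0Sn n)); apply/eqP.
have E1 := mul_bin_down n.+1 d; have := mul_bin_down (n.+1 + d) d; rewrite addnK /= addSn /= => E2.
rewrite /leg_coef addSn; transitivity ((n.+1 - d) * 'C(n.+1, d) * (n.+1 * 'C((n + d).+1, d)))%N; first by ring.
by rewrite -E1 -E2 /=; ring.
Qed.

Lemma leg_coefSr n e : (e.+1 ^ 2 * leg_coef n e.+1 = (n + e.+1) * (n - e) * leg_coef n e)%N.
Proof.
have E1 := mul_bin_left n e; have := mul_bin_diag (n + e).+1 e; rewrite /= => E2.
rewrite /leg_coef addnS; transitivity (e.+1 * 'C(n, e.+1) * (e.+1 * 'C((n + e).+1, e.+1)))%N; first by ring.
by rewrite E1 -E2; ring.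
Qed.

(** For e <= m all coefficients are rational multiples of [leg_coef m.+1 e.+1] by the ratios
    [leg_coefS] and [leg_coefSr]. The case e = m + 1 is separate, since that coefficient is then
    0. *)
Lemma leg_coef_rec m e : ((m.+2 * leg_coef m.+2 e.+1)%:R : C) =
  (2 * m + 3)%:R * ((leg_coef m.+1 e.+1)%:R + 2 * (leg_coef m.+1 e)%:R) - (m.+1 * leg_coef m e.+1)%:R.
Proof.
case: (leqP e m) => em.
  have [k mE] : exists k, m = (e + k)%N by exists (m - e)%N; rewrite subnKC.
  subst m; have r1 := leg_coefS (e + k).+1 e.+1; have r2 := leg_coefS (e + k) e.+1; have r3 := leg_coefSr (e + k).+1 e.
  move: r1 r2 r3; rewrite (_ : (e + k).+2 - e.+1 = k.+1)%N 1?(_ : (e + k).+1 - e.+1 = k)%N 1?(_ : (e + k).+1 - e = k.+1)%N; try lia.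
  move: (leg_coef (e + k).+2 e.+1) (leg_coef (e + k).+1 e.+1) (leg_coef (e + k) e.+1) (leg_coef (e + k).+1 e) => A x B D.
  move=> /(congr1 (fun n => n%:R : C)) r1 /(congr1 (fun n => n%:R : C)) r2 /(congr1 (fun n => n%:R : C)) r3.
  have {}r1 : (k%:R + 1) * A%:R = (2 * e%:R + k%:R + 3) * x%:R :> C by apply: (eq_by r1); ring.
  have {}r2 : k%:R * x%:R = (2 * e%:R + k%:R + 2) * B%:R :> C by apply: (eq_by r2); ring.
  have {}r3 : (e%:R + 1) ^+ 2 * x%:R = (2 * e%:R + k%:R + 2) * (k%:R + 1) * D%:R :> C by apply: (eq_by r3); ring.
  have k0 : (k%:R + 1 : C) != 0 by rewrite natr1 pnatr_eq0.
  have e0 : (2 * e%:R + k%:R + 2 : C) != 0.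
    by rewrite -natrM -natrD -(natrD _ _ 2) pnatr_eq0; lia.
  have AE : A%:R = (2 * e%:R + k%:R + 3) * x%:R / (k%:R + 1) :> C by rewrite -r1; field.
  have BE : B%:R = k%:R * x%:R / (2 * e%:R + k%:R + 2) :> C by rewrite r2; field.
  have DE : D%:R = (e%:R + 1) ^+ 2 * x%:R / ((2 * e%:R + k%:R + 2) * (k%:R + 1)) :> C.
    by rewrite r3; field; rewrite k0 e0.
  rewrite !natrM AE BE DE; field; by rewrite k0 e0.
case: (eqVneq e m.+1) => [->|em1]; last by rewrite !leg_coef_small ?muln0 ?mulr0 ?addr0 ?mulr0 ?subr0 //; lia.
have r3 := leg_coefSr m.+2 m.+1; have r1 := leg_coefS m.+1 m.+1.
rewrite [leg_coef m.+1 m.+2]leg_coef_small // [leg_coef m m.+2]leg_coef_small; last by lia.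
move: r1 r3; rewrite (_ : m.+2 - m.+1 = 1)%N; last by lia.
move: (leg_coef m.+2 m.+2) (leg_coef m.+2 m.+1) (leg_coef m.+1 m.+1) => A B D r1 r3.
rewrite muln0 subr0 add0r -!natrM; congr (_%:R); nia.
Qed.

Lemma leg_wide n N : (n <= N)%N -> leg n = \sum_(d < N.+1) (leg_coef n d)%:R * Q ^+ d.
Proof.
move=> nN; rewrite /leg (big_ord_widen N.+1 (fun d => (leg_coef n d)%:R * Q ^+ d)) //.
rewrite big_mkcond; apply: eq_bigr => d _; case: ltnP => // nd.
by rewrite leg_coef_small // mul0r.
Qed.

(** Bonnet's three-term recurrence at z = 1 + 2 Q, coefficient by coefficient in Q. *)
Lemma leg_recurrence m : (m.+2)%:R * leg m.+2 =
  (2 * m + 3)%:R * (1 + 2 * Q) * leg m.+1 - m.+1%:R * leg m.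
Proof.
have E n : (n <= m.+2)%N -> leg n = 1 + \sum_(e < m.+2) (leg_coef n e.+1)%:R * Q ^+ e.+1.
  move=> nm; rewrite (leg_wide nm) big_ord_recl leg_coefn0 expr0 mulr1; congr (_ + _).
have F : Q * leg m.+1 = \sum_(e < m.+2) (leg_coef m.+1 e)%:R * Q ^+ e.+1.
  by rewrite /leg mulr_sumr; apply: eq_bigr => e _; rewrite exprS mulrCA.
transitivity ((2 * m + 3)%:R * (leg m.+1 + 2 * (Q * leg m.+1)) - m.+1%:R * leg m); last by ring.
rewrite F !E //; last by lia.
have H : \sum_(e < m.+2) m.+2%:R * ((leg_coef m.+2 e.+1)%:R * Q ^+ e.+1) =
  \sum_(e < m.+2) ((2 * m + 3)%:R * ((leg_coef m.+1 e.+1)%:R * Q ^+ e.+1 + 2 * ((leg_coef m.+1 e)%:R * Q ^+ e.+1))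
    - m.+1%:R * ((leg_coef m e.+1)%:R * Q ^+ e.+1)).
  apply: eq_bigr => e _; have := leg_coef_rec m e.
  rewrite (natrM _ m.+2 (leg_coef _ _)) (natrM _ m.+1 (leg_coef _ _)) mulrA => ->.
  by move: (Q ^+ e.+1) => q; ring.
move: H; rewrite sumrB -!mulr_sumr big_split -mulr_sumr /=.
move: (\sum_(e < _) _) (\sum_(e < _) _) (\sum_(e < _) _) (\sum_(e < _) _) => a b c d H.
by rewrite mulrDr H; rewrite natrD natrM -!natr1; ring.
Qed.

Lemma leg0 : leg 0 = 1.
Proof. by rewrite /leg big_ord1 leg_coefn0 mulr1. Qed.

Lemma leg1 : leg 1 = 1 + 2 * Q.
Proof. by rewrite /leg big_ord_recr big_ord1 leg_coefn0 mulr1 expr1. Qed.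

(** Relative to C(n+1, d) C(n+d, d), the coefficients of P_(n+1) and P_n are (n+1+d)/(n+1) and
    (n+1-d)/(n+1), which add up to 2. *)
Lemma leg_mean n : 2 * (\sum_(d < n.+2) ('C(n + d, d) * 'C(n.+1, d))%:R * Q ^+ d) = leg n.+1 + leg n.
Proof.
rewrite (leg_wide (leqnSn n)) /leg -big_split mulr_sumr; apply: eq_bigr => d _ /=.
rewrite mulrA -mulrDl -natrM -natrD; congr (_%:R * _); have dn := ltn_ord d.
apply/eqP; rewrite -(eqn_pmul2l (ltn0Sn n)) /leg_coef; apply/eqP.
have E1 := mul_bin_down n.+1 d; have := mul_bin_down (n.+1 + d) d; rewrite addnK /= addSn /= => E2.
transitivity ('C(n.+1, d) * (n.+1 * 'C((n + d).+1, d)) + n.+1 * 'C(n, d) * 'C(n + d, d))%N; last first.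
  by rewrite ?addSn; ring.
rewrite -E2 E1 /=; move: ('C(n.+1, d)) ('C(n + d, d)) => A B.
case: (leqP d n.+1) => H; last by lia.
have : (n.+1 - d + d = n.+1)%N by lia.
move: (n.+1 - d)%N => j jE.
nia.
Qed.

(** The recurrence gives |P_(n+2)| <= 2 |z| |P_(n+1)| + |P_n|, whence the rate 2 |z| + 1. A crude
    rate is enough, as only a neighbourhood of x = 0 matters. *)
Lemma leg_bound n : normc (leg n) <= (2 * normc (1 + 2 * Q) + 1) ^+ n.
Proof.
set z := 1 + 2 * Q; have z0 := normc_ge0 z; set rho := 2 * _ + 1.
have rho1 : 1 <= rho by rewrite /rho; lra.
have nn k : normc (k%:R : C) = k%:R by apply: complexI; rewrite -normcE' normr_nat rmorph_nat.
suff : normc (leg n) <= rho ^+ n /\ normc (leg n.+1) <= rho ^+ n.+1 by case.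
elim: n => [|n [IH1 IH2]].
  by rewrite leg0 leg1 normc1 expr1 -/z /rho; split => //; lra.
split=> //; have n2 : 0 < (n.+2%:R : R) by rewrite ltr0n.
rewrite -(ler_pM2l n2) -[X in X * normc _]nn -normcM leg_recurrence -/z.
apply: le_trans (le_normcD' _ _) _; rewrite normcN' !normcM !nn.
have H1 : (2 * n + 3)%:R <= 2 * n.+2%:R :> R by rewrite -natrM ler_nat; lia.
have H2 : n.+1%:R <= n.+2%:R :> R by rewrite ler_nat.
apply: le_trans (_ : 2 * n.+2%:R * normc z * rho ^+ n.+1 + n.+2%:R * rho ^+ n.+1 <= _).
  rewrite lerD // ?ler_pM ?mulr_ge0 ?normc_ge0 //.
  by apply: le_trans IH1 _; rewrite exprS ler_peMl // exprn_ge0 // (le_trans _ rho1).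
by rewrite [rho ^+ n.+2]exprS /rho; move: ((2 * normc z + 1) ^+ n.+1) => X; rewrite le_eqVlt; apply/orP; left; apply/eqP; ring.
Qed.
End Legendre.

(** * Complex differentiation and power series *)

Section ComplexDerivative.
Variable R : realType.
Local Notation C := R[i].
Implicit Types (f g : C -> C) (x l m w z : C) (e d : R).

(** Complex derivative without quotients: real bounds, with h = 0 allowed. [dif_is_derive] converts
    it to the derivative of the theorem. *)
Definition dif f x l := forall e, 0 < e -> exists2 d, 0 < d &
  forall h : C, normc h < d -> normc (f (x + h) - f x - h * l) <= e * normc h.

Lemma normc_sum (I : Type) (r : seq I) (F : I -> C) : normc (\sum_(i <- r) F i) <= \sum_(i <- r) normc (F i).
Proof.
elim/big_rec2: _ => [|i y z _ H]; first by rewrite normc0.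
by apply: le_trans (le_normcD' _ _) _; rewrite lerD2l.
Qed.

Lemma dif_cst x z : dif (fun=> z) x 0.
Proof.
move=> e e0; exists 1 => // h _; rewrite mulr0 subrr subr0 normc0.
by rewrite mulr_ge0 ?normc_ge0 // ltW.
Qed.

Lemma dif_id x : dif id x 1.
Proof.
move=> e e0; exists 1 => // h _; rewrite mulr1 [x + h]addrC addrK subrr normc0.
by rewrite mulr_ge0 ?normc_ge0 // ltW.
Qed.

Lemma difD f g x l m : dif f x l -> dif g x m -> dif (fun x => f x + g x) x (l + m).
Proof.
move=> H H' e e0; have e2 : 0 < e / 2 by rewrite divr_gt0.
have [d d0 Hd] := H _ e2; have [d' d'0 Hd'] := H' _ e2.
exists (Num.min d d'); first by rewrite lt_min d0.
move=> h; rewrite lt_min => /andP[/Hd h1 /Hd' h2].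
have -> : f (x + h) + g (x + h) - (f x + g x) - h * (l + m) =
  (f (x + h) - f x - h * l) + (g (x + h) - g x - h * m) by ring.
apply: le_trans (le_normcD' _ _) _; lra.
Qed.

Lemma dif_lip f x l : dif f x l -> exists2 d, 0 < d & forall h : C, normc h < d ->
  normc (f (x + h) - f x) <= (normc l + 1) * normc h.
Proof.
move=> /(_ 1 ltr01)[d d0 H]; exists d => // h /H; rewrite mul1r => h1.
have -> : f (x + h) - f x = (f (x + h) - f x - h * l) + h * l by ring.
apply: le_trans (le_normcD' _ _) _; rewrite normcM.
by rewrite mulrDl mul1r addrC [normc l * _]mulrC lerD2l.
Qed.

Lemma dif_cont f x l : dif f x l -> forall e, 0 < e -> exists2 d, 0 < d &
  forall h : C, normc h < d -> normc (f (x + h) - f x) < e.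
Proof.
move=> /dif_lip[d d0 H] e e0; have L0 := normc_ge0 l.
exists (Num.min d (e / (normc l + 1))); first by rewrite lt_min d0 divr_gt0 //; lra.
move=> h; rewrite lt_min => /andP[/H h1 h2]; apply: le_lt_trans h1 _.
by rewrite mulrC -ltr_pdivlMr //; lra.
Qed.

Lemma difM f g x l m : dif f x l -> dif g x m -> dif (fun x => f x * g x) x (f x * m + l * g x).
Proof.
move=> H H' e e0.
pose A := normc (f x) + normc (g x) + normc l + 1.
have [A1 A2 A3 A4] : [/\ 0 < A, normc (f x) <= A, normc (g x) <= A & normc l <= A].
  by have := normc_ge0 (f x); have := normc_ge0 (g x); have := normc_ge0 l; rewrite /A; split; lra.
have e3 : 0 < e / (3 * A) by rewrite divr_gt0 // mulr_gt0.
have [d d0 Hd] := H _ e3; have [d1 d10 Hd1] := H' _ e3.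
have [d2 d20 Hd2] := dif_cont H' e3.
have [d3 d30 Hd3] := dif_cont H' (ltr01 : (0 : R) < 1).
exists (Num.min (Num.min d d1) (Num.min d2 d3)); first by rewrite !lt_min d0 d10 d20.
move=> h; rewrite !lt_min => /andP[/andP[/Hd h1 /Hd1 h2] /andP[/Hd2 /ltW h3 /Hd3 /ltW h4]].
have -> : f (x + h) * g (x + h) - f x * g x - h * (f x * m + l * g x) =
  (f (x + h) - f x - h * l) * g (x + h) + f x * (g (x + h) - g x - h * m) + h * l * (g (x + h) - g x) by ring.
have h5 : normc (g (x + h)) <= A.
  have -> : g (x + h) = g (x + h) - g x + g x by ring.
  by apply: le_trans (le_normcD' _ _) _; rewrite /A; have := normc_ge0 (f x); have := normc_ge0 l; lra.
apply: le_trans (le_normcD' _ _) _; rewrite !normcM.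
apply: le_trans (lerD (le_normcD' _ _) (lexx _)) _; rewrite !normcM.
have -> : e * normc h = e / (3 * A) * normc h * A + A * (e / (3 * A) * normc h) + normc h * A * (e / (3 * A)).
  by field; rewrite gt_eqF.
by rewrite !lerD // !ler_pM // ?mulr_ge0 ?normc_ge0.
Qed.

Lemma dif_comp f g x l m : dif f (g x) l -> dif g x m -> dif (fun x => f (g x)) x (l * m).
Proof.
move=> H H' e e0; have L0 := normc_ge0 l; have M0 := normc_ge0 m.
have L1 : 0 < normc l + 1 by lra.
have M1 : 0 < normc m + 1 by lra.
have [d d0 Hd] := H (e / (2 * (normc m + 1))) (divr_gt0 e0 (mulr_gt0 (ltr0Sn _ 1) M1)).
have [d1 d10 Hd1] := H' (e / (2 * (normc l + 1))) (divr_gt0 e0 (mulr_gt0 (ltr0Sn _ 1) L1)).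
have [d2 d20 Hd2] := dif_cont H' d0.
have [d3 d30 Hd3] := dif_lip H'.
exists (Num.min d1 (Num.min d2 d3)); first by rewrite !lt_min d10 d20.
move=> h; rewrite !lt_min => /and3P[/Hd1 h1 /Hd2 /Hd h2 /Hd3 h3].
have kE : g x + (g (x + h) - g x) = g (x + h) by ring.
move: h2; rewrite kE; set k := g (x + h) - g x in h1 h3 *.
move=> h2; have -> : f (g (x + h)) - f (g x) - h * (l * m) =
  (f (g (x + h)) - f (g x) - k * l) + (k - h * m) * l by ring.
apply: le_trans (le_normcD' _ _) _; rewrite normcM.
apply: le_trans (_ : e / (2 * (normc m + 1)) * ((normc m + 1) * normc h) + e / (2 * (normc l + 1)) * normc h * (normc l + 1) <= _).
  apply: lerD; first by apply: le_trans h2 _; rewrite ler_wpM2l // divr_ge0 ?mulr_ge0 // ltW.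
  by rewrite ler_pM ?normc_ge0 //; lra.
by rewrite le_eqVlt; apply/orP; left; apply/eqP; field; rewrite !gt_eqF.
Qed.

(** Over any [numFieldType], so that it serves for complex derivatives and for the real ones in
    [real_seg_cst]. *)
Lemma eps_is_derive (K : numFieldType) (f : K -> K) (x l : K) :
  (forall e : K, 0 < e -> exists2 d : K, 0 < d & forall h, `|h| < d -> `|f (x + h) - f x - h * l| <= e * `|h|) ->
  is_derive x 1 f l.
Proof.
move=> H; have L : (h^-1 *: ((f \o shift x) (h *: 1) - f x) : K) @[h --> 0^'] --> l.
  apply/cvgrPdist_le => e e0; have [d d0 Hd] := H e e0.
  apply/nbhs_normP; exists d => // h /=; rewrite sub0r normrN => hd h0.
  rewrite distrC -(ler_pM2r (_ : 0 < `|h|)) ?normr_gt0 // -normrM; apply: le_trans (Hd h hd).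
  by rewrite mulrBl mulrAC mulVf // mul1r [l * h]mulrC /= [h *: 1]mulr1 [h + x]addrC.
by apply: DeriveDef; [apply: cvgP L|apply/cvg_lim: L].
Qed.

Lemma dif_is_derive f x l : dif f x l -> is_derive x 1 f l.
Proof.
move=> H; apply: eps_is_derive => e e0.
have eR : e = (complex.Re e)%:C%C by rewrite RRe_real // gtr0_real.
have /H[d d0 Hd] : 0 < complex.Re e by rewrite -ltcR -eR.
exists d%:C%C; rewrite ?ltcR // => h; rewrite !normcE' ltcR => /Hd.
by rewrite eR -rmorphM lecR.
Qed.

Lemma Re_le_normc z : `|complex.Re z| <= normc z.
Proof.
case: z => a b /=; rewrite -sqrtr_sqr ler_wsqrtr // lerDl; exact: sqr_ge0.
Qed.

Lemma Im_le_normc z : `|complex.Im z| <= normc z.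
Proof.
case: z => a b /=; rewrite -sqrtr_sqr ler_wsqrtr // lerDr; exact: sqr_ge0.
Qed.

Lemma normc_le_ReIm z : normc z <= `|complex.Re z| + `|complex.Im z|.
Proof.
case: z => a b /=; rewrite -(@ger0_norm _ (`|a| + `|b|)) ?addr_ge0 // -sqrtr_sqr ler_wsqrtr //.
rewrite sqrrD !real_normK ?num_real // lerD2r lerDl; apply: mulrn_wge0; exact: mulr_ge0.
Qed.

(** On the segment from 0 to x the real function s -> p (f (s x)) has derivative 0, so the real mean
    value theorem applies; p will be the real or the imaginary part. *)
Lemma real_seg_cst (p : C -> R) f x (r : R) :
  (forall z z', p (z - z') = p z - p z') -> (forall z, `|p z| <= normc z) ->
  (forall x, normc x < r -> dif f x 0) -> normc x < r -> p (f x) = p (f 0).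
Proof.
move=> pB ple H xr; pose q (s : R) := p (f (s%:C%C * x)).
have ns (s : R) : normc s%:C%C = `|s| by rewrite /= expr0n addr0 sqrtr_sqr.
have D (s : R) : s \in `[0, 1] -> is_derive s 1 q 0.
  rewrite in_itv /= => /andP[s0 s1]; apply: eps_is_derive => e e0.
  have sx : normc (s%:C%C * x) < r.
    rewrite normcM ns ger0_norm //; apply: le_lt_trans xr.
    by rewrite -[leRHS]mul1r ler_wpM2r ?normc_ge0.
  have X0 := normc_ge0 x; have X1 : 0 < normc x + 1 by lra.
  have [d d0 Hd] := H _ sx (e / (normc x + 1)) (divr_gt0 e0 X1).
  exists (d / (normc x + 1)); first exact: divr_gt0.
  move=> h hd; rewrite mulr0 subr0 /q -pB; apply: le_trans (ple _) _.
  have := Hd (h%:C%C * x); rewrite mulr0 subr0 -mulrDl -rmorphD normcM ns => Hh.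
  apply: le_trans (Hh _) _.
    apply: le_lt_trans (_ : `|h| * (normc x + 1) < _); last by rewrite -ltr_pdivlMr.
    by rewrite ler_wpM2l //; lra.
  have -> : e * `|h| = e / (normc x + 1) * (`|h| * (normc x + 1)) by field; rewrite gt_eqF.
  apply: ler_wpM2l; first by apply: divr_ge0; apply: ltW.
  by apply: ler_wpM2l => //; rewrite lerDl ler01.
have W : {within `[(0 : R), 1], continuous q}.
  by apply: derivable_within_continuous => s /D[].
have D' s : s \in `](0 : R), 1[ -> is_derive s 1 q 0.
  by rewrite in_itv /= => /andP[s0 s1]; apply: D; rewrite in_itv /= !ltW.
have [c _] := MVT ltr01 D' W.
by rewrite mul0r /q mul1r mul0r => /eqP; rewrite subr_eq0 => /eqP.
Qed.

Lemma dif0_cst f x (r : R) : (forall x, normc x < r -> dif f x 0) -> normc x < r -> f x = f 0.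
Proof.
move=> H xr; apply/eqP; rewrite eq_complex; apply/andP; split; apply/eqP.
  by apply: (real_seg_cst _ Re_le_normc H xr) => -[a b] [c d].
by apply: (real_seg_cst _ Im_le_normc H xr) => -[a b] [c d].
Qed.

Lemma is_derive_eps (f : R -> R) (x l : R) : is_derive x 1 f l ->
  forall e, 0 < e -> exists2 d, 0 < d & forall h, `|h| < d -> `|f (x + h) - f x - h * l| <= e * `|h|.
Proof.
move=> [/cvg_ex[m Hm] D] e e0; have lm : l = m by rewrite -D; apply/cvg_lim: Hm.
move/cvgrPdist_le: Hm => /(_ e e0)/nbhs_normP[d d0 Hd].
exists d => // h hd; have [->|h0] := eqVneq h 0.
  by rewrite addr0 subrr mul0r subr0 normr0 mulr0.
have := Hd h; rewrite /= sub0r normrN => /(_ hd h0).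
rewrite distrC -(ler_pM2r (_ : 0 < `|h|)) ?normr_gt0 // -normrM; apply: le_trans.
by rewrite mulrBl mulrAC mulVf // mul1r lm [m * h]mulrC /= [h *: 1]mulr1 [h + x]addrC.
Qed.

End ComplexDerivative.

(** * The complex exponential and the principal logarithm *)

Section Exponential.
Variable R : realType.
Local Notation C := R[i].
Implicit Types (x z w h g : C).

Lemma cexpD z w : cexp (z + w) = cexp z * cexp w.
Proof.
case: z w => a b [c d]; rewrite /cexp /= expRD cosD sinD.
by simpc; congr Complex; ring.
Qed.

Lemma cexp0 : cexp 0 = 1 :> C.
Proof. by rewrite /cexp /= expR0 cos0 sin0 mul1r. Qed.

Lemma cexpVN z : cexp z * cexp (- z) = 1.
Proof. by rewrite -cexpD subrr cexp0. Qed.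

Lemma cexp_neq0 z : cexp z != 0.
Proof. by apply: contra_eq_neq (cexpVN z) => ->; rewrite mul0r eq_sym oner_neq0. Qed.

Lemma cexp_small (e : R) : 0 < e -> exists2 d : R, 0 < d &
  forall h, normc h < d -> normc (cexp h - 1 - h) <= e * normc h.
Proof.
(* The real part costs 3/8 of [e] ([T1]) and the imaginary part 5/8 ([T2]). *)
move=> e0; have e8 : 0 < e / 8 by rewrite divr_gt0.
have [d1 d10 H1] := is_derive_eps (is_derive_expR (0 : R)) e8.
have [d1' d1'0 H1'] := is_derive_eps (is_derive_expR (0 : R)) (ltr01 : 0 < (1 : R)).
have [d2 d20 H2] := is_derive_eps (is_derive_sin (0 : R)) e8.
have [d2' d2'0 H2'] := is_derive_eps (is_derive_sin (0 : R)) (ltr01 : 0 < (1 : R)).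
have [d3 d30 H3] := is_derive_eps (is_derive_cos (0 : R)) e8.
exists (Num.min (Num.min (Num.min d1 d1') (Num.min d2 d2')) (Num.min (Num.min d3 1) (e / 8))).
  by rewrite !lt_min d10 d1'0 d20 d2'0 d30 ltr01.
move=> h; have := normc_ge0 h; have := Re_le_normc h; have := Im_le_normc h.
move: (normc h) (normc_le_ReIm (cexp h - 1 - h)) => N; case: h => a b /= HN bN aN N0.
rewrite !lt_min => /andP[/andP[/andP[n1 n1'] /andP[n2 n2']] /andP[/andP[n3 n4] n5]].
have {H1 n1} E1 := H1 a (le_lt_trans aN n1); have {H1' n1'} E1' := H1' a (le_lt_trans aN n1').
have {H2 n2} E2 := H2 b (le_lt_trans bN n2); have {H2' n2'} E2' := H2' b (le_lt_trans bN n2').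
have {H3 n3} E3 := H3 b (le_lt_trans bN n3).
move: E1 E1' E2 E2' E3 HN; rewrite !add0r expR0 sin0 cos0 !oppr0 !mulr0 !subr0 !mulr1 !mul0r ?addr0 ?add0r ?subr0.
have := cos_le1 b; have := cos_geN1 b.
move: (expR a) (cos b) (sin b) => E c s c1 c2 E1 E1' E2 E2' E3 HN.
apply: le_trans HN _.
have T1 : `|E * c - 1 - a| <= e / 8 * N + 2 * (e / 8 * N).
  have -> : E * c - 1 - a = (E - 1 - a) * c + (1 + a) * (c - 1) by ring.
  apply: le_trans (ler_normD _ _) _; rewrite !normrM lerD //.
    rewrite -[leRHS]mulr1 ler_pM //; last by rewrite ler_norml c1 c2.
    by apply: le_trans E1 _; rewrite ler_wpM2l //; lra.
  rewrite ler_pM //; first by apply: le_trans (ler_normD _ _) _; rewrite normr1; lra.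
  by apply: le_trans E3 _; rewrite ler_wpM2l //; lra.
have sN : `|s| <= 2 * N.
  have -> : s = (s - b) + b by ring.
  by apply: le_trans (ler_normD _ _) _; lra.
have EN : `|E - 1| <= 2 * (e / 8).
  have -> : E - 1 = (E - 1 - a) + a by ring.
  by apply: le_trans (ler_normD _ _) _; lra.
have T2 : `|E * s - b| <= 2 * (e / 8) * (2 * N) + e / 8 * N.
  have -> : E * s - b = (E - 1) * s + (s - b) by ring.
  apply: le_trans (ler_normD _ _) _; rewrite normrM lerD // ?ler_pM //.
  by apply: le_trans E2 _; rewrite ler_wpM2l //; lra.
by apply: le_trans (lerD T1 T2) _; lra.
Qed.

Lemma dif_cexp w : dif (@cexp R) w (cexp w).
Proof.
move=> e e0; have W0 := normc_ge0 (cexp w); have W1 : 0 < normc (cexp w) + 1 by lra.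
have [d d0 H] := cexp_small (divr_gt0 e0 W1); exists d => // h /H Hh.
have -> : cexp (w + h) - cexp w - h * cexp w = cexp w * (cexp h - 1 - h) by rewrite cexpD; ring.
rewrite normcM; apply: le_trans (_ : (normc (cexp w) + 1) * (e / (normc (cexp w) + 1) * normc h) <= _).
  by rewrite ler_pM ?normc_ge0 // lerDl.
by rewrite mulrA mulrCA mulfV ?mulr1 // gt_eqF.
Qed.

Lemma cos1_eq0 (x : R) : cos x = 1 -> `|x| < 2 * pi -> x = 0.
Proof.
move=> cx xpi; have xE : x = (x / 2) *+ 2 by rewrite -mulr_natr divfK.
move: cx; rewrite xE cos_mulr2n => cx.
have : sin (x / 2) ^+ 2 = 0 by have := cos2Dsin2 (x / 2); lra.
move/eqP; rewrite sqrf_eq0 => /eqP sx.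
case: (ltgtP x 0) => [x0|x0|-> //]; last 2 first.
- suff : 0 < sin (x / 2) by rewrite sx ltxx.
  by apply: sin_gt0_pi; move: xpi; rewrite gtr0_norm //; lra.
- by rewrite mul0r mul0rn.
suff : 0 < sin (- (x / 2)) by rewrite sinN sx oppr0 ltxx.
by apply: sin_gt0_pi; move: xpi; rewrite ltr0_norm //; lra.
Qed.

(** Two logarithms in the principal strip differ by some a + i b with |b| < 2 pi and exponential 1;
    the modulus gives a = 0, and then [cos1_eq0] gives b = 0. *)
Lemma clog_cexp z : - pi < complex.Im z <= pi -> clog (cexp z) = z.
Proof.
move=> zpi; rewrite /clog; case: xgetP => [w _ [wz wpi]|/(_ z)]; last by case.
have : cexp (w - z) = 1 by rewrite cexpD wz cexpVN.
case: w z wpi zpi wz => a b [c d] /= wpi zpi _; rewrite /cexp /= => -[].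
rewrite !mul0r subr0 addr0 => Ec Es.
have E1 : expR (a - c) = 1.
  have : expR (a - c) ^+ 2 = 1.
    transitivity ((expR (a - c) * cos (b - d)) ^+ 2 + (expR (a - c) * sin (b - d)) ^+ 2).
      by rewrite !exprMn -mulrDr cos2Dsin2 mulr1.
    by rewrite Ec Es expr1n expr0n addr0.
  by move/eqP; rewrite sqrf_eq1 => /orP[/eqP //|/eqP E]; have := expR_gt0 (a - c); rewrite E; lra.
have ac : a - c = 0 by apply: expR_inj; rewrite E1 expR0.
have bd : b - d = 0.
  by apply: cos1_eq0; [move: Ec; rewrite E1 mul1r|rewrite ltr_norml; lra].
by congr Complex; lra.
Qed.
End Exponential.

(** * Power series with geometrically bounded coefficients *)

Section PowerSeries.
Variable R : realType.
Local Notation C := R[i].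
Implicit Types (a b : nat -> C) (x h z : C) (rho : R).

Definition psq a x (N : nat) : C := \sum_(k < N) a k * x ^+ k.
Definition psum a x : C := limn (psq a x).
Definition geo rho a := exists2 K : R, 0 <= K & forall n, normc (a n) <= K * rho ^+ n.

Lemma cvgC_shift (f : nat -> C) z : f @ \oo --> z -> (fun n => f n.+1) @ \oo --> z.
Proof.
move=> /cvgCP H; apply/cvgCP => e /H[N HN]; exists N => n Nn; apply: HN; lia.
Qed.

Lemma cvgC_le (f : nat -> C) z (B : R) : f @ \oo --> z -> (forall n, normc (f n) <= B) -> normc z <= B.
Proof.
move=> /cvgCP H fB; rewrite leNgt; apply/negP => Bz.
have /H[N /(_ N (leqnn N)) HN] : 0 < normc z - B by lra.
have := le_normcD' (z - f N) (f N); rewrite subrK; have := fB N; lra.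
Qed.

Lemma half_sum (N : nat) : \sum_(k < N) (1 / 2 : R) ^+ k <= 2.
Proof.
suff -> : \sum_(k < N) (1 / 2 : R) ^+ k = 2 - 2 * (1 / 2) ^+ N.
  by rewrite gerBl mulr_ge0 // exprn_ge0.
elim: N => [|N IH]; first by rewrite big_ord0 expr0; lra.
by rewrite big_ord_recr /= IH exprS; lra.
Qed.

Lemma real_cvg (u : nat -> R) (K : R) : (forall n, `|u n| <= K * (1 / 2) ^+ n) ->
  exists l : R, (fun N => \sum_(k < N) u k) @ \oo --> l.
Proof.
move=> H; have K0 : 0 <= K by have := H 0%N; rewrite expr0 mulr1; apply: le_trans.
have : cvgn (series u).
  apply: normed_cvg; apply: (@series_le_cvg _ _ (geometric K (1 / 2))) => [n|n|n|]; rewrite /geometric /=.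
  - exact: normr_ge0.
  - by rewrite mulr_ge0 // exprn_ge0.
  - exact: H.
  - by apply: is_cvg_geometric_series; rewrite ger0_norm; lra.
case/cvg_ex => l Hl; exists l; rewrite (_ : (fun N => _) = series u) //.
by apply: funext => n; rewrite /series /= big_mkord.
Qed.

Lemma complex_cvg (u : nat -> C) (K : R) : (forall n, normc (u n) <= K * (1 / 2) ^+ n) ->
  exists l : C, (fun N => \sum_(k < N) u k) @ \oo --> l.
Proof.
move=> H.
have [l1 H1] : exists l : R, (fun N => \sum_(k < N) complex.Re (u k)) @ \oo --> l.
  by apply: (@real_cvg (fun k => complex.Re (u k)) K) => n; apply: le_trans (H n); exact: Re_le_normc.
have [l2 H2] : exists l : R, (fun N => \sum_(k < N) complex.Im (u k)) @ \oo --> l.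
  by apply: (@real_cvg (fun k => complex.Im (u k)) K) => n; apply: le_trans (H n); exact: Im_le_normc.
exists (Complex l1 l2); apply/cvgCP => e e0; have e2 : 0 < e / 2 by rewrite divr_gt0.
move/cvgrPdist_lt: H1 => /(_ _ e2)[N1 _ H1]; move/cvgrPdist_lt: H2 => /(_ _ e2)[N2 _ H2].
exists (maxn N1 N2) => n; rewrite geq_max => /andP[/H1 /= h1 /H2 /= h2].
apply: le_lt_trans (normc_le_ReIm _) _.
have -> : \sum_(k < n) u k = Complex (\sum_(k < n) complex.Re (u k)) (\sum_(k < n) complex.Im (u k)).
  elim: n {h1 h2} => [|n IH]; first by rewrite !big_ord0.
  by rewrite !big_ord_recr IH /=; case: (u n).
by rewrite /=; lra.
Qed.

Lemma geo_term rho a x : 0 < rho -> geo rho a -> normc x <= (4 * rho)^-1 ->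
  exists2 K : R, 0 <= K & forall n, normc (a n * x ^+ n) <= K * (1 / 2) ^+ n.
Proof.
move=> r0 [K K0 H] xr; exists K => // n; rewrite normcM normcX.
apply: le_trans (_ : K * rho ^+ n * (4 * rho)^-1 ^+ n <= _).
  by rewrite ler_pM ?exprn_ge0 ?normc_ge0 // lerXn2r // ?nnegrE ?normc_ge0 // invr_ge0 mulr_ge0 // ltW.
have q : rho * (4 * rho)^-1 = 1 / 4 by rewrite invfM mulrCA mulfV ?gt_eqF // mulr1 mul1r.
by rewrite -mulrA -exprMn q ler_wpM2l // lerXn2r ?nnegrE //; lra.
Qed.

Section Ball.
Variables (rho : R) (rho1 : 0 < rho).
(** A quarter of 1/rho: one factor 2 is spent on the 2^n of [expr_dif_bound], the other leaves the
    ratio 1/2 for convergence. *)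
Let r := (4 * rho)^-1.

Lemma psum_cvg a x : geo rho a -> normc x <= r -> psq a x @ \oo --> psum a x.
Proof.
move=> ga xr; have [K _ H] := geo_term rho1 ga xr.
have [l Hl] := complex_cvg H; rewrite /psum -[limn _](_ : l = _); first exact: Hl.
exact: esym (cvgC_lim Hl).
Qed.

Lemma geoD a b : geo rho a -> geo rho b -> geo rho (fun n => a n + b n).
Proof.
move=> [K K0 H] [L L0 H']; exists (K + L); first exact: addr_ge0.
by move=> n; apply: le_trans (le_normcD' _ _) _; rewrite mulrDl lerD.
Qed.

Lemma geoZ z a : geo rho a -> geo rho (fun n => z * a n).
Proof.
move=> [K K0 H]; exists (normc z * K); first by rewrite mulr_ge0 ?normc_ge0.
by move=> n; rewrite normcM -mulrA ler_wpM2l ?normc_ge0.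
Qed.

Definition shiftr a n := if n is k.+1 then a k else 0.

Lemma geo_shiftr a : geo rho a -> geo rho (shiftr a).
Proof.
move=> [K K0 H]; exists (K / rho); first by rewrite divr_ge0 // ltW.
case=> [|n].
  have -> : shiftr a 0 = 0 by [].
  by rewrite normc0 mulr_ge0 // divr_ge0 // ltW.
by rewrite exprS mulrA divfK ?gt_eqF //; exact: H.
Qed.

Lemma psumD a b x : geo rho a -> geo rho b -> normc x <= r ->
  psum (fun n => a n + b n) x = psum a x + psum b x.
Proof.
move=> ga gb xr; apply: cvgC_lim; have L := cvgCD (psum_cvg ga xr) (psum_cvg gb xr).
apply: (cvgC_eq L) => n; rewrite /psq -big_split; apply: eq_bigr => k _ /=.
by rewrite mulrDl.
Qed.

Lemma psumZ z a x : geo rho a -> normc x <= r -> psum (fun n => z * a n) x = z * psum a x.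
Proof.
move=> ga xr; apply: cvgC_lim; have L := cvgCM (cvgC_cst _ z) (psum_cvg ga xr).
by apply: (cvgC_eq L) => n; rewrite /psq mulr_sumr; apply: eq_bigr => k _; rewrite mulrA.
Qed.

Lemma psum_shiftr a x : geo rho a -> normc x <= r -> psum (shiftr a) x = x * psum a x.
Proof.
move=> ga xr; have L := cvgCM (cvgC_cst _ x) (psum_cvg ga xr).
have L' := cvgC_shift (psum_cvg (geo_shiftr ga) xr).
apply: cvgC_unique L' _; apply: (cvgC_eq L) => n.
rewrite /psq big_ord_recl /= mul0r add0r mulr_sumr; apply: eq_bigr => k _.
by rewrite /= exprS mulrCA.
Qed.

Lemma psum_eq a b x : a =1 b -> psum a x = psum b x.
Proof. by move=> ab; congr psum; apply: funext. Qed.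

Lemma psum_at0 a : psum a 0 = a 0%N.
Proof.
apply: cvgC_lim; apply: (@cvgC_near _ (fun=> a 0%N) _ _ 1); last exact: cvgC_cst.
case=> // n _; rewrite /psq big_ord_recl expr0 mulr1 big1 ?addr0 // => k _.
by rewrite expr0n mulr0.
Qed.

Definition deriv_seq a n : C := n.+1%:R * a n.+1.

(** Second-order remainder of a power, by induction on x^(n+1) = x x^n. The factor 2^n is crude but
    keeps the sum over n geometric. *)
Lemma expr_dif_bound (s : R) x h n : 0 < s -> normc x <= s -> normc (x + h) <= s ->
  normc ((x + h) ^+ n - x ^+ n - n%:R * h * x ^+ n.-1) <= (2 * s) ^+ n / s ^+ 2 * normc h ^+ 2.
Proof.
move=> s0 xs xhs; have s20 : 0 < s ^+ 2 by rewrite exprn_gt0.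
elim: n => [|n IH].
  rewrite !expr0 subrr !mul0r subr0 normc0; apply: mulr_ge0; last by rewrite exprn_ge0 ?normc_ge0.
  by rewrite mul1r invr_ge0 ltW.
have nE : n%:R * x ^+ n = n%:R * x * x ^+ n.-1 by case: n {IH} => [|n]; rewrite ?mul0r // exprS mulrA.
have -> : (x + h) ^+ n.+1 - x ^+ n.+1 - n.+1%:R * h * x ^+ n.+1.-1 =
   (x + h) * ((x + h) ^+ n - x ^+ n - n%:R * h * x ^+ n.-1) + n%:R * x ^+ n.-1 * h ^+ 2.
  transitivity ((x + h) ^+ n.+1 - x ^+ n.+1 - h * (x ^+ n + n%:R * x ^+ n)).
    by rewrite /= -natr1; ring.
  by rewrite nE !exprS; ring.
apply: le_trans (le_normcD' _ _) _; rewrite !normcM !normcX.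
have nn : normc (n%:R : C) = n%:R.
  by apply: complexI; rewrite -normcE' normr_nat rmorph_nat.
have nb : n%:R * s ^+ n.-1 <= (2 * s) ^+ n * s / s ^+ 2.
  case: n {IH nE nn} => [|n]; first by rewrite mul0r !mulr_ge0 // ?invr_ge0 ltW.
  rewrite exprMn [s ^+ n.+1]exprSr [n.+1.-1]/= (_ : _ / _ = 2 ^+ n.+1 * s ^+ n); last first.
    by move: (2 ^+ n.+1) (s ^+ n) => A B; field; rewrite gt_eqF.
  by rewrite ler_wpM2r ?exprn_ge0 ?(ltW s0) // -natrX ler_nat ltnW // ltn_expl.
apply: le_trans (_ : s * ((2 * s) ^+ n / s ^+ 2 * normc h ^+ 2) + (2 * s) ^+ n * s / s ^+ 2 * normc h ^+ 2 <= _).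
  apply: lerD; first by rewrite ler_pM ?normc_ge0.
  rewrite (ler_wpM2r (exprn_ge0 2 (normc_ge0 h))) //.
  apply: le_trans nb; rewrite nn ler_wpM2l // lerXn2r ?nnegrE ?normc_ge0 //.
  exact: ltW.
rewrite le_eqVlt; apply/orP; left; apply/eqP; rewrite [in RHS]exprS.
by move: ((2 * s) ^+ n) (normc h ^+ 2) => A H; ring.
Qed.

(** The remainder of every partial sum is at most M |h|^2 with M independent of the length, and
    [cvgC_le] carries the bound to the limit. *)
Lemma dif_psum a x : geo rho a -> geo rho (deriv_seq a) -> normc x < r ->
  dif (psum a) x (psum (deriv_seq a) x).
Proof.
move=> ga gda xr e e0; have [K K0 HK] := ga.
have r0 : 0 < r by rewrite invr_gt0 mulr_gt0.
(* The 2 bounds the sum of the powers of 1/2. *)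
pose M := 2 * (K / r ^+ 2); have M0 : 0 <= M by rewrite mulr_ge0 // divr_ge0 // exprn_ge0 // ltW.
have M1 : 0 < M + 1 by lra.
exists (Num.min (r - normc x) (e / (M + 1))); first by rewrite lt_min divr_gt0 // subr_gt0 xr.
move=> h; rewrite lt_min => /andP[h1 h2].
have xhr : normc (x + h) <= r by apply: le_trans (le_normcD' _ _) _; lra.
have L1 := cvgC_shift (psum_cvg ga xhr).
have L2 := cvgC_shift (psum_cvg ga (ltW xr)).
have L3 := cvgCM (cvgC_cst _ h) (psum_cvg gda (ltW xr)).
have L := cvgCB (cvgCB L1 L2) L3.
apply: le_trans (_ : M * normc h ^+ 2 <= _); last first.
  rewrite expr2 mulrA ler_wpM2r ?normc_ge0 //; apply: le_trans (_ : (M + 1) * normc h <= _).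
    by rewrite ler_wpM2r ?normc_ge0 // lerDl.
  by rewrite mulrC -ler_pdivlMr // ltW.
apply: (cvgC_le L) => N.
have -> : psq a (x + h) N.+1 - psq a x N.+1 - h * psq (deriv_seq a) x N =
   \sum_(k < N.+1) a k * ((x + h) ^+ k - x ^+ k - k%:R * h * x ^+ k.-1).
  have -> : h * psq (deriv_seq a) x N = \sum_(k < N.+1) a k * (k%:R * h * x ^+ k.-1).
    rewrite big_ord_recl mul0r mul0r mulr0 add0r /psq mulr_sumr; apply: eq_bigr => k _.
    rewrite /deriv_seq lift0 [k.+1.-1]/=.
    by move: (k.+1%:R) (a k.+1) (x ^+ k) => A B D; ring.
  by rewrite /psq -!sumrB; apply: eq_bigr => k _; rewrite !mulrBr.
apply: le_trans (normc_sum _ _) _.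
apply: le_trans (_ : \sum_(k < N.+1) K / r ^+ 2 * normc h ^+ 2 * (1 / 2) ^+ k <= _).
  apply: ler_sum => k _; rewrite normcM.
  apply: le_trans (ler_pM (normc_ge0 _) (normc_ge0 _) (HK k) (expr_dif_bound k r0 (ltW xr) xhr)) _.
  rewrite le_eqVlt; apply/orP; left; apply/eqP.
  have -> : (1 / 2 : R) ^+ k = rho ^+ k * (2 * r) ^+ k.
    by rewrite -exprMn; congr (_ ^+ _); rewrite /r; field; rewrite gt_eqF.
  by move: ((2 * r) ^+ k) (rho ^+ k) (normc h ^+ 2) => A B H; ring.
rewrite -mulr_sumr; apply: le_trans (ler_wpM2l _ (half_sum _)) _.
  by apply: mulr_ge0; [apply: divr_ge0 => //; apply: exprn_ge0; exact: ltW|apply: exprn_ge0; exact: normc_ge0].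
by rewrite [leLHS]mulrC mulrA.
Qed.
End Ball.
End PowerSeries.

(** * The mirror curve *)

Section GeometricBounds.
Variable R : realType.
Local Notation C := R[i].
Implicit Types (a b : nat -> C) (rho : R).

Lemma normc_nat n : normc (n%:R : C) = n%:R.
Proof. by apply: complexI; rewrite -normcE' normr_nat rmorph_nat. Qed.

Lemma geo_le rho a b : (forall n, normc (b n) <= normc (a n)) -> geo rho a -> geo rho b.
Proof. by move=> ba [K K0 H]; exists K => // n; apply: le_trans (H n). Qed.

Lemma geo_mono rho rho' a : 0 <= rho -> rho <= rho' -> geo rho a -> geo rho' a.
Proof.
move=> r0 rr' [K K0 H]; exists K => // n; apply: le_trans (H n) _.
by rewrite ler_wpM2l // lerXn2r // nnegrE // (le_trans r0).
Qed.

(** The factor n + 1 is at most 2^n, at the price of doubling the rate. *)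
Lemma geo_deriv rho a : 0 <= rho -> geo rho a -> geo (2 * rho) (deriv_seq a).
Proof.
move=> r0 [K K0 H]; exists (K * rho); first exact: mulr_ge0.
move=> n; rewrite /deriv_seq normcM normc_nat.
apply: le_trans (_ : 2 ^+ n * (K * rho ^+ n.+1) <= _).
  by rewrite ler_pM ?normc_ge0 // -natrX ler_nat ltn_expl.
by rewrite exprMn exprS; move: (2 ^+ n) (rho ^+ n) => A B; rewrite le_eqVlt; apply/orP; left; apply/eqP; ring.
Qed.
End GeometricBounds.

Section Curve.
Variable R : realType.
Local Notation C := R[i].
Variable Q : C.
Implicit Types (x : C).

Let z := 1 + 2 * Q.
(** [rho0] is the growth rate of the P_n in [leg_bound]; [rho] doubles it to cover the
    differentiated series. *)
Let rho0 := 2 * normc z + 1.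
Let rho := 2 * rho0.
Definition radius := (4 * rho)^-1.
Local Notation r := radius.
Local Notation P := (leg Q).

(** Genus 0 coefficients without the factor - n^-2. The value 1 at n = 0 is removed in [psi_coef]
    and [log_coef] by 0^-1 = 0. *)
Definition disk_coef n : C := \sum_(d < n.+1) ('C(n.-1 + d, d) * 'C(n, d))%:R * Q ^+ d.
Definition psi_coef n : C := - (n%:R ^+ 2)^-1 * disk_coef n.
Definition log_coef n : C := - n%:R^-1 * disk_coef n.

Lemma rho0_ge1 : 1 <= rho0.
Proof. by rewrite /rho0; have := normc_ge0 z; lra. Qed.

Lemma rho_gt0 : 0 < rho.
Proof. by rewrite /rho; have := rho0_ge1; lra. Qed.

Lemma radius_gt0 : 0 < r.
Proof. by rewrite invr_gt0 mulr_gt0 // rho_gt0. Qed.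

Lemma geo_leg0 : geo rho0 P.
Proof. by exists 1 => // n; rewrite mul1r; exact: leg_bound. Qed.

Lemma geo0 a : geo rho0 a -> geo rho a.
Proof. by have := rho0_ge1 => r1; apply: geo_mono; rewrite /rho; lra. Qed.

Lemma geo_dleg : geo rho (deriv_seq P).
Proof. by apply: geo_deriv geo_leg0; have := rho0_ge1; lra. Qed.

Lemma disk_coefS n : 2 * disk_coef n.+1 = P n.+1 + P n.
Proof. exact: leg_mean. Qed.

Lemma geo_diskS : geo rho0 (fun n => disk_coef n.+1).
Proof.
have r1 := rho0_ge1; exists rho0; first by lra.
move=> n; rewrite -(ler_pM2l (ltr0Sn R 1)) -[X in X * normc _](normc_nat R 2) -normcM disk_coefS.
apply: le_trans (le_normcD' _ _) _; have h1 := leg_bound Q n.+1; have h2 := leg_bound Q n.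
apply: le_trans (lerD h1 h2) _; rewrite -/z -/rho0 exprS.
have : 0 <= rho0 ^+ n by rewrite exprn_ge0 //; lra.
move: (rho0 ^+ n) => X X0; have : X <= rho0 * X by rewrite ler_peMl.
lra.
Qed.

Lemma geo_disk : geo rho0 (fun n => if n is 0 then 0 else disk_coef n).
Proof.
have r1 := rho0_ge1; have r0 : 0 < rho0 by lra.
by apply: geo_le (geo_shiftr r0 geo_diskS) => -[|n].
Qed.

Lemma nat_inv_le1 n : normc ((n.+1%:R : C)^-1) <= 1.
Proof. by rewrite normcV normc_nat invf_le1 ?ler1n // ltr0n. Qed.

Lemma geo_log : geo rho0 log_coef.
Proof.
apply: geo_le geo_disk => -[|n]; first by rewrite /log_coef invr0 oppr0 mul0r.
by rewrite /log_coef normcM normcN' ler_piMl ?normc_ge0 // nat_inv_le1.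
Qed.

Lemma geo_psi : geo rho0 psi_coef.
Proof.
apply: geo_le geo_log => -[|n]; first by rewrite /log_coef /psi_coef expr0n invr0 !oppr0 !mul0r.
rewrite /log_coef /psi_coef !normcM !normcN' ler_wpM2r ?normc_ge0 //.
by rewrite expr2 invfM normcM ler_piMl ?normc_ge0 // nat_inv_le1.
Qed.

Definition Lf := psum P.
Definition Lf' := psum (deriv_seq P).
Definition Kf := psum (fun n => disk_coef n.+1).
Definition log_curve := psum log_coef.
(** Discriminant (1 - x)^2 - 4 Q x of the mirror curve y^2 + (x - 1) y + Q x = 0 in y. *)
Definition Delta x := 1 - 2 * z * x + x * x.
(** On the disk [Delta x * Lf x] is the square root of [Delta x] with value 1 at 0, written without
    division so that the product rule differentiates it. *)
Definition ycurve x := (1 - x + Delta x * Lf x) / 2.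

Lemma dif_ext f f' x l l' : dif f x l -> f =1 f' -> l = l' -> dif f' x l'.
Proof. by move=> H /funext <- <-. Qed.

Lemma dif_L x : normc x < r -> dif Lf x (Lf' x).
Proof. by move=> xr; apply: (dif_psum rho_gt0 (geo0 geo_leg0) geo_dleg). Qed.

Lemma dif_g x : normc x < r -> dif log_curve x (- Kf x).
Proof.
move=> xr; have r0 : 0 <= rho0 by have := rho0_ge1; lra.
have H := dif_psum rho_gt0 (geo0 geo_log) (geo_deriv r0 geo_log) xr.
apply: dif_ext H _ _ => //; have E := psumZ rho_gt0 (-1) (geo0 geo_diskS) (ltW xr).
rewrite -[- Kf x]mulN1r -[_ * _]E; apply: psum_eq => n.
by rewrite /deriv_seq /log_coef mulrA mulrN mulfV // pnatr_eq0.
Qed.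

Lemma dif_psi x : normc x < r -> exists2 l, dif (psum psi_coef) x l & x * l = log_curve x.
Proof.
move=> xr; have r0 : 0 <= rho0 by have := rho0_ge1; lra.
have gd := geo_deriv r0 geo_psi.
exists (psum (deriv_seq psi_coef) x); first exact: (dif_psum rho_gt0 (geo0 geo_psi) gd xr).
rewrite -(psum_shiftr rho_gt0 gd (ltW xr)); apply: psum_eq => -[|n] /=.
  by rewrite /log_coef invr0 oppr0 mul0r.
rewrite /deriv_seq /psi_coef /log_coef; have : (n.+1%:R : C) != 0 by rewrite pnatr_eq0.
by move=> n0; field.
Qed.

(** Coefficient by coefficient this is the recurrence of the P_n; the constant term is P_1 = z
    P_0. *)
Lemma L_ode x : normc x < r -> Delta x * Lf' x = (z - x) * Lf x.
Proof.
move=> /ltW xr; have g1 := geo0 geo_leg0; have g2 := geo_dleg; have rp := rho_gt0.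
have s1 := geo_shiftr rp g1; have s2 := geo_shiftr rp g2; have s3 := geo_shiftr rp s2.
have E : psum (fun n => (((deriv_seq P n + - (2 * z) * shiftr (deriv_seq P) n)
   + shiftr (shiftr (deriv_seq P)) n) + - z * P n) + shiftr P n) x = 0.
  rewrite -[RHS](mul0r (psum P x)) -(psumZ rp 0 g1 xr); apply: psum_eq => n; rewrite mul0r.
  case: n => [|[|n]] /=; rewrite /deriv_seq.
  - by rewrite leg0 leg1 -/z; ring.
  - by have := leg_recurrence Q 0; rewrite leg0 leg1 -/z => E; apply: (eq_by E); ring.
  by have := leg_recurrence Q n.+1; rewrite -/z => E; apply: (eq_by E); ring.
move: E; rewrite !(psumD rp, psumZ rp, psum_shiftr rp) //; try by repeat apply: geoD => //; apply: geoZ.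
by rewrite /Delta -/Lf -/Lf' => E; apply: (eq_by E); ring.
Qed.

(** Generating function of 2 [disk_coef n] = P_n + P_(n-1) for n >= 1; the 1 corrects the constant
    term, where P_0 stands alone. *)
Lemma K_L x : normc x < r -> 2 * (x * Kf x) = (1 + x) * Lf x - 1.
Proof.
move=> /ltW xr; have g1 := geo0 geo_leg0; have rp := rho_gt0; have s1 := geo_shiftr rp g1.
have g3 := geo0 geo_diskS; have s3 := geo_shiftr rp g3.
pose one_seq n : C := (n == 0%N)%:R.
have go : geo rho one_seq.
  exists 1 => // -[|n]; rewrite /one_seq normc_nat mul1r ?expr0 //.
  exact: exprn_ge0 (ltW rp).
have o1 : psum one_seq x = 1.
  apply: cvgC_lim; apply: (@cvgC_near _ (fun=> 1) _ _ 1); last exact: cvgC_cst.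
  case=> // n _; rewrite /psq big_ord_recl /one_seq mul1r expr0 big1 ?addr0 // => k _.
  by rewrite mul0r.
have : psum (fun n => 2 * shiftr (fun n => disk_coef n.+1) n) x = psum (fun n => (P n + shiftr P n) + -1 * one_seq n) x.
  apply: psum_eq => -[|n] /=; first by rewrite leg0 /one_seq eqxx mulr0 addr0 mulN1r subrr.
  by rewrite disk_coefS /one_seq /= mulr0 addr0.
have g4 := geoZ (-1) go; have g5 := geoD g1 s1.
rewrite !(psumD rp, psumZ rp, psum_shiftr rp) //.
rewrite o1 -/(Kf x) -/(Lf x) => E.
by apply: (eq_by E); ring.
Qed.

Lemma L_at0 : Lf 0 = 1.
Proof. by rewrite /Lf psum_at0 leg0. Qed.

Lemma dif_Delta x : dif Delta x (2 * x - 2 * z).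
Proof.
apply: dif_ext (difD (difD (dif_cst x 1) (difM (dif_cst x (- (2 * z))) (dif_id x))) (difM (dif_id x) (dif_id x))) _ _.
  by move=> w; rewrite /Delta; ring.
by ring.
Qed.

Lemma L_algebraic x : normc x < r -> Lf x ^+ 2 * Delta x = 1.
Proof.
move=> xr; rewrite (@dif0_cst _ (fun x => Lf x ^+ 2 * Delta x) x r _ xr).
  by rewrite L_at0 /Delta; ring.
move=> w wr; apply: dif_ext (difM (difM (dif_L wr) (dif_L wr)) (dif_Delta w)) _ _ => [v|].
  by rewrite expr2.
transitivity (2 * Lf w * (Delta w * Lf' w - (z - w) * Lf w)); first by ring.
by rewrite L_ode // subrr mulr0.
Qed.

(** By [L_ode] the derivative of Delta L is (2x - 2z) L + (z - x) L = (x - z) L. *)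
Lemma dif_y x : normc x < r -> dif ycurve x (((x - z) * Lf x - 1) / 2).
Proof.
move=> xr.
apply: dif_ext (difM (difD (difD (dif_cst x 1) (difM (dif_cst x (-1)) (dif_id x)))
  (difM (dif_Delta x) (dif_L xr))) (dif_cst x (2^-1))) _ _ => [v|].
  by rewrite /ycurve mulN1r.
by rewrite L_ode //; field.
Qed.

Lemma y_equation x : normc x < r -> ycurve x ^+ 2 + (x - 1) * ycurve x + x * Q = 0.
Proof.
move=> xr; have E := L_algebraic xr.
transitivity ((Delta x * (Lf x ^+ 2 * Delta x) - (1 - x) ^+ 2 + 4 * x * Q) / 4); first by rewrite /ycurve; field.
by rewrite E /Delta /z; field.
Qed.

(** The equation y' = - y K. As [K_L] determines only x K, the identity is proved after
    multiplication by x, and at x = 0 from the first coefficient 1 + Q. *)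
Lemma y_K x : normc x < r -> ((x - z) * Lf x - 1) / 2 + ycurve x * Kf x = 0.
Proof.
move=> xr; have [->|x0] := eqVneq x 0.
  rewrite /ycurve L_at0 /Kf psum_at0 /Delta.
  have K0 : 2 * disk_coef 1 = 2 * (1 + Q) by rewrite disk_coefS leg1 leg0; ring.
  by transitivity ((2 * disk_coef 1 - (1 + z)) / 2); [field|rewrite K0 /z; field].
apply: (mulfI x0); rewrite mulr0; have E := L_algebraic xr; have E' := K_L xr.
transitivity (x * ((x - z) * Lf x - 1) / 2 + ycurve x * (2 * (x * Kf x)) / 2); first by field.
rewrite E' /ycurve.
transitivity ((1 + x) * (Lf x ^+ 2 * Delta x - 1) / 4 + Lf x * ((1 - x ^+ 2 - Delta x) + 2 * x * (x - z)) / 4); first by field.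
by rewrite E /Delta; field.
Qed.

Lemma y_at0 : ycurve 0 = 1.
Proof. by rewrite /ycurve L_at0 /Delta; field. Qed.

Lemma g_at0 : log_curve 0 = 0.
Proof. by rewrite /log_curve psum_at0 /log_coef invr0 oppr0 mul0r. Qed.

(** y times the exponential of - [log_curve] has derivative 0 by [y_K] and value 1 at 0. No branch
    of the logarithm enters, and y is seen to have no zero on the disk. *)
Lemma y_exp x : normc x < r -> ycurve x = cexp (log_curve x).
Proof.
move=> xr; suff H : ycurve x * cexp (- log_curve x) = 1.
  by rewrite -[LHS]mulr1 -(cexpVN (log_curve x)) [X in _ * X]mulrC mulrA H mul1r.
rewrite (@dif0_cst _ (fun x => ycurve x * cexp (- log_curve x)) x r _ xr).
  by rewrite y_at0 g_at0 oppr0 cexp0 mulr1.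
move=> w wr.
have D : dif (fun x => cexp (- log_curve x)) w (cexp (- log_curve w) * Kf w).
  have H := difM (dif_cst w (-1)) (dif_g wr).
  have H' := @dif_comp _ (@cexp R) (fun x => -1 * log_curve x) w _ _ (dif_cexp _) H.
  by apply: dif_ext H' _ _ => [v|]; rewrite mulN1r //; ring.
apply: dif_ext (difM (dif_y wr) D) _ _ => //.
transitivity (cexp (- log_curve w) * (((w - z) * Lf w - 1) / 2 + ycurve w * Kf w)); first by ring.
by rewrite y_K // mulr0.
Qed.

End Curve.

(** * Neighbourhoods of 0 and the series of the theorem *)

Section Assembly.
Variable R : realType.
Local Notation C := R[i].
Implicit Types (t x : C).

Lemma near0P (P : C -> Prop) : (\forall x \near (0 : C), P x) <->
  exists2 r : R, 0 < r & forall x, normc x < r -> P x.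
Proof.
split=> [/nbhs_normP[e e0 H]|[r r0 H]].
  have eR : e = (complex.Re e)%:C%C by rewrite RRe_real // gtr0_real.
  exists (complex.Re e); first by rewrite -ltcR -eR.
  by move=> x xe; apply: H; rewrite /= sub0r normrN eR ltcR.
apply/nbhs_normP; exists r%:C%C; first by rewrite /= ltcR.
by move=> x /=; rewrite sub0r normrN ltcR => /H.
Qed.

Lemma continuous0P (f : C -> C) : {for 0, continuous f} ->
  forall e : R, 0 < e -> exists2 r : R, 0 < r & forall x, normc x < r -> normc (f 0 - f x) < e.
Proof.
move=> /cvgrPdist_lt H e e0; have /H/near0P[r r0 Hr] : (0 : C) < e%:C%C by rewrite ltcR.
by exists r => // x /Hr; rewrite ltcR.
Qed.

Lemma Fterm_value n t d : (0 < n)%N ->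
  Fterm 0 0 n t d = - (n%:R ^+ 2)^-1 * (('C(n.-1 + d, d) * 'C(n, d))%:R * (- cexp (- t)) ^+ d).
Proof. by move=> n0; rewrite /Fterm Fcoef_value // mulrA. Qed.

(** The series in Q is finite: C(n, d) = 0 for d > n, so the partial sums are eventually
    constant. *)
Lemma series_Fterm n t : (0 < n)%N -> series (Fterm 0 0 n t) @ \oo --> psi_coef (- cexp (- t)) n.
Proof.
move=> n0; apply: (@cvgC_near _ (fun=> psi_coef (- cexp (- t)) n) _ _ n.+1); last exact: cvgC_cst.
move=> m nm; rewrite /series /= big_mkord /psi_coef /disk_coef mulr_sumr.
rewrite (big_ord_widen m (fun d => - (n%:R ^+ 2)^-1 * (('C(n.-1 + d, d) * 'C(n, d))%:R * (- cexp (- t)) ^+ d))) //.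
rewrite big_mkcond; apply: eq_bigr => d _; rewrite Fterm_value //; case: ltnP => // nd.
by rewrite [X in (_ * X)%:R]bin_small // muln0 mul0r mulr0.
Qed.

Lemma Psi01_termE t x n : Psi01_term 0 t x n = psi_coef (- cexp (- t)) n * x ^+ n.
Proof.
case: n => [|n]; first by rewrite /psi_coef expr0n invr0 oppr0 !mul0r.
by rewrite /Psi01_term /Fgn (cvgC_lim (@series_Fterm n.+1 t (ltn0Sn n))).
Qed.

Lemma series_Psi01 t x : series (Psi01_term 0 t x) = psq (psi_coef (- cexp (- t))) x.
Proof.
by apply: funext => n; rewrite /series /= big_mkord; apply: eq_bigr => k _; rewrite Psi01_termE.
Qed.

Lemma Psi01E t : Psi01 0 t = psum (psi_coef (- cexp (- t))).
Proof. by apply: funext => x; rewrite /Psi01 series_Psi01. Qed.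

Lemma on_mirror_curveE t x y : on_mirror_curve t x y <->
  y != 0 /\ y ^+ 2 + (x - 1) * y + x * (- cexp (- t)) = 0.
Proof.
split=> -[y0 E]; split=> //.
  by rewrite -[RHS](mulr0 y) -E; field.
by apply: (mulfI y0); rewrite mulr0 -[RHS]E; field.
Qed.
End Assembly.

Theorem theorem6p1 (R : realType) (t : R[i]) :
  (forall n, (0 < n)%N -> cvgn (series (Fterm 0 0 n t))) /\
  exists y : R[i] -> R[i],
    [/\ y 0 = 1,
        \forall x \near (0 : R[i]),
          on_mirror_curve t x (y x) /\ derivable y x 1,
        forall y' : R[i] -> R[i], y' 0 = 1 -> {for 0, continuous y'} ->
          (\forall x \near (0 : R[i]), on_mirror_curve t x (y' x)) ->
          \forall x \near (0 : R[i]), y' x = y x &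
        \forall x \near (0 : R[i]),
          [/\ cvgn (series (Psi01_term 0 t x)),
              derivable (Psi01 0 t) x 1 &
              x * 'D_1 (Psi01 0 t) x = clog (y x)]].
Proof.
split=> [n n0|]; first by apply/cvg_ex; exists (psi_coef (- cexp (- t)) n); exact: series_Fterm.
set Q := - cexp (- t); have r0 := radius_gt0 Q.
have curve x : normc x < radius Q -> on_mirror_curve t x (ycurve Q x).
  move=> xr; apply/on_mirror_curveE; split; first by rewrite y_exp // cexp_neq0.
  exact: y_equation.
exists (ycurve Q); split; first exact: y_at0.
- apply: (near0P _).2; exists (radius Q); first exact: r0.
  move=> x xr; split; first exact: curve.
  by case: (dif_is_derive (dif_y xr)).
- move=> y' y'0 /continuous0P cy' /near0P[r' r'0 Hr'].
  have r00 : normc (0 : R[i]) < radius Q by rewrite normc0.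
  (* A different solution over x would be the other root, with y' + y = 1 - x; this is impossible
     once |y' - 1|, |y - 1| and |x| are all below 1/4. *)
  have e0 : 0 < (1 / 4 : R) by lra.
  have [d d0 Hd] := cy' _ e0; have [d' d'0 Hd'] := dif_cont (dif_y r00) e0.
  apply: (near0P _).2; exists (Num.min (Num.min r' (radius Q)) (Num.min (Num.min d d') (1 / 4))).
    by rewrite !lt_min r'0 r0 d0 d'0.
  move=> x; rewrite !lt_min => /andP[/andP[xr' xr] /andP[/andP[/Hd xd /Hd' xd'] x4]].
  have [_ E] := (on_mirror_curveE _ _ _).1 (Hr' x xr'); have E' := y_equation xr.
  rewrite add0r y_at0 in xd'; rewrite y'0 in xd.
  have : (y' x - ycurve Q x) * (y' x + ycurve Q x + x - 1) = 0.
    transitivity ((y' x ^+ 2 + (x - 1) * y' x + x * - cexp (- t)) - (ycurve Q x ^+ 2 + (x - 1) * ycurve Q x + x * Q)).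
      by rewrite /Q; ring.
    by rewrite E E' subrr.
  move/eqP; rewrite mulf_eq0 subr_eq0 => /orP[/eqP //|/eqP F]; exfalso.
  have : normc ((1 - y' x) - (ycurve Q x - 1) - x) < 1.
    apply: le_lt_trans (le_normcD' _ _) _; rewrite normcN'.
    by apply: le_lt_trans (lerD (le_normcD' _ _) (lexx _)) _; rewrite normcN'; lra.
  have -> : (1 - y' x) - (ycurve Q x - 1) - x = 1 - (y' x + ycurve Q x + x - 1) by ring.
  by rewrite F subr0 normc1 ltxx.
have r00 : normc (0 : R[i]) < radius Q by rewrite normc0.
(* Close to 0 the imaginary part of [log_curve] stays within the principal strip, so [clog] undoes
   [cexp]. *)
have [d d0 Hd] := dif_cont (dif_g r00) (pi_gt0 R).
apply: (near0P _).2; exists (Num.min (radius Q) d); first by rewrite lt_min r0.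
move=> x; rewrite lt_min => /andP[xr /Hd]; rewrite add0r g_at0 subr0 => gpi.
have [l Hl lE] := dif_psi xr; have [D1 D2] := dif_is_derive Hl.
rewrite series_Psi01 Psi01E -/Q; split.
- apply/cvg_ex; exists (psum (psi_coef Q) x).
  exact (psum_cvg (rho_gt0 Q) (geo0 (geo_psi Q)) (ltW xr)).
- exact: D1.
- rewrite D2 lE (y_exp xr) clog_cexp; first by [].
  have := Im_le_normc (log_curve Q x); rewrite ler_norml => /andP[h1 h2].
  by apply/andP; split; [apply: lt_le_trans h1; rewrite ltrN2|apply: le_trans h2 (ltW _)].
Qed.
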